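(* Let $\frac12<\alpha<1$, $\lambda\in(0,1]$, $I\in\mathbb{N}$, and suppose all functions and distributions are space-time periodic. Let $\{f_1(\cdot,a_0),\dots,f_I(\cdot,a_0)\}_{a_0\in[\lambda,1/\lambda]}$ be $I$ families of distributions with $$\|f_i\|_{\alpha-2,1}\le N_i,\quad i=1,\dots,I,$$ for some constants $N_1,\dots,N_I$. For $a_0\in[\lambda,\frac1\lambda]$ let $v_i(\cdot,a_0)$ be the function of vanishing mean solving $$(\partial_2-a_0\partial_1^2)v_i(\cdot,a_0)=Pf_i(\cdot,a_0)\quad\text{distributionally}.$$ Let $u$ be a function modelled after $(v_1,\dots,v_I)$ according to functions $a\in[\lambda,\frac1\lambda]$ and $(\sigma_1,\dots,\sigma_I)$ with modelling constant $M$. Assume that for some constant $N$ $$\sup_{0<T\le1}(T^{1/4})^{2-2\alpha}\Big\|\partial_2u_T-P\Big(a\,\partial_1^2u_T+\sum_i\sigma_iEf_{iT}\Big)\Big\|\le N^2,$$ where $E$ evaluates a function of $(x,a_0)$ at $(x,a(x))$. Then $$M\le C\Big(N^2+[a]_\alpha M+\sum_iN_i\big([\sigma_i]_\alpha+\|\sigma_i\|[a]_\alpha\big)\Big),\qquad[u]_\alpha\le C\Big(M+\sum_iN_i\|\sigma_i\|\Big),$$ with a constant $C$ depending only on $\lambda$ and $\alpha$.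
   Context: Points are $x=(x_1,x_2)\in\mathbb{R}^2$; $d(x,y):=|x_1-y_1|+\sqrt{|x_2-y_2|}$; $[u]_\alpha:=\sup_{x\neq y}|u(x)-u(y)|/d^\alpha(x,y)$; $\|\cdot\|$ is the supremum norm. Space-time periodic: $1$-periodic in $x_1$ and $x_2$; $Pf=f-\int_{[0,1)^2}f$. For $T>0$, $\psi_T$ is the Schwartz function with Fourier transform $\exp(-T(k_1^4+k_2^2))$ and $f_T=(f)_T:=f*\psi_T$ (in the variable $x$). $\|f\|_{\alpha-2}:=\sup_{0<T\le1}(T^{1/4})^{2-\alpha}\|f_T\|$ and, for a family depending on $a_0$, $\|f\|_{\alpha-2,1}:=\sup_{a_0\in[\lambda,1/\lambda]}\max_{i=0,1}\|(\partial/\partial a_0)^if(\cdot,a_0)\|_{\alpha-2}$. Modelledness: $u$ is modelled after $(v_1,\dots,v_I)$ (functions of $(x,a_0)$) according to $a$ and $(\sigma_1,\dots,\sigma_I)$ if there is a (then unique) function $\nu$ such that the modelling constant $$M:=\sup_{x\ne y}\frac{1}{d^{2\alpha}(y,x)}\Big|u(y)-u(x)-\sum_i\sigma_i(x)\big(v_i(y,a(x))-v_i(x,a(x))\big)-\nu(x)(y-x)_1\Big|$$ is finite. *)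

(* Defs.v *)
From HB Require Import structures.
From mathcomp Require Import all_boot all_order all_algebra.
From mathcomp Require Import complex.
From mathcomp Require Import all_classical all_reals all_analysis.

Set Implicit Arguments.
Unset Strict Implicit.
Unset Printing Implicit Defensive.

Import Order.TTheory GRing.Theory Num.Theory.
Import numFieldNormedType.Exports.

Local Open Scope classical_set_scope.
Local Open Scope ring_scope.

Section Plane.
Variable R : realType.
Implicit Types (f g u : R * R -> R) (x y : R * R).

Definition leb2 : {measure set (measurableTypeR R * measurableTypeR R) -> \bar R} :=
  ((@lebesgue_measure R) \x (@lebesgue_measure R))%E.

Definition integral2 f : R := (\int[leb2]_x f x)%R.

Definition unit_square : set (R * R) := `[0, 1[ `*` `[0, 1[.

Definition cell_mean f : R := (\int[leb2]_(x in unit_square) f x)%R.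

Definition e_ (b : bool) : R * R := if b then (0, 1) else (1, 0).

Definition d1 f : R * R -> R := 'D_(e_ false) f.
Definition d2 f : R * R -> R := 'D_(e_ true) f.

(* The iterated partial derivative along a word of directions
   (false = x_1, true = x_2). *)
Definition partials (w : seq bool) f : R * R -> R :=
  foldr (fun b g => 'D_(e_ b) g) f w.

Definition smooth f : Prop :=
  forall w : seq bool, continuous (partials w f) /\
    forall (b : bool) x, derivable (partials w f) x (e_ b).

Definition schwartz f : Prop :=
  smooth f /\
  forall (w : seq bool) (p : nat), exists B : R,
    forall x, (1 + `|x|) ^+ p * `|partials w f x| <= B.

Definition periodic2 f : Prop :=
  forall (b : bool) x, f (x + e_ b) = f x.

Definition cc_dist x y : R :=
  `|x.1 - y.1| + Num.sqrt `|x.2 - y.2|.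

Definition supnorm f : \bar R := ereal_sup [set `|f x|%:E | x in setT].

Definition holder_semi (alpha : R) u : \bar R :=
  ereal_sup [set (`|u p.1 - u p.2| / cc_dist p.1 p.2 `^ alpha)%:E |
             p in [set p : (R * R) * (R * R) | p.1 <> p.2]].

(* P f = f - \int_{[0,1)^2} f *)
Definition proj0 f : R * R -> R := fun x => f x - cell_mean f.

(* Convention: fourier f k = \int f(x) e^{- i k . x} dx. *)
Definition fourier f (k : R * R) : R[i] :=
  Complex (integral2 (fun x => f x * cos (k.1 * x.1 + k.2 * x.2)))
          (- integral2 (fun x => f x * sin (k.1 * x.1 + k.2 * x.2))).

Definition is_kernel (psi : R -> R * R -> R) : Prop :=
  forall T : R, 0 < T -> schwartz (psi T) /\
    forall k : R * R,
      fourier (psi T) k = Complex (expR (- T * (k.1 ^+ 4 + k.2 ^+ 2))) 0.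

(* Distributions are functionals on Schwartz functions, with irrelevant values
   elsewhere; periodic distributions on the plane are automatically tempered. *)
Definition functional := (R * R -> R) -> R.
Implicit Types F G : functional.

Definition tempered F : Prop :=
  (forall (c : R) (phi chi : R * R -> R), schwartz phi -> schwartz chi ->
     F (fun x => c * phi x + chi x) = c * F phi + F chi) /\
  (exists (p m : nat) (K : R), forall (phi : R * R -> R) (B : R),
     schwartz phi ->
     (forall (w : seq bool) x, (size w <= m)%N ->
        (1 + `|x|) ^+ p * `|partials w phi x| <= B) ->
     `|F phi| <= K * B).

Definition periodic_distribution F : Prop :=
  tempered F /\
  forall (b : bool) (phi : R * R -> R), schwartz phi ->
    F (fun x => phi (x + e_ b)) = F phi.

Definition dist_of_fun f : functional :=
  fun phi => integral2 (fun x => f x * phi x).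

Definition dist_conv F (phi : R * R -> R) : R * R -> R :=
  fun x => F (fun y => phi (x - y)).

(* The mean \int_{[0,1)^2} F of a periodic distribution: the unique m such that
   F * phi, for every Schwartz phi, has mean m * \int phi. *)
Definition is_dist_mean F (m : R) : Prop :=
  forall phi : R * R -> R, schwartz phi ->
    cell_mean (dist_conv F phi) = m * integral2 phi.

Definition dist_mean F : R := xget 0 [set m | is_dist_mean F m].

Definition dist_proj0 F : functional :=
  fun phi => F phi - dist_mean F * integral2 phi.

(* (d_2 - a0 d_1^2) F, by duality. *)
Definition heat_op (a0 : R) F : functional :=
  fun phi => F (fun x => - d2 phi x - a0 * d1 (d1 phi) x).

Definition dist_eq F G : Prop :=
  forall phi : R * R -> R, schwartz phi -> F phi = G phi.

(* dF is the a0-derivative of the family F on [lambda, 1/lambda], tested against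
   Schwartz functions and one-sided at the end points. For lambda = 1 the
   interval is a point and there is no constraint on dF. *)
Definition is_family_derivative (lambda : R) (F dF : R -> functional) : Prop :=
  forall (a0 : R) (phi : R * R -> R), a0 \in `[lambda, lambda^-1] ->
    schwartz phi ->
    (F (a0 + h) phi - F a0 phi) / h
      @[h --> within [set h | a0 + h \in `[lambda, lambda^-1]] 0^']
      --> dF a0 phi.

(* sup_{0 < T <= 1} (T^{1/4})^s || g_T || *)
Definition scale_sup (s : R) (g : R -> R * R -> R) : \bar R :=
  ereal_sup [set (((T `^ 4^-1) `^ s)%:E * supnorm (g T))%E |
             T in [set T : R | 0 < T <= 1]].

Section Kernel.
Variable psi : R -> R * R -> R.

Definition mollify F (T : R) : R * R -> R := dist_conv F (psi T).

Definition neg_norm (alpha : R) F : \bar R :=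
  scale_sup (2 - alpha) (mollify F).

Definition neg_norm1 (lambda alpha : R) (F dF : R -> functional) : \bar R :=
  ereal_sup [set maxe (neg_norm alpha (F a0)) (neg_norm alpha (dF a0)) |
             a0 in `[lambda, lambda^-1]].

End Kernel.

(* v is the vanishing-mean solution of (d_2 - a0 d_1^2) v = P F; "function" means
   the continuous representative, as pointwise values of v are used. *)
Definition solves (a0 : R) F (v : R * R -> R) : Prop :=
  [/\ continuous v, periodic2 v, cell_mean v = 0 &
      dist_eq (heat_op a0 (dist_of_fun v)) (dist_proj0 F)].

Definition modelling_constant (alpha : R) (n : nat) u
    (v : 'I_n -> R * R -> R -> R) (a : R * R -> R)
    (sigma : 'I_n -> R * R -> R) (nu : R * R -> R) : \bar R :=
  ereal_sup [set
    let x := p.1 in let y := p.2 in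
    ((cc_dist y x `^ (2 * alpha))^-1 *
     `| u y - u x - \sum_(i < n) sigma i x * (v i y (a x) - v i x (a x))
        - nu x * (y - x).1 |)%:E |
    p in [set p : (R * R) * (R * R) | p.1 <> p.2]].

(* The witness nu is unique because 2 * alpha > 1; M : R encodes finiteness. *)
Definition modelled_with_constant (alpha : R) (n : nat) u
    (v : 'I_n -> R * R -> R -> R) (a : R * R -> R)
    (sigma : 'I_n -> R * R -> R) (M : R) : Prop :=
  exists nu : R * R -> R, modelling_constant alpha u v a sigma nu = M%:E.

End Plane.

(* Main.v *)
Require Import Defs.
From HB Require Import structures.
From mathcomp Require Import all_boot all_order all_algebra.
From mathcomp Require Import complex.
From mathcomp Require Import ring lra.
From mathcomp Require Import all_classical all_reals all_analysis.
From mathcomp Require Import measurable_realfun lebesgue_integral_under.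

Set Implicit Arguments.
Unset Strict Implicit.
Unset Printing Implicit Defensive.

Import Order.TTheory GRing.Theory Num.Theory.
Import numFieldNormedType.Exports.

Local Open Scope classical_set_scope.
Local Open Scope ring_scope.

(* Write psi_T = scal s s^2 psi_1 with s = T^(1/4), and let k_tau be the kernel with
   Fourier transform exp (- tau^4 (a0^2 k1^4 + k2^2)). Since
   a0^2 k1^4 + k2^2 = (a0 k1^2 + i k2) (a0 k1^2 - i k2), the derivative of k_tau in tau
   is 4 tau^3 times the convolution of (d_2 - a0 d_1^2) psi_T, with T = (kappa tau)^4,
   and (d_2 + a0 d_1^2) of a remaining kernel. Hence a bound on
   (d_2 - a0 d_1^2) w_T, modulo constants depending on T, integrates to a bound on
   w - w * k_tau. Taking tau = L |y - x| and Taylor expanding w * k_tau, the terms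
   controlled by the seminorm to be estimated come with a small factor for L large and
   are absorbed. For w = v_i this bounds the Hoelder seminorm of v_i by N_i. For
   w = u - sum_i sigma_i(x0) v_i(., a(x0)) it bounds M: freezing the coefficients at x0
   costs [a]_alpha and [sigma_i]_alpha, by the bounds on [u]_alpha (read off from the
   modelling) and on the a0-derivative of f_i. The kernel psi_1 is determined by its
   Fourier transform, so that constants may depend on it. *)

(** * Lebesgue integration on the plane *)

(** The kernels [psi_T] do not see [a0], while the equation does. Dilating [psi_1] independently in
    the two variables produces the kernel adapted to [a0]; what is left after splitting off [psi_T]
    is again such a dilate, because the exponents of the Fourier transforms add up. Uniformity in
    [a0] then amounts to keeping this rest away from degeneracy. The hypotheses only cover [T <= 1],
    whereas [tau] has to be a large multiple of the distance. Periodicity restricts the argument to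
    distances at most 2, and larger distances are reached by translation. Absorbing a seminorm
    presupposes that it is finite. For [M] this is part of the modelling assumption; for the
    solutions [v_i] it is not known beforehand, which forces a regularized seminorm. The exponent
    [2 * alpha] lies strictly between 1 and 2. Below 2, the Taylor remainder of [w * k_tau] carries
    a negative power of [L]; above 1, the slope of [w * k_tau] at the base point can be compared
    with [nu] at a small distance, again with a small factor in front of [M]. *)

Lemma ge0_integral_scaled_pushforward d1 d2 (X : measurableType d1)
    (Y : measurableType d2) (R : realType) (m : {measure set X -> \bar R})
    (m' : {measure set Y -> \bar R}) (phi : X -> Y)
    (mphi : measurable_fun setT phi) (k : {nonneg R}) (f : Y -> \bar R) :
  (forall A, measurable A -> (k%:num%:E * m (phi @^-1` A))%E = m' A) ->
  measurable_fun setT f -> (forall x, 0 <= f x)%E ->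
  (\int[m']_x f x = k%:num%:E * \int[m]_x f (phi x))%E.
Proof.
move=> m'E mf f0.
pose p : {measure set Y -> \bar R} :=
  measure_function_pushforward__canonical__measure_function_Measure m mphi.
transitivity (\int[mscale k p]_x f x)%E.
  by apply: eq_measure_integral => A mA _; rewrite -m'E.
rewrite ge0_integral_mscale //; congr (_ * _)%E.
exact: (ge0_integral_pushforward mphi).
Qed.

Section Lebesgue2.
Variable R : realType.

Local Notation mu := (@lebesgue_measure R).
Local Notation mR := (measurableTypeR R).
Local Notation mR2 := (measurableTypeR R * measurableTypeR R)%type.
Local Notation meas2 f := (measurable_fun [set: mR2] (f : mR2 -> mR)).

Definition affine1 (s c : R) : mR -> mR := fun x => s * x + c.

Lemma measurable_affine1 (s c : R) : measurable_fun setT (affine1 s c).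
Proof.
apply: (@continuous_measurable_fun R) => x; apply: cvgD; last exact: cvg_cst.
by apply: cvgM; [exact: cvg_cst|exact: cvg_id].
Qed.

(** The rescaled image measure agrees with the Lebesgue measure on the intervals []a, b]], which
    determine it. For negative [s] the preimage is closed on the left and open on the right, with
    the same length. *)
Lemma lebesgue_affine (s c : R) (A : set mR) : s != 0 -> measurable A ->
  (`|s|%:E * mu (affine1 s c @^-1` A))%E = mu A.
Proof.
move=> s0 mA.
have ns0 : 0 < `|s| by rewrite normr_gt0.
have mA1 := measurable_affine1 s c.
pose p : {measure set mR -> \bar R} := measure_function_pushforward__canonical__measure_function_Measure mu mA1.
pose m' : {measure set mR -> \bar R} := mscale (NngNum (normr_ge0 s)) p.
rewrite -[LHS]/(m' A); apply/esym/lebesgue_measure_unique => // _ [[a b] _ <-].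
rewrite /m' /= /mscale /= /pushforward.
have [s_gt0|s_le0] := ltP 0 s.
  have -> : affine1 s c @^-1` `]a, b] = `](a - c) / s, (b - c) / s]%classic.
    apply/seteqP; split=> x /=; rewrite !in_itv /= ltr_pdivrMr // ler_pdivlMr // /affine1 [x * s]mulrC; lra.
  rewrite !lebesgue_measure_itv /= !lte_fin ltr_pM2r ?invr_gt0 // ltrD2r gtr0_norm //.
  case: ifP => _; last by rewrite mule0.
  by rewrite -EFinM; congr _%:E; field; lra.
have s_lt0 : s < 0 by rewrite lt_neqAle s0.
have -> : affine1 s c @^-1` `]a, b] = `[(b - c) / s, (a - c) / s[%classic.
  apply/seteqP; split=> x /=; rewrite !in_itv /= ltr_ndivlMr // ler_ndivrMr // /affine1 [x * s]mulrC; lra.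
rewrite !lebesgue_measure_itv /= !lte_fin ltr_nM2r ?invr_lt0 // ltrD2r ltr0_norm //.
case: ifP => _; last by rewrite mule0.
by rewrite -EFinM; congr _%:E; field; lra.
Qed.

Definition affine2 (s1 s2 c1 c2 : R) : mR2 -> mR2 :=
  fun x => (affine1 s1 c1 x.1, affine1 s2 c2 x.2).

Lemma measurable_affine2 (s1 s2 c1 c2 : R) :
  measurable_fun setT (affine2 s1 s2 c1 c2).
Proof.
apply: measurable_fun_pair.
  by apply: measurableT_comp; [exact: measurable_affine1|exact: measurable_fst].
by apply: measurableT_comp; [exact: measurable_affine1|exact: measurable_snd].
Qed.

Lemma leb2_affine (s1 s2 c1 c2 : R) (A : set mR2) : s1 != 0 -> s2 != 0 ->
  measurable A ->
  (`|s1 * s2|%:E * leb2 R (affine2 s1 s2 c1 c2 @^-1` A))%E = leb2 R A.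
Proof.
move=> s10 s20 mA.
have mA2 := measurable_affine2 s1 s2 c1 c2.
pose p : {measure set mR2 -> \bar R} := measure_function_pushforward__canonical__measure_function_Measure (leb2 R) mA2.
pose m' : {measure set mR2 -> \bar R} := mscale (NngNum (normr_ge0 (s1 * s2))) p.
rewrite -[LHS]/(m' A); apply/esym/product_measure_unique => // B C mB mC.
rewrite /m' /= /mscale /= /pushforward.
have -> : affine2 s1 s2 c1 c2 @^-1` (B `*` C) =
    (affine1 s1 c1 @^-1` B) `*` (affine1 s2 c2 @^-1` C).
  by apply/seteqP; split.
have mp s c (D : set mR) : measurable D -> measurable (affine1 s c @^-1` D).
  by move=> mD; rewrite -[X in measurable X]setTI; apply: measurable_affine1.
rewrite product_measure1E; [|exact: mp|exact: mp].
rewrite normrM EFinM muleACA; congr (_ * _)%E; exact: lebesgue_affine.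
Qed.

Lemma ge0_integral_affine (s1 s2 c1 c2 : R) (f : mR2 -> \bar R) :
  s1 != 0 -> s2 != 0 -> measurable_fun setT f -> (forall x, 0 <= f x)%E ->
  (\int[leb2 R]_x f x = `|s1 * s2|%:E * \int[leb2 R]_x f (affine2 s1 s2 c1 c2 x))%E.
Proof.
move=> s10 s20 mf f0.
apply: (ge0_integral_scaled_pushforward (measurable_affine2 s1 s2 c1 c2)
  (k := NngNum (normr_ge0 (s1 * s2)))) => // A mA.
exact: leb2_affine.
Qed.

Lemma integrable_affine (s1 s2 c1 c2 : R) (f : mR2 -> R) :
  s1 != 0 -> s2 != 0 -> (leb2 R).-integrable setT (EFin \o f) ->
  (leb2 R).-integrable setT (EFin \o (f \o affine2 s1 s2 c1 c2)).
Proof.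
move=> s10 s20 /integrableP[mf fi].
have ns : `|s1 * s2| != 0 by rewrite normr_eq0 mulf_neq0.
apply/integrableP; split.
  by apply: (measurableT_comp mf); exact: measurable_affine2.
move: fi; rewrite (ge0_integral_affine (f := fun x => `|(EFin \o f) x|%E) c1 c2 s10 s20) //; last exact: measurableT_comp.
move=> h; rewrite ltNge leye_eq; apply/negP => /eqP e; move: h.
by rewrite e gt0_muley ?ltxx // lte_fin lt_neqAle eq_sym ns /=.
Qed.

Lemma integral2_affine (s1 s2 c1 c2 : R) (f : mR2 -> R) :
  s1 != 0 -> s2 != 0 -> (leb2 R).-integrable setT (EFin \o f) ->
  integral2 f = `|s1 * s2| * integral2 (f \o affine2 s1 s2 c1 c2).
Proof.
move=> s10 s20 fi.
have fai := integrable_affine c1 c2 s10 s20 fi.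
have mf := measurable_int _ fi.
rewrite /integral2 /Rintegral (integralE _ _ (EFin \o f)) (integralE _ _ (EFin \o (f \o _))).
have mp := measurable_funepos mf; have mn := measurable_funeneg mf.
rewrite (ge0_integral_affine c1 c2 s10 s20 mp) // (ge0_integral_affine c1 c2 s10 s20 mn) //.
have Pf := integrable_pos_fin_num _ fai.
have Nf := integrable_neg_fin_num _ fai.
transitivity (fine (`|s1 * s2|%:E * (\int[leb2 R]_x (EFin \o (f \o affine2 s1 s2 c1 c2))^\+ x) -
    `|s1 * s2|%:E * (\int[leb2 R]_x (EFin \o (f \o affine2 s1 s2 c1 c2))^\- x)))%E.
  by congr (fine (_ * _ - _ * _))%E; apply: eq_integral => x _; rewrite ?funeposE ?funenegE.
by rewrite -(fineK (Pf measurableT)) -(fineK (Nf measurableT)) -!EFinM /= mulrBr.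
Qed.

(** Measurability refers to the product sigma-algebra, generated by rectangles. An open set belongs
    to it as a countable union of boxes with rational centres and radii [1 / (n + 1)]; the boxes not
    contained in the set are replaced by [set0]. *)
Lemma continuous_measurable2 (f : R * R -> R) : continuous f -> meas2 f.
Proof.
move=> /continuousP cf; apply: (measurability _ (RGenOpens.measurableE R)).
move=> _ [_ [a [b ->] <-]]; rewrite setTI.
set U := f @^-1` _.
have oU : open U by exact/cf/interval_open.
pose box (q : rat * rat * nat) : set mR2 :=
  ball (ratr q.1.1 : R) q.2.+1%:R^-1 `*` ball (ratr q.1.2 : R) q.2.+1%:R^-1.
have -> : U = \bigcup_(q : rat * rat * nat) (if `[< box q `<=` U >] then box q else set0).
  apply/seteqP; split=> [x Ux|x [q _]]; last by case: asboolP => // bU /bU.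
  have /nbhs_ballP[e e0 eU] : nbhs x U by exact: open_nbhs_nbhs.
  have e20 : 0 < e / 2 by rewrite divr_gt0.
  have [n _ /(_ n (leqnn n)) /= ne] := near_infty_natSinv_lt (PosNum e20).
  have n0 : 0 < n.+1%:R^-1 :> R by rewrite invr_gt0.
  set dl := n.+1%:R^-1 in n0 ne *.
  have [q1 q1x] : exists q : rat, ratr q \in `]x.1 - dl, x.1 + dl[.
    by apply: rat_in_itvoo; lra.
  have [q2 q2x] : exists q : rat, ratr q \in `]x.2 - dl, x.2 + dl[.
    by apply: rat_in_itvoo; lra.
  move: q1x q2x; rewrite !in_itv /= => /andP[? ?] /andP[? ?].
  exists (q1, q2, n) => //.
  case: asboolP => [_|[]].
    by rewrite /box /ball /= -/dl; split; rewrite /= ltr_norml; apply/andP; split; lra.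
  move=> y [/=]; rewrite /ball /= -/dl => y1 y2; apply: eU.
  move: y1 y2; rewrite !ltr_norml => /andP[? ?] /andP[? ?].
  by split; rewrite /ball /= ltr_norml; apply/andP; split; lra.
apply: countable_bigcupT_measurable => [|q]; first exact: countableP.
case: asboolP => // _; apply: measurableX; apply: open_measurable; exact: ball_open.
Qed.

Lemma integral_oneDsqrV_fin : (\int[mu]_x (oneDsqr x)^-1%:E < +oo)%E.
Proof.
rewrite (@ge0_symfun_integralT R (fun x => (oneDsqr x)^-1)).
- rewrite (_ : [set x | _] = `[0, +oo[%classic); last first.
    by apply/seteqP; split => x/=; rewrite in_itv/= andbT.
  by rewrite integral0y_oneDsqr -EFinM ltry.
- by move=> x; rewrite invr_ge0 addr_ge0 // sqr_ge0.
- exact: continuous_oneDsqrV.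
- by move=> x; rewrite /= /oneDsqr sqrrN.
Qed.

(** The standard integrable majorant. The product form makes its integral factorize under Tonelli,
    and a bound on [(1 + |x|)^4 * |f x|] dominates [f] by a multiple of it, see [wt_lower]. *)
Definition wt (x : R * R) : R := (oneDsqr x.1)^-1 * (oneDsqr x.2)^-1.

Lemma wt_gt0 x : 0 < wt x.
Proof. by rewrite mulr_gt0 // invr_gt0 ltr_pwDl // sqr_ge0. Qed.

Lemma wt_ge0 x : 0 <= wt x. Proof. exact/ltW/wt_gt0. Qed.

Lemma continuous_fst2 : continuous (fst : R * R -> R).
Proof. by move=> x; exact: cvg_fst. Qed.

Lemma continuous_snd2 : continuous (snd : R * R -> R).
Proof. by move=> x; exact: cvg_snd. Qed.

Lemma continuous_wt : continuous wt.
Proof.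
move=> x; apply: cvgM.
  apply: (@cvg_comp _ _ _ fst (fun t : R => (oneDsqr t)^-1) (nbhs x) (nbhs x.1)).
    exact: continuous_fst2.
  exact: continuous_oneDsqrV.
apply: (@cvg_comp _ _ _ snd (fun t : R => (oneDsqr t)^-1) (nbhs x) (nbhs x.2)).
  exact: continuous_snd2.
exact: continuous_oneDsqrV.
Qed.

Lemma integrable_wt : (leb2 R).-integrable setT (EFin \o wt).
Proof.
have mw : meas2 wt by apply: continuous_measurable2; exact: continuous_wt.
apply/integrableP; split; first exact/measurable_EFinP.
under eq_integral do rewrite /= ger0_norm ?wt_ge0 //.
rewrite /leb2 fubini_tonelli1 //=; [|exact/measurable_EFinP|by move=> x; rewrite lee_fin wt_ge0].
rewrite /fubini_F /=.
have i0 := integral_oneDsqrV_fin.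
have mo : measurable_fun setT (fun y : mR => (oneDsqr y)^-1%:E).
  by apply/measurable_EFinP; apply: (@continuous_measurable_fun R); exact: continuous_oneDsqrV.
have o0 : forall y : mR, (0 <= (oneDsqr y)^-1%:E)%E.
  by move=> y; rewrite lee_fin invr_ge0 addr_ge0 // sqr_ge0.
rewrite (eq_integral (fun x : mR => (oneDsqr x)^-1%:E * \int[mu]_y (oneDsqr (y : mR))^-1%:E)%E); last first.
  by move=> x _; rewrite -ge0_integralZl.
rewrite ge0_integralZr //; last by apply: integral_ge0 => y _; exact: o0.
by rewrite lte_mul_pinfty // ?integral_ge0 // ge0_fin_numE // integral_ge0.
Qed.

Definition domd (f : R * R -> R) := exists B : R, forall x, `|f x| <= B * wt x.

Lemma domd_ge0 f : domd f -> exists2 B : R, 0 <= B & forall x, `|f x| <= B * wt x.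
Proof.
case=> B fB; exists `|B| => // x; apply: le_trans (fB x) _.
by rewrite ler_wpM2r ?wt_ge0 // ler_norm.
Qed.

Lemma domd_integrable f : meas2 f -> domd f ->
  (leb2 R).-integrable setT (EFin \o f).
Proof.
move=> mf [B fB].
apply: (@le_integrable _ _ _ (leb2 R) setT measurableT _
  (fun x => (B%:E * (EFin \o wt) x)%E)).
- exact/measurable_EFinP.
- move=> x _ /=; rewrite lee_fin; apply: le_trans (fB x) _.
  exact: ler_norm.
- by apply: integrableZl => //; exact: integrable_wt.
Qed.

End Lebesgue2.

Notation meas2 f :=
  (measurable_fun [set: measurableTypeR _ * measurableTypeR _]
     (f : measurableTypeR _ * measurableTypeR _ -> measurableTypeR _)).
Notation intg f := ((leb2 _).-integrable setT (EFin \o f)).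

(** * Calculus of real-valued integrals over the plane *)

Section Integral2.
Variable R : realType.
Implicit Types f g k w : R * R -> R.

Lemma eq_integral2 f g : f =1 g -> integral2 f = integral2 g.
Proof. by move=> fg; congr integral2; apply/funext. Qed.

Lemma integral2_ge0 f : (forall x, 0 <= f x) -> 0 <= integral2 f.
Proof. by move=> f0; apply: Rintegral_ge0. Qed.

Lemma integral2D f g : intg f -> intg g ->
  integral2 (fun x => f x + g x) = integral2 f + integral2 g.
Proof. by move=> fi gi; exact: RintegralD. Qed.

Lemma integral2B f g : intg f -> intg g ->
  integral2 (fun x => f x - g x) = integral2 f - integral2 g.
Proof. by move=> fi gi; exact: RintegralB. Qed.

Lemma integral2Zl f (c : R) : intg f ->
  integral2 (fun x => c * f x) = c * integral2 f.
Proof. by move=> fi; exact: RintegralZl. Qed.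

Lemma le_integral2 f g : intg f -> intg g -> (forall x, f x <= g x) ->
  integral2 f <= integral2 g.
Proof. by move=> fi gi fg; apply: le_Rintegral. Qed.

Lemma norm_integral2_le f : intg f -> `|integral2 f| <= integral2 (fun x => `|f x|).
Proof. by move=> fi; exact: le_normr_Rintegral. Qed.

Lemma intgD f g : intg f -> intg g -> intg (fun x => f x + g x).
Proof. by move=> fi gi; have := integrableD measurableT fi gi. Qed.

Lemma intgZl f (c : R) : intg f -> intg (fun x => c * f x).
Proof. by move=> fi; have := integrableZl measurableT c fi. Qed.

Lemma intg_norm f : intg f -> intg (fun x => `|f x|).
Proof. by move=> fi; have := integrable_norm fi. Qed.

Lemma intg_meas f : intg f -> meas2 f.
Proof. by move=> fi; apply/measurable_EFinP; exact: measurable_int fi. Qed.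

Lemma intg_le f g : meas2 f -> intg g -> (forall x, `|f x| <= g x) -> intg f.
Proof.
move=> mf gi fg.
apply: (@le_integrable _ _ _ (leb2 R) setT measurableT _ (EFin \o g)) => //.
  exact/measurable_EFinP.
by move=> x _ /=; rewrite lee_fin (le_trans (fg x)) // ler_norm.
Qed.

Lemma norm_integral2_le_dom f g : meas2 f -> intg g ->
  (forall x, `|f x| <= g x) -> `|integral2 f| <= integral2 g.
Proof.
move=> mf gi fg; have fi := intg_le mf gi fg.
by apply: le_trans (norm_integral2_le fi) _; apply: le_integral2 => //; exact: intg_norm.
Qed.

Lemma intg_mulbd f g (B : R) : intg f -> meas2 g -> (forall x, `|g x| <= B) ->
  intg (fun x => g x * f x).
Proof.
move=> fi mg gB; apply: (@intg_le _ (fun x => B * `|f x|)).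
- by apply: measurable_funM => //; exact: intg_meas.
- by apply: intgZl; exact: intg_norm.
- by move=> x; rewrite normrM ler_wpM2r.
Qed.

Lemma integral2_refl_shift f (x : R * R) : intg f ->
  integral2 (fun y => f (x - y)) = integral2 f.
Proof.
move=> fi; rewrite [RHS](integral2_affine (s1 := -1) (s2 := -1) x.1 x.2) ?oppr_eq0 ?oner_eq0 //.
rewrite mulrNN mulr1 normr1 mul1r; apply: eq_integral2 => y /=.
by congr f; rewrite [LHS]surjective_pairing /affine2 /affine1 /= !mulN1r ![- _ + _]addrC.
Qed.

Lemma intg_refl_shift f (x : R * R) : intg f -> intg (fun y => f (x - y)).
Proof.
move=> fi; have := integrable_affine (s1 := -1) (s2 := -1) x.1 x.2 _ _ fi.
rewrite oppr_eq0 oner_eq0 => /(_ isT isT).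
congr (_.-integrable _ _); apply/funext => y /=; congr (f _)%:E.
by rewrite [RHS]surjective_pairing /affine2 /affine1 /= !mulN1r ![- _ + _]addrC.
Qed.

Lemma integral2_shift f (x : R * R) : intg f ->
  integral2 (fun y => f (y + x)) = integral2 f.
Proof.
move=> fi; rewrite [RHS](integral2_affine (s1 := 1) (s2 := 1) x.1 x.2) ?oner_eq0 //.
rewrite mulr1 normr1 mul1r; apply: eq_integral2 => y /=.
by congr f; rewrite [LHS]surjective_pairing /affine2 /affine1 /= !mul1r.
Qed.

Lemma intg_shift f (x : R * R) : intg f -> intg (fun y => f (y + x)).
Proof.
move=> fi; have := integrable_affine (s1 := 1) (s2 := 1) x.1 x.2 _ _ fi.
rewrite oner_eq0 => /(_ isT isT).
congr (_.-integrable _ _); apply/funext => y /=; congr (f _)%:E.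
by rewrite [RHS]surjective_pairing /affine2 /affine1 /= !mul1r.
Qed.

Lemma integral2_scale f (r s : R) : 0 < r -> 0 < s -> intg f ->
  integral2 (fun y => (r * s)^-1 * f (y.1 / r, y.2 / s)) = integral2 f.
Proof.
move=> r0 s0 fi; rewrite [RHS](integral2_affine (s1 := r^-1) (s2 := s^-1) 0 0) ?invr_eq0 ?gt_eqF //.
rewrite integral2Zl; last first.
  have := integrable_affine (s1 := r^-1) (s2 := s^-1) 0 0 _ _ fi.
  rewrite !invr_eq0 !gt_eqF // => /(_ isT isT).
  congr (_.-integrable _ _); apply/funext => y /=; congr (f _)%:E.
  by rewrite /affine2 /affine1 !addr0 ![_^-1 * _]mulrC.
rewrite invfM gtr0_norm ?mulr_gt0 ?invr_gt0 //; congr (_ * _); apply: eq_integral2 => y /=.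
by rewrite /affine2 /affine1 /= !addr0 ![_^-1 * _]mulrC.
Qed.

Lemma intg_scale f (r s : R) : 0 < r -> 0 < s -> intg f ->
  intg (fun y => f (y.1 / r, y.2 / s)).
Proof.
move=> r0 s0 fi; have := integrable_affine (s1 := r^-1) (s2 := s^-1) 0 0 _ _ fi.
rewrite !invr_eq0 !gt_eqF // => /(_ isT isT).
congr (_.-integrable _ _); apply/funext => y /=; congr (f _)%:E.
by rewrite /affine2 /affine1 !addr0 ![_^-1 * _]mulrC.
Qed.

Lemma dominated2 (fn : nat -> R * R -> R) f g : (forall n, meas2 (fn n)) ->
  meas2 f -> intg g -> (forall n x, `|fn n x| <= g x) ->
  (forall x, fn n x @[n --> \oo] --> f x) ->
  integral2 (fn n) @[n --> \oo] --> integral2 f.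
Proof.
move=> mfn mf gi fng fnf.
have fi : intg f.
  apply: (intg_le mf gi) => x.
  have h : `|fn n x| @[n --> \oo] --> `|f x| by apply: cvg_norm; exact: fnf.
  rewrite -(cvg_lim _ h) //; apply: limr_le; first by apply: cvgP h.
  by apply: nearW => n; exact: fng.
apply: fine_cvg.
rewrite fineK; last exact: integrable_fin_num.
apply: (@dominated_cvg _ _ _ (leb2 R) setT measurableT (fun n => EFin \o fn n) (EFin \o f) (EFin \o g)).
- by move=> n; have mn := mfn n; exact/measurable_EFinP.
- by move=> x _; apply: cvg_EFin; [exact: nearW|exact: fnf].
- by [].
- exact: gi.
- by move=> n x _ /=; rewrite lee_fin.
Qed.

End Integral2.

(** * Injectivity of the Fourier transform *)

Section Fourier.
Variable R : realType.
Implicit Types f g h : R * R -> R.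

Lemma cont_cst2 (c : R) : continuous (fun _ : R * R => c).
Proof. by move=> x; exact: cvg_cst. Qed.

Lemma cont_add2 f g : continuous f -> continuous g -> continuous (fun x => f x + g x).
Proof. by move=> cf cg x; apply: cvgD; [exact: cf|exact: cg]. Qed.

Lemma cont_mul2 f g : continuous f -> continuous g -> continuous (fun x => f x * g x).
Proof. by move=> cf cg x; apply: cvgM; [exact: cf|exact: cg]. Qed.

Lemma cont_comp2 (F : R -> R) f : continuous F -> continuous f -> continuous (fun x => F (f x)).
Proof.
move=> cF cf x.
by apply: (@cvg_comp _ _ _ f F (nbhs x) (nbhs (f x))); [exact: cf|exact: cF].
Qed.

Lemma cont_pair2 (F : R * R -> R) f g : continuous F -> continuous f ->
  continuous g -> continuous (fun x => F (f x, g x)).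
Proof.
move=> cF cf cg x.
apply: (@cvg_comp _ _ _ (fun x => (f x, g x)) F (nbhs x) (nbhs (f x, g x))); last exact: cF.
have := cvg_pair (cf x) (cg x). exact.
Qed.

Definition dot (k x : R * R) : R := k.1 * x.1 + k.2 * x.2.

Lemma continuous_dot k : continuous (dot k).
Proof.
by apply: cont_add2; apply: cont_mul2; do ?[exact: cont_cst2|exact: continuous_fst2|exact: continuous_snd2].
Qed.

Lemma continuous_cosdot k : continuous (fun x => cos (dot k x)).
Proof. by apply: cont_comp2; [exact: continuous_cos|exact: continuous_dot]. Qed.

Lemma continuous_sindot k : continuous (fun x => sin (dot k x)).
Proof. by apply: cont_comp2; [exact: continuous_sin|exact: continuous_dot]. Qed.

Definition fcos g (k : R * R) : R := integral2 (fun x => g x * cos (dot k x)).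
Definition fsin g (k : R * R) : R := integral2 (fun x => g x * sin (dot k x)).

Lemma intg_mulc g h (B : R) : intg g -> continuous h -> (forall x, `|h x| <= B) ->
  intg (fun x => g x * h x).
Proof.
move=> gi ch hB; have -> : (fun x => g x * h x) = (fun x => h x * g x).
  by apply/funext => x; rewrite mulrC.
by apply: (intg_mulbd gi _ hB); exact: continuous_measurable2.
Qed.

Lemma norm_cos_le1 (t : R) : `|cos t| <= 1.
Proof. by rewrite ler_norml cos_geN1 cos_le1. Qed.

Lemma norm_sin_le1 (t : R) : `|sin t| <= 1.
Proof. by rewrite ler_norml sin_geN1 sin_le1. Qed.

Lemma intg_cos g k : intg g -> intg (fun x => g x * cos (dot k x)).
Proof.
by move=> gi; apply: (intg_mulc gi (@continuous_cosdot k) (B := 1)) => x; exact: norm_cos_le1.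
Qed.

Lemma intg_sin g k : intg g -> intg (fun x => g x * sin (dot k x)).
Proof.
by move=> gi; apply: (intg_mulc gi (@continuous_sindot k) (B := 1)) => x; exact: norm_sin_le1.
Qed.

Lemma dotD k l x : dot (k.1 + l.1, k.2 + l.2) x = dot k x + dot l x.
Proof. by rewrite /dot /=; ring. Qed.

Lemma dotB k l x : dot (k.1 - l.1, k.2 - l.2) x = dot k x - dot l x.
Proof. by rewrite /dot /=; ring. Qed.

Definition fzero g := forall k, fcos g k = 0 /\ fsin g k = 0.

(* Multiplying by a translated cosine only shifts frequencies. *)
Lemma fzero_mulcos g (l : R * R) (c : R) : intg g -> fzero g ->
  fzero (fun x => g x * cos (dot l x - c)).
Proof.
move=> gi g0 k.
have ic k' : intg (fun x => g x * cos (dot k' x)) by exact: intg_cos.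
have is_ k' : intg (fun x => g x * sin (dot k' x)) by exact: intg_sin.
pose p := (k.1 + l.1, k.2 + l.2); pose m := (k.1 - l.1, k.2 - l.2).
split.
- rewrite /fcos.
  transitivity (integral2 (fun x =>
    ((cos c / 2) * (g x * cos (dot p x)) + (cos c / 2) * (g x * cos (dot m x))) +
    ((sin c / 2) * (g x * sin (dot p x)) + (- (sin c / 2)) * (g x * sin (dot m x))))).
    apply: eq_integral2 => x.
    rewrite /p /m dotD dotB; move: (dot k x) (dot l x) => a b.
    by rewrite !cosD !sinD !cosN !sinN; field.
  rewrite !integral2D ?integral2Zl //; do ?[by apply: intgZl|by apply: intgD; apply: intgZl].
  rewrite -/(fcos g p) -/(fcos g m) -/(fsin g p) -/(fsin g m).
  by have [-> ->] := g0 p; have [-> ->] := g0 m; rewrite !mulr0 !addr0.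
- rewrite /fsin.
  transitivity (integral2 (fun x =>
    ((cos c / 2) * (g x * sin (dot p x)) + (cos c / 2) * (g x * sin (dot m x))) +
    ((- (sin c / 2)) * (g x * cos (dot p x)) + (sin c / 2) * (g x * cos (dot m x))))).
    apply: eq_integral2 => x.
    rewrite /p /m dotD dotB; move: (dot k x) (dot l x) => a b.
    by rewrite !cosD !sinD !cosN !sinN; field.
  rewrite !integral2D ?integral2Zl //; do ?[by apply: intgZl|by apply: intgD; apply: intgZl].
  rewrite -/(fcos g p) -/(fcos g m) -/(fsin g p) -/(fsin g m).
  by have [-> ->] := g0 p; have [-> ->] := g0 m; rewrite !mulr0 !addr0.
Qed.

Lemma continuous_cosdotB l (c : R) : continuous (fun x => cos (dot l x - c)).
Proof.
apply: cont_comp2; first exact: continuous_cos.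
by apply: cont_add2; [exact: continuous_dot|exact: cont_cst2].
Qed.

Lemma fzero_mulcosX g (l : R * R) (c : R) (n : nat) : intg g -> fzero g ->
  intg (fun x => g x * cos (dot l x - c) ^+ n) /\
  fzero (fun x => g x * cos (dot l x - c) ^+ n).
Proof.
move=> gi g0; elim: n => [|n [IHi IH0]].
  by have -> : (fun x => g x * cos (dot l x - c) ^+ 0) = g by apply/funext => x; rewrite expr0 mulr1.
have -> : (fun x => g x * cos (dot l x - c) ^+ n.+1) =
    (fun x => (g x * cos (dot l x - c) ^+ n) * cos (dot l x - c)).
  by apply/funext => x; rewrite exprSr mulrA.
split; last exact: fzero_mulcos.
by apply: (intg_mulc IHi (@continuous_cosdotB l c) (B := 1)) => x; exact: norm_cos_le1.
Qed.

Lemma fzero_integral g : fzero g -> integral2 g = 0.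
Proof.
move=> /(_ (0, 0)) [<- _]; apply: eq_integral2 => x.
by rewrite /dot /= !mul0r addr0 cos0 mulr1.
Qed.

Lemma norm_subX_le (a b : R) (n : nat) : `|a| <= 1 -> `|b| <= 1 ->
  `|a ^+ n - b ^+ n| <= n%:R * `|a - b|.
Proof.
move=> a1 b1; rewrite subrXX normrM mulrC ler_wpM2r //.
apply: le_trans (ler_norm_sum _ _ _) _.
have -> : n%:R = \sum_(i < n) (1 : R) by rewrite sumr_const card_ord.
apply: ler_sum => i _; rewrite normrM !normrX.
by rewrite mulr_ile1 // exprn_ile1.
Qed.

Lemma cvg_divSn (c : R) : c / n.+1%:R @[n --> \oo] --> (0 : R).
Proof.
rewrite -[X in _ --> X](mulr0 c); apply: cvgM; first exact: cvg_cst.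
exact: cvg_harmonic.
Qed.

Lemma cvg_diffquot (F : R -> R) (dF : R) (u : nat -> R) :
  is_derive (0 : R) 1 F dF -> (forall n, u n != 0) -> u n @[n --> \oo] --> (0 : R) ->
  (F (u n) - F 0) / u n @[n --> \oo] --> dF.
Proof.
move=> [dF1 dFE] u0 cu.
have : h^-1 *: ((F \o shift 0) (h *: 1) - F 0) @[h --> 0^'] --> dF.
  by rewrite -dFE; exact: dF1.
move/cvgr_dnbhsP => /(_ u (conj u0 cu)).
apply: cvg_trans; apply: near_eq_cvg; apply: nearW => n /=.
by rewrite addr0 scaler1 [RHS]mulrC.
Qed.

(** Both [cos (y / n)] and [exp (- y^2 / (2 n^2))] equal [1 - y^2 / (2 n^2)] up to [o (n^-2)], so
    [n^2] times their difference tends to 0. As both have modulus at most 1, raising to the power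
    [n^2] multiplies the difference by at most [n^2] ([norm_subX_le]), and the second power is
    constant. *)
Lemma cvg_cosX (y : R) :
  cos (y / n.+1%:R) ^+ (n.+1 ^ 2) @[n --> \oo] --> expR (- (y ^+ 2 / 2)).
Proof.
have [->|y0] := eqVneq y 0.
  under eq_fun do rewrite mul0r cos0 expr1n.
  by rewrite expr0n mul0r oppr0 expR0; exact: cvg_cst.
pose a n : R := cos (y / n.+1%:R).
pose b n : R := expR (- (y ^+ 2 / 2) / n.+1%:R ^+ 2).
have nz n : n.+1%:R != 0 :> R by rewrite pnatr_eq0.
have bX n : b n ^+ (n.+1 ^ 2) = expR (- (y ^+ 2 / 2)).
  by rewrite /b -expRM_natr natrX mulfVK // expf_neq0.
have b1 n : `|b n| <= 1.
  rewrite ger0_norm ?expR_ge0 // -expR0 ler_expR mulNr oppr_le0.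
  by rewrite divr_ge0 ?exprn_ge0 // divr_ge0 // sqr_ge0.
have a1 n : `|a n| <= 1 by exact: norm_cos_le1.
(* By [1 - cos (2 u) = 2 (sin u)^2] the limit reduces to the difference quotient of [sin] at 0,
   squared. *)
have ca : (n.+1 ^ 2)%:R * (a n - 1) @[n --> \oo] --> - (y ^+ 2 / 2).
  pose u n : R := (y / 2) / n.+1%:R.
  have u0 n : u n != 0 by rewrite !mulf_neq0 // ?invr_eq0 // pnatr_eq0.
  have cu : (sin (u n) - sin 0) / u n @[n --> \oo] --> cos (0 : R).
    by apply: (@cvg_diffquot sin _ u) => //; exact: cvg_divSn.
  rewrite (_ : - (y ^+ 2 / 2) = - (y ^+ 2 / 2) * (cos 0 * cos 0)); last first.
    by rewrite cos0 !mulr1.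
  have cc : (fun _ : nat => - (y ^+ 2 / 2)) n @[n --> \oo] --> - (y ^+ 2 / 2) by exact: cvg_cst.
  apply: (cvg_trans _ (cvgM cc (cvgM cu cu))); apply: near_eq_cvg; apply: nearW => n /=.
  have -> : a n = 1 - (sin (u n) ^+ 2) *+ 2.
    rewrite /a (_ : y / _ = u n + u n); last first.
      by rewrite /u; move: (n.+1%:R : R) (nz n) => N0 N0n; field.
    by rewrite cosD -!expr2 cos2sin2; ring.
  rewrite sin0 subr0 natrX -mulr_natr; move: (sin _) => S; rewrite /u.
  by move: (n.+1%:R : R) (nz n) => N0 N0n; field; rewrite ?y0 ?N0n.
have cb : (n.+1 ^ 2)%:R * (b n - 1) @[n --> \oo] --> - (y ^+ 2 / 2).
  pose u n : R := - (y ^+ 2 / 2) / n.+1%:R ^+ 2.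
  have u0 n : u n != 0.
    by rewrite !mulf_neq0 ?invr_eq0 ?oppr_eq0 ?expf_neq0 // mulf_neq0 ?invr_eq0 ?expf_neq0 // pnatr_eq0.
  have cu0 : u n @[n --> \oo] --> (0 : R).
    rewrite -[X in _ --> X](mulr0 0).
    apply: (cvg_trans _ (cvgM (cvg_divSn (- (y ^+ 2 / 2))) (cvg_divSn 1))); apply: near_eq_cvg; apply: nearW => n /=.
    by rewrite /u; move: (n.+1%:R : R) (nz n) => N0 N0n; field.
  have cu : (expR (u n) - expR 0) / u n @[n --> \oo] --> expR (0 : R).
    by apply: (@cvg_diffquot expR _ u).
  rewrite (_ : - (y ^+ 2 / 2) = - (y ^+ 2 / 2) * expR 0); last by rewrite expR0 mulr1.
  have cc : (fun _ : nat => - (y ^+ 2 / 2)) n @[n --> \oo] --> - (y ^+ 2 / 2) by exact: cvg_cst.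
  apply: (cvg_trans _ (cvgM cc cu)); apply: near_eq_cvg; apply: nearW => n /=.
  rewrite expR0 natrX /b -/(u n); move: (expR _) => S; rewrite /u.
  by move: (n.+1%:R : R) (nz n) => N0 N0n; field; rewrite ?y0 ?N0n.
have cab : (n.+1 ^ 2)%:R * `|a n - b n| @[n --> \oo] --> (0 : R).
  have e0 : `|- (y ^+ 2 / 2) - - (y ^+ 2 / 2)| = 0 :> R by rewrite subrr normr0.
  rewrite -[X in _ --> X]e0; apply: (cvg_trans _ (cvg_norm (cvgB ca cb))); apply: near_eq_cvg; apply: nearW => n /=.
  by rewrite !fctE -mulrBr opprB addrA subrK normrM ger0_norm.
have ce : (fun _ : nat => expR (- (y ^+ 2 / 2))) n @[n --> \oo] --> expR (- (y ^+ 2 / 2)) by exact: cvg_cst.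
have cz : (fun _ : nat => 0 : R) n @[n --> \oo] --> (0 : R) by exact: cvg_cst.
apply: cvg_sub0 ce.
apply: norm_cvg0; apply: (squeeze_cvgr _ cz cab).
apply: nearW => n; rewrite normr_ge0 /= !fctE -(bX n).
exact: norm_subX_le (a1 n) (b1 n).
Qed.

Definition gauss2 (x : R * R) : R := expR (- (x.1 ^+ 2 / 2)) * expR (- (x.2 ^+ 2 / 2)).

Lemma cont_pow2 f n : continuous f -> continuous (fun x => f x ^+ n).
Proof.
move=> cf; apply: (@cont_comp2 (fun t : R => t ^+ n) f) => //.
exact: exprn_continuous.
Qed.

Lemma continuous_gauss2 : continuous gauss2.
Proof.
apply: cont_mul2; apply: cont_comp2; try exact: continuous_expR;
 (apply: (@cont_comp2 -%R); first exact: opp_continuous);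
 apply: cont_mul2; try exact: cont_cst2; apply: cont_pow2;
 by [exact: continuous_fst2|exact: continuous_snd2].
Qed.

Lemma gauss2_le_wt x : `|gauss2 x| <= 4 * wt x.
Proof.
rewrite ger0_norm ?mulr_ge0 ?expR_ge0 // /gauss2 /wt (_ : 4 = 2 * 2 :> R); last by ring.
have h (t : R) : expR (- (t ^+ 2 / 2)) <= 2 * (oneDsqr t)^-1.
  have d : 0 < oneDsqr t by rewrite ltr_pwDl // sqr_ge0.
  rewrite expRN ler_pdivlMr // -ler_pdivlMl ?invr_gt0 ?expR_gt0 // invrK mulrC.
  have := expR_ge1Dx (t ^+ 2 / 2); rewrite /oneDsqr; lra.
by rewrite mulrACA ler_pM ?expR_ge0.
Qed.

Lemma domd_intg f : continuous f -> domd f -> intg f.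
Proof. by move=> cf df; apply: domd_integrable => //; exact: continuous_measurable2. Qed.

Lemma intg_gauss2 : intg gauss2.
Proof.
by apply: domd_intg; [exact: continuous_gauss2|exists 4; exact: gauss2_le_wt].
Qed.

(** Positivity suffices to divide by the integral in [fzero_eq0]; it follows from the lower bound
    [exp (-1)] on the closed unit square. *)
Lemma integral2_gauss2_gt0 : 0 < integral2 gauss2.
Proof.
pose A : set (measurableTypeR R) := `[0, 1]%classic.
pose Q : set (measurableTypeR R * measurableTypeR R) := A `*` A.
have mA : measurable A by exact: measurable_itv.
have mQ : measurable Q by exact: measurableX.
have Q1 : leb2 R Q = 1%E.
  have A1 : lebesgue_measure A = 1%E.
    by apply: etrans (lebesgue_measure_itv `[0, 1]) _; rewrite /= lte_fin ltr01 oppr0 adde0.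
  apply: etrans (product_measure1E (@lebesgue_measure R) (@lebesgue_measure R) mA mA) _.
  by apply: etrans (congr2 mule A1 A1) _; rewrite mule1.
have iQ : intg (fun x => expR (- 1) * \1_Q x).
  apply: intgZl; apply/integrableP; split.
    by apply/measurable_EFinP; exact: measurable_indic.
  under eq_integral do rewrite /= ger0_norm //.
  by rewrite integral_indic // setIT Q1 ltry.
apply: lt_le_trans (le_integral2 iQ intg_gauss2 _).
  rewrite integral2Zl; last first.
    apply/integrableP; split.
      by apply/measurable_EFinP; exact: measurable_indic.
    under eq_integral do rewrite /= ger0_norm //.
    by rewrite integral_indic // setIT Q1 ltry.
  rewrite mulr_gt0 ?expR_gt0 // /integral2 /Rintegral integral_indic // setIT Q1 /=.
  exact: ltr01.
move=> x; rewrite indicE; case: (boolP (x \in Q)) => [|_]; last first.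
  by rewrite mulr0 mulr_ge0 // expR_ge0.
rewrite inE mulr1 => -[]; rewrite /A /= !in_itv /= => /andP[x0 x1] /andP[y0 y1].
rewrite /gauss2 -expRD ler_expR.
have : x.1 ^+ 2 <= 1 by rewrite expr_le1.
have : x.2 ^+ 2 <= 1 by rewrite expr_le1.
by lra.
Qed.

(* The products [cos (y1 / n) ^ n^2 * cos (y2 / n) ^ n^2], which are trigonometric
   polynomials, converge boundedly to the Gaussian. *)
Lemma fzero_scaled_gauss g (x0 : R * R) (s : R) : 0 < s -> continuous g ->
  intg g -> fzero g ->
  integral2 (fun y => g (s * y.1 + x0.1, s * y.2 + x0.2) * gauss2 y) = 0.
Proof.
move=> s0 cg gi g0.
pose gs y := g (s * y.1 + x0.1, s * y.2 + x0.2).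
have sn0 : s != 0 by rewrite gt_eqF.
have gsi : intg gs.
  by have := integrable_affine (s1 := s) (s2 := s) x0.1 x0.2 sn0 sn0 gi.
have cgs : continuous gs.
  apply: (@cont_pair2 g (fun y => s * y.1 + x0.1) (fun y => s * y.2 + x0.2)) => //.
    apply: cont_add2; last exact: cont_cst2.
    by apply: cont_mul2; [exact: cont_cst2|exact: continuous_fst2].
  apply: cont_add2; last exact: cont_cst2.
  by apply: cont_mul2; [exact: cont_cst2|exact: continuous_snd2].
pose cn n (t : R) := cos (t / n.+1%:R) ^+ (n.+1 ^ 2).
pose G n y := gs y * (cn n y.1 * cn n y.2).
have ccn n : continuous (cn n).
  move=> t; apply: (@cvg_comp _ _ _ _ (fun z : R => z ^+ (n.+1 ^ 2)) _ (nbhs (cos (t / n.+1%:R)))); last exact: exprn_continuous.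
  apply: (@cvg_comp _ _ _ (fun t : R => t / n.+1%:R) cos _ (nbhs (t / n.+1%:R))); last exact: continuous_cos.
  by apply: cvgM; [exact: cvg_id|exact: cvg_cst].
have ccn2 n : continuous (fun y : R * R => cn n y.1 * cn n y.2).
  by apply: cont_mul2; apply: (@cont_comp2 (cn n)) => //; [exact: continuous_fst2|exact: continuous_snd2].
have cn1 n t : `|cn n t| <= 1 by rewrite normrX exprn_ile1 // norm_cos_le1.
have I0 n : integral2 (G n) = 0.
  (* Undoing the dilation and the translation turns the two powers of cosines into powers of
     translated cosines in the original variable, one along each axis; multiplication by them
     preserves [fzero]. *)
  pose l1 : R * R := (s^-1 / n.+1%:R, 0); pose l2 : R * R := (0, s^-1 / n.+1%:R).
  have [i1 z1] := fzero_mulcosX l1 (s^-1 * x0.1 / n.+1%:R) (n.+1 ^ 2) gi g0.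
  have [i2 z2] := fzero_mulcosX l2 (s^-1 * x0.2 / n.+1%:R) (n.+1 ^ 2) i1 z1.
  have := fzero_integral z2.
  rewrite (integral2_affine (s1 := s) (s2 := s) x0.1 x0.2 sn0 sn0 i2).
  move/eqP; rewrite mulf_eq0 normr_eq0 mulf_eq0 (negbTE sn0) /= => /eqP <-.
  apply: eq_integral2 => y; rewrite /G /gs /= -mulrA /affine2 /affine1 /dot /=.
  rewrite /cn; have N0 : n.+1%:R != 0 :> R by rewrite pnatr_eq0.
  move: (n.+1%:R : R) N0 => N N0.
  by congr (_ * (cos _ ^+ _ * cos _ ^+ _)); field; rewrite ?sn0 ?N0.
have : integral2 (G n) @[n --> \oo] --> integral2 (fun y => gs y * gauss2 y).
  apply: (@dominated2 _ G _ (fun y => `|gs y|)).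
  - by move=> n; apply: continuous_measurable2; apply: cont_mul2.
  - by apply: continuous_measurable2; apply: cont_mul2 => //; exact: continuous_gauss2.
  - exact: intg_norm.
  - move=> n y; rewrite normrM ler_piMr // normrM mulr_ile1 //.
  - move=> y; apply: cvgM; first exact: cvg_cst.
    by apply: cvgM; exact: cvg_cosX.
move/cvg_lim => <- //.
have -> : (fun n => integral2 (G n)) = cst 0 by apply/funext.
by rewrite lim_cst.
Qed.

Lemma wt_le1 (x : R * R) : wt x <= 1.
Proof. by rewrite mulr_ile1 ?invr_ge0 ?addr_ge0 ?sqr_ge0 // invf_le1 ?ltr_pwDl ?sqr_ge0 // lerDl sqr_ge0. Qed.

(** The Gaussian averages of [g] around [x] at width [1 / (n + 1)] all vanish, while by continuity
    and dominated convergence they tend to [g x] times the positive integral of [gauss2]. *)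
Lemma fzero_eq0 g : continuous g -> domd g -> fzero g -> forall x, g x = 0.
Proof.
move=> cg dg g0 x.
have gi : intg g by exact: domd_intg.
have [B B0 gB] := domd_ge0 dg.
pose G n y := g (n.+1%:R^-1 * y.1 + x.1, n.+1%:R^-1 * y.2 + x.2) * gauss2 y.
have : integral2 (G n) @[n --> \oo] --> integral2 (fun y => g x * gauss2 y).
  apply: (@dominated2 _ G _ (fun y => B * gauss2 y)).
  - move=> n; apply: continuous_measurable2; apply: cont_mul2; last exact: continuous_gauss2.
    apply: (@cont_pair2 g (fun y => n.+1%:R^-1 * y.1 + x.1) (fun y => n.+1%:R^-1 * y.2 + x.2)) => //.
      apply: cont_add2; last exact: cont_cst2.
      by apply: cont_mul2; [exact: cont_cst2|exact: continuous_fst2].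
    apply: cont_add2; last exact: cont_cst2.
    by apply: cont_mul2; [exact: cont_cst2|exact: continuous_snd2].
  - by apply: continuous_measurable2; apply: cont_mul2; [exact: cont_cst2|exact: continuous_gauss2].
  - exact: intgZl intg_gauss2.
  - move=> n y; rewrite normrM [X in _ * X]ger0_norm; last by rewrite mulr_ge0 // expR_ge0.
    rewrite ler_wpM2r //; first by rewrite mulr_ge0 // expR_ge0.
    by apply: le_trans (gB _) _; rewrite ler_piMr // wt_le1.
  - move=> y; apply: cvgM; last exact: cvg_cst.
    apply: (@cvg_comp _ _ _ (fun n => (n.+1%:R^-1 * y.1 + x.1, n.+1%:R^-1 * y.2 + x.2)) g _ (nbhs x)); last exact: cg.
    rewrite [X in _ `=>` nbhs X](_ : x = (0 * y.1 + x.1, 0 * y.2 + x.2)); last first.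
      by rewrite !mul0r !add0r -surjective_pairing.
    have h (c d : R) : n.+1%:R^-1 * c + d @[n --> \oo] --> 0 * c + d.
      apply: cvgD; last exact: cvg_cst.
      by apply: cvgM; [exact: cvg_harmonic|exact: cvg_cst].
    exact: cvg_pair (h y.1 x.1) (h y.2 x.2).
have -> : (fun n => integral2 (G n)) = cst 0.
  by apply/funext => n; apply: fzero_scaled_gauss => //; rewrite invr_gt0.
move/cvg_lim => /(_ (@Rhausdorff R)); rewrite lim_cst // integral2Zl; last exact: intg_gauss2.
move/esym/eqP; rewrite mulf_eq0 => /orP[/eqP //|/eqP e].
by have := integral2_gauss2_gt0; rewrite e ltxx.
Qed.

Lemma fourier_inj f g : continuous f -> continuous g -> domd f -> domd g ->
  (forall k, fcos f k = fcos g k /\ fsin f k = fsin g k) -> f = g.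
Proof.
move=> cf cg df dg fg; apply/funext => x; apply/eqP; rewrite -subr_eq0; apply/eqP.
have fi := domd_intg cf df; have gi := domd_intg cg dg.
apply: (@fzero_eq0 (fun x => f x - g x)).
- by move=> y; apply: cvgB; [exact: cf|exact: cg].
- have [B fB] := df; have [B' gB] := dg; exists (B + B') => y.
  by rewrite mulrDl (le_trans (ler_normB _ _)) // lerD.
- move=> k; have [fgc fgs] := fg k; split.
    rewrite /fcos; under eq_integral2 do rewrite mulrBl.
    by rewrite integral2B; [apply/eqP; rewrite subr_eq0; apply/eqP|exact: intg_cos|exact: intg_cos].
  rewrite /fsin; under eq_integral2 do rewrite mulrBl.
  by rewrite integral2B; [apply/eqP; rewrite subr_eq0; apply/eqP|exact: intg_sin|exact: intg_sin].
Qed.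

End Fourier.

(** * Schwartz functions and convolution *)

Section Schwartz.
Variable R : realType.
Implicit Types f g k w : R * R -> R.

Lemma is_derive_mull (c t : R) : is_derive t 1 (fun s : R => c * s) c.
Proof.
have h := @is_deriveZ _ _ _ (@id R) c t 1 1 (is_derive_id t 1).
have -> : (fun s : R => c * s) = c *: (@id R) by [].
by apply: is_derive_eq; rewrite /GRing.scale /= mulr1.
Qed.

(** Directional derivatives in the plane become derivatives of functions of one real variable along
    a line, where the chain rule and the mean value theorem apply. *)
Lemma slice_quotient k (x v : R * R) (t : R) :
  (fun h : R => h^-1 *: (((fun s : R => k (x + s *: v)) \o shift t) (h *: 1) - k (x + t *: v))) =
  (fun h : R => h^-1 *: ((k \o shift (x + t *: v)) (h *: v) - k (x + t *: v))).
Proof.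
apply/funext => h /=; congr (_ *: (k _ - _)).
by rewrite scaler1 scalerDl addrCA.
Qed.

Lemma slice_derivable k (x v : R * R) (t : R) : derivable k (x + t *: v) v ->
  is_derive t 1 (fun s => k (x + s *: v)) ('D_v k (x + t *: v)).
Proof.
by move=> dk; split; rewrite /derivable /derive slice_quotient.
Qed.

Lemma derivable_slice k (x v : R * R) (d : R) :
  is_derive (0 : R) 1 (fun s : R => k (x + s *: v)) d -> is_derive x v k d.
Proof.
move=> [dk dkE].
have e := slice_quotient k x v 0; rewrite scale0r addr0 in e.
split; first by rewrite /derivable -e; move: dk; rewrite /derivable scale0r addr0.
by rewrite /derive -e -dkE /derive scale0r addr0.
Qed.

Lemma partials_cat (u w : seq bool) f : partials (u ++ w) f = partials u (partials w f).
Proof. by rewrite /partials foldr_cat. Qed.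

Lemma partials_cons b (w : seq bool) f : partials (b :: w) f = 'D_(e_ R b) (partials w f).
Proof. by []. Qed.

Lemma schwartz_partials (u : seq bool) f : schwartz f -> schwartz (partials u f).
Proof.
move=> [sf bf]; split=> [w|w p]; first by rewrite -partials_cat; exact: sf.
by have [B fB] := bf (w ++ u) p; exists B => x; rewrite -partials_cat.
Qed.

Lemma schwartz_continuous f : schwartz f -> continuous f.
Proof. by case=> /(_ [::]) []. Qed.

Lemma schwartz_derivable f b x : schwartz f -> derivable f x (e_ R b).
Proof. by case=> /(_ [::]) [_ h] _; exact: h. Qed.

Lemma schwartz_is_derive f b x : schwartz f -> is_derive x (e_ R b) f ('D_(e_ R b) f x).
Proof. by move=> sf; apply/derivableP; exact: schwartz_derivable. Qed.

Lemma schwartz_bound f (p : nat) : schwartz f ->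
  exists2 B : R, 0 <= B & forall x, (1 + `|x|) ^+ p * `|f x| <= B.
Proof.
case=> _ /(_ [::] p) [B fB]; exists B => //.
by apply: le_trans (fB 0); rewrite mulr_ge0 // exprn_ge0 // addr_ge0.
Qed.

Lemma partials_lin (w : seq bool) (c : R) f g : smooth f -> smooth g ->
  partials w (fun x => c * f x + g x) = fun x => c * partials w f x + partials w g x.
Proof.
move=> sf sg; elim: w => [//|b w IH].
rewrite !partials_cons IH; apply/funext => x.
have [_ /(_ b x) df] := sf w; have [_ /(_ b x) dg] := sg w.
have h := is_deriveD (is_deriveZ c (derivableP df)) (derivableP dg).
exact: (@derive_val _ _ _ _ _ _ _ h).
Qed.

Lemma schwartz_lin (c : R) f g : schwartz f -> schwartz g ->
  schwartz (fun x => c * f x + g x).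
Proof.
move=> [sf bf] [sg bg]; split=> [w|w p].
  rewrite partials_lin //; have [cf df] := sf w; have [cg dg] := sg w; split.
    by apply: cont_add2 => //; apply: cont_mul2 => //; exact: cont_cst2.
  by move=> b x; apply: derivableD => //; apply: derivableZ.
have [B fB] := bf w p; have [B' gB] := bg w p; exists (`|c| * B + B') => x.
rewrite partials_lin //.
have e0 : 0 <= (1 + `|x|) ^+ p by rewrite exprn_ge0 // addr_ge0.
apply: (@le_trans _ _ (`|c| * ((1 + `|x|) ^+ p * `|partials w f x|) + (1 + `|x|) ^+ p * `|partials w g x|)).
  rewrite mulrCA -mulrDr ler_wpM2l // -normrM; exact: ler_normD.
by rewrite lerD // ler_wpM2l.
Qed.

Lemma partials_cst0 (w : seq bool) : partials w (fun _ : R * R => 0) = (fun _ => 0).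
Proof.
elim: w => [//|b w IH]; rewrite partials_cons IH; apply/funext => x.
exact: derive_cst.
Qed.

Lemma schwartz0 : schwartz (fun _ : R * R => 0).
Proof.
split=> [w|w p]; rewrite partials_cst0.
  by split; [exact: cont_cst2|move=> b x; exact: derivable_cst].
by exists 0 => x; rewrite normr0 mulr0.
Qed.

Lemma schwartzZ (c : R) f : schwartz f -> schwartz (fun x => c * f x).
Proof.
move=> sf; have := schwartz_lin c sf schwartz0.
by congr schwartz; apply/funext => x; rewrite addr0.
Qed.

Lemma schwartzB f g : schwartz f -> schwartz g -> schwartz (fun x => f x - g x).
Proof.
move=> sf sg; have := schwartz_lin (-1) sg sf.
by congr schwartz; apply/funext => x; rewrite mulN1r addrC.
Qed.

(** One family covers the dilations of kernels, the reflection in the first variable, and the map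
    [y |-> x - y] occurring in convolutions. *)
Definition aff (s1 s2 : R) (c x : R * R) : R * R := (s1 * x.1 + c.1, s2 * x.2 + c.2).

Lemma affE s1 s2 c : aff s1 s2 c = affine2 s1 s2 c.1 c.2.
Proof. by []. Qed.

Lemma continuous_aff (s1 s2 : R) c k : continuous k -> continuous (fun x => k (aff s1 s2 c x)).
Proof.
move=> ck; apply: (@cont_pair2 _ k (fun x => s1 * x.1 + c.1) (fun x => s2 * x.2 + c.2)) => //.
  apply: cont_add2; last exact: cont_cst2.
  by apply: cont_mul2; [exact: cont_cst2|exact: continuous_fst2].
apply: cont_add2; last exact: cont_cst2.
by apply: cont_mul2; [exact: cont_cst2|exact: continuous_snd2].
Qed.

Definition sel (s1 s2 : R) (b : bool) : R := if b then s2 else s1.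

Lemma aff_slice s1 s2 c x b (t : R) :
  aff s1 s2 c (x + t *: e_ R b) = aff s1 s2 c x + (sel s1 s2 b * t) *: e_ R b.
Proof.
rewrite /aff /e_ /sel; case: x => x1 x2; case: b => /=; apply/pair_equal_spec => /=; split;
 rewrite /GRing.scale /=; ring.
Qed.

Lemma derive_aff s1 s2 c k x b : derivable k (aff s1 s2 c x) (e_ R b) ->
  is_derive x (e_ R b) (fun x => k (aff s1 s2 c x))
    (sel s1 s2 b * 'D_(e_ R b) k (aff s1 s2 c x)).
Proof.
move=> dk; apply: derivable_slice.
have -> : (fun s : R => k (aff s1 s2 c (x + s *: e_ R b))) =
    (fun s => k (aff s1 s2 c x + s *: e_ R b)) \o (fun t => sel s1 s2 b * t).
  by apply/funext => s; rewrite aff_slice.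
have h : is_derive (sel s1 s2 b * 0) 1 (fun s => k (aff s1 s2 c x + s *: e_ R b))
    ('D_(e_ R b) k (aff s1 s2 c x)).
  rewrite mulr0; have := @slice_derivable k (aff s1 s2 c x) (e_ R b) 0.
  by rewrite scale0r addr0 => /(_ dk).
have hg : is_derive (0 : R) 1 (fun t : R => sel s1 s2 b * t) (sel s1 s2 b).
  exact: is_derive_mull.
by rewrite mulrC; exact: (is_derive1_comp h hg).
Qed.

Fixpoint selw (s1 s2 : R) (w : seq bool) : R :=
  if w is b :: w' then sel s1 s2 b * selw s1 s2 w' else 1.

Lemma partials_aff s1 s2 c k (w : seq bool) : smooth k ->
  partials w (fun x => k (aff s1 s2 c x)) =
  fun x => selw s1 s2 w * partials w k (aff s1 s2 c x).
Proof.
move=> sk; elim: w => [|b w IH]; first by apply/funext => x; rewrite mul1r.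
rewrite !partials_cons IH; apply/funext => x.
have [_ /(_ b (aff s1 s2 c x)) dw] := sk w.
have dd := derive_aff dw.
rewrite -[LHS]/('D_(e_ R b) (selw s1 s2 w *: (fun x => partials w k (aff s1 s2 c x))) x).
rewrite deriveZ; last by case: dd.
by rewrite (@derive_val _ _ _ _ _ _ _ dd) /= /GRing.scale /= mulrCA mulrA.
Qed.

Lemma aff_norm s1 s2 c : s1 != 0 -> s2 != 0 ->
  exists2 K : R, 0 <= K & forall x, 1 + `|x| <= K * (1 + `|aff s1 s2 c x|).
Proof.
move=> s10 s20.
exists (1 + `|s1|^-1 * (1 + `|c|) + `|s2|^-1 * (1 + `|c|)).
  by rewrite !addr_ge0 // mulr_ge0 ?invr_ge0 // addr_ge0.
move=> x; set y := aff s1 s2 c x.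
have n1 (z : R * R) : `|z.1| <= `|z| by rewrite /Num.norm /= le_max lexx.
have n2 (z : R * R) : `|z.2| <= `|z| by rewrite /Num.norm /= le_max lexx orbT.
have h (s t d D : R) : s != 0 -> `|d| <= D -> `|t| <= `|s|^-1 * (`|s * t + d| + D).
  move=> s0 dD; rewrite -ler_pdivrMl ?invr_gt0 ?normr_gt0 // invrK -normrM.
  rewrite -[X in `|X| <= _](addrK d) (le_trans (ler_normB _ _)) //.
  by rewrite lerD2l.
have h1 := h s1 x.1 c.1 `|c| s10 (n1 c).
have h2 := h s2 x.2 c.2 `|c| s20 (n2 c).
have y1 : `|s1 * x.1 + c.1| <= `|y| by exact: (n1 y).
have y2 : `|s2 * x.2 + c.2| <= `|y| by exact: (n2 y).
have i1 : 0 <= `|s1|^-1 by rewrite invr_ge0.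
have i2 : 0 <= `|s2|^-1 by rewrite invr_ge0.
have y0 : 0 <= `|y| by [].
have c0 : 0 <= `|c| by [].
have X1 : `|x.1| <= `|s1|^-1 * (`|y| + `|c|).
  by apply: le_trans h1 _; rewrite ler_wpM2l // lerD2r.
have X2 : `|x.2| <= `|s2|^-1 * (`|y| + `|c|).
  by apply: le_trans h2 _; rewrite ler_wpM2l // lerD2r.
have : `|x| <= `|s1|^-1 * (`|y| + `|c|) + `|s2|^-1 * (`|y| + `|c|).
  rewrite [`|x|]/Num.norm /= ge_max; apply/andP; split.
    by apply: le_trans X1 _; rewrite lerDl mulr_ge0 // addr_ge0.
  by apply: le_trans X2 _; rewrite lerDr mulr_ge0 // addr_ge0.
move: (`|s1|^-1) (`|s2|^-1) (`|y|) (`|c|) (`|x|) i1 i2 y0 c0 => a b Y Cc X a0 b0 Y0 C0 H.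
have : 0 <= a * (Cc * Y) by rewrite !mulr_ge0.
have : 0 <= b * (Cc * Y) by rewrite !mulr_ge0.
nra.
Qed.

Lemma schwartz_aff s1 s2 c k : s1 != 0 -> s2 != 0 -> schwartz k ->
  schwartz (fun x => k (aff s1 s2 c x)).
Proof.
move=> s10 s20 [sk bk]; split=> [w|w p]; rewrite partials_aff //.
  have [ck dk] := sk w; split.
    by apply: cont_mul2; [exact: cont_cst2|exact: continuous_aff].
  move=> b x; apply: derivableZ.
  by case: (derive_aff (dk b (aff s1 s2 c x))).
have [B kB] := bk w p; have [K K0 xK] := aff_norm c s10 s20.
exists (K ^+ p * (`|selw s1 s2 w| * B)) => x.
rewrite normrM.
apply: (@le_trans _ _ ((K * (1 + `|aff s1 s2 c x|)) ^+ p * (`|selw s1 s2 w| * `|partials w k (aff s1 s2 c x)|))).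
  by rewrite ler_wpM2r ?mulr_ge0 // lerXn2r ?nnegrE ?mulr_ge0 ?addr_ge0.
rewrite exprMn -mulrA ler_wpM2l ?exprn_ge0 // mulrCA ler_wpM2l //.
Qed.

End Schwartz.

(** * Convolution of bounded functions with Schwartz kernels *)

Section Convolution.
Variable R : realType.
Implicit Types f g k w : R * R -> R.

Lemma le_of_eq (a b : R) : a = b -> a <= b.
Proof. by move->. Qed.

Lemma norm_fst_le (x : R * R) : `|x.1| <= `|x|.
Proof. by rewrite [`|x|]/Num.norm /= le_max lexx. Qed.

Lemma norm_snd_le (x : R * R) : `|x.2| <= `|x|.
Proof. by rewrite [`|x|]/Num.norm /= le_max lexx orbT. Qed.

Lemma wt_lower (x : R * R) : 1 <= (1 + `|x|) ^+ 4 * wt x.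
Proof.
rewrite /wt -invfM -ler_pdivrMr ?invr_gt0 ?mulr_gt0 ?ltr_pwDl ?sqr_ge0 // invrK mul1r.
rewrite (_ : (1 + `|x|) ^+ 4 = (1 + `|x|) ^+ 2 * (1 + `|x|) ^+ 2); last by ring.
have h (t : R) : `|t| <= `|x| -> oneDsqr t <= (1 + `|x|) ^+ 2.
  move=> tx; rewrite /oneDsqr -(real_normK (num_real t)).
  have : `|t| ^+ 2 <= `|x| ^+ 2 by rewrite lerXn2r ?nnegrE.
  have : 0 <= `|x| by [].
  by move: (`|t| ^+ 2) => T; nra.
by rewrite ler_pM ?addr_ge0 ?sqr_ge0 // h // ?norm_fst_le ?norm_snd_le.
Qed.

Lemma domd_of_weight f (B : R) : (forall x, (1 + `|x|) ^+ 4 * `|f x| <= B) ->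
  forall x, `|f x| <= B * wt x.
Proof.
move=> fB x; have w0 := wt_ge0 x.
apply: le_trans (ler_wpM2r w0 (fB x)); rewrite mulrAC ler_peMl //.
exact: wt_lower.
Qed.

Lemma schwartz_domd f : schwartz f -> domd f.
Proof.
move=> sf; have [B B0 fB] := schwartz_bound 4 sf.
by exists B; exact: domd_of_weight.
Qed.

Lemma schwartz_meas f : schwartz f -> meas2 f.
Proof. by move=> sf; apply: continuous_measurable2; exact: schwartz_continuous. Qed.

Lemma schwartz_intg f : schwartz f -> intg f.
Proof. by move=> sf; apply: domd_integrable; [exact: schwartz_meas|exact: schwartz_domd]. Qed.

Definition bounded2 w := exists B : R, forall x, `|w x| <= B.

(** Unfolds to the same integral as [dist_conv (dist_of_fun w) k], so that the mollification of a
    function is an instance by computation. *)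
Definition convol w k (x : R * R) : R := integral2 (fun y => w y * k (x - y)).

Lemma meas2_refl_shift f (x : R * R) : meas2 f -> meas2 (fun y => f (x - y)).
Proof.
move=> mf; have := measurableT_comp mf (measurable_affine2 (-1) (-1) x.1 x.2).
apply: eq_measurable_fun => y _ /=; congr f.
by rewrite [RHS]surjective_pairing /affine2 /affine1 /= !mulN1r ![- _ + _]addrC.
Qed.

Lemma intg_bd_mul w f : meas2 w -> bounded2 w -> intg f -> intg (fun x => w x * f x).
Proof. by move=> mw [B wB] fi; exact: intg_mulbd fi mw wB. Qed.

Lemma bounded2_refl_shift w (x : R * R) : bounded2 w -> bounded2 (fun y => w (x - y)).
Proof. by move=> [B wB]; exists B => y. Qed.

Lemma intg_conv w k x : meas2 w -> bounded2 w -> intg k ->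
  intg (fun y => w y * k (x - y)).
Proof. by move=> mw bw ik; apply: intg_bd_mul => //; exact: intg_refl_shift. Qed.

Lemma intg_conv2 w k x : meas2 w -> bounded2 w -> intg k ->
  intg (fun z => w (x - z) * k z).
Proof.
move=> mw bw ik; apply: intg_bd_mul => //; first exact: meas2_refl_shift.
exact: bounded2_refl_shift.
Qed.

Lemma convE w k x : meas2 w -> bounded2 w -> intg k ->
  convol w k x = integral2 (fun z => w (x - z) * k z).
Proof.
move=> mw bw ik; rewrite /convol -[LHS](integral2_refl_shift x); last exact: intg_conv.
by apply: eq_integral2 => z; rewrite opprB addrCA subrr addr0.
Qed.

Lemma conv_bound w k (G : R * R -> R) x : meas2 w -> bounded2 w -> intg k ->
  intg (fun z => G z * `|k z|) -> (forall z, `|w (x - z)| <= G z) ->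
  `|convol w k x| <= integral2 (fun z => G z * `|k z|).
Proof.
move=> mw bw ik iG wG; rewrite convE //; apply: norm_integral2_le_dom => //.
- apply: measurable_funM; first exact: meas2_refl_shift.
  exact: intg_meas.
- by move=> z; rewrite normrM ler_wpM2r.
Qed.

Lemma conv_bounded w k : meas2 w -> bounded2 w -> intg k -> bounded2 (convol w k).
Proof.
move=> mw [B wB] ik; exists (integral2 (fun z => B * `|k z|)) => x.
apply: conv_bound => //; first by exists B.
by apply: intgZl; exact: intg_norm.
Qed.

Lemma conv_subcst w k (c : R) x : meas2 w -> bounded2 w -> intg k ->
  convol (fun y => w y - c) k x = convol w k x - c * integral2 k.
Proof.
move=> mw bw ik; rewrite /convol -(integral2_refl_shift x ik) -integral2Zl; last exact: intg_refl_shift.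
rewrite -integral2B; [|exact: intg_conv|by apply: intgZl; exact: intg_refl_shift].
by apply: eq_integral2 => y; rewrite mulrBl.
Qed.

Lemma conv_linr w k1 k2 (c : R) x : meas2 w -> bounded2 w -> intg k1 -> intg k2 ->
  convol w (fun z => c * k1 z + k2 z) x = c * convol w k1 x + convol w k2 x.
Proof.
move=> mw bw i1 i2; rewrite /convol -integral2Zl; last exact: intg_conv.
rewrite -integral2D; [|by apply: intgZl; exact: intg_conv|exact: intg_conv].
by apply: eq_integral2 => y; rewrite mulrDr mulrCA.
Qed.

Lemma conv_linl w1 w2 k (c : R) x : meas2 w1 -> bounded2 w1 -> meas2 w2 ->
  bounded2 w2 -> intg k ->
  convol (fun z => c * w1 z + w2 z) k x = c * convol w1 k x + convol w2 k x.
Proof.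
move=> m1 b1 m2 b2 ik; rewrite /convol -integral2Zl; last exact: intg_conv.
rewrite -integral2D; [|by apply: intgZl; exact: intg_conv|exact: intg_conv].
by apply: eq_integral2 => y; rewrite mulrDl mulrA.
Qed.

(** A multiplicative form of the triangle inequality: it lets polynomial weights pass through
    translations and split over convolutions. *)
Lemma weight_shift (x z : R * R) : 1 + `|x| <= (1 + `|z|) * (1 + `|x + z|).
Proof.
have : `|x| <= `|x + z| + `|z| by rewrite -{1}(addrK z x) ler_normB.
have : 0 <= `|z| * `|x + z| by rewrite mulr_ge0.
by rewrite mulrDl !mulrDr; lra.
Qed.

(** Provides a majorant that is integrable and uniform over shifts of size at most 1, as
    differentiation under the convolution integral requires. *)
Lemma schwartz_shift_dom k : schwartz k ->
  exists2 B : R, 0 <= B & forall x z, `|z| <= 1 -> `|k (x + z)| <= B * wt x.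
Proof.
move=> sk; have [B B0 kB] := schwartz_bound 4 sk.
exists (2 ^+ 4 * B); first by rewrite mulr_ge0 // exprn_ge0.
move=> x z z1; have := @domd_of_weight (fun x => k (x + z)) (2 ^+ 4 * B) _ x.
apply => y; apply: le_trans (ler_wpM2l (exprn_ge0 4 (ler0n R 2)) (kB (y + z))).
rewrite mulrA -exprMn ler_wpM2r // lerXn2r ?nnegrE ?mulr_ge0 ?addr_ge0 //.
apply: le_trans (weight_shift y z) _; rewrite ler_wpM2r ?addr_ge0 //.
by move: z1; lra.
Qed.

Lemma e_norm b : `|e_ R b| = 1.
Proof.
by case: b; rewrite -[LHS]/(Num.max _ _) /= normr0 normr1; [apply: max_r|apply: max_l].
Qed.

Lemma derive_integral2 (F dF : R -> R * R -> R) (G : R * R -> R) (a d : R) :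
  0 < d -> (forall t, a - d < t < a + d -> intg (F t)) ->
  (forall t y, a - d < t < a + d -> is_derive t 1 (F ^~ y) (dF t y)) ->
  intg G -> (forall t y, a - d < t < a + d -> `|dF t y| <= G y) ->
  is_derive a 1 (fun t => integral2 (F t)) (integral2 (dF a)).
Proof.
move=> d0 iF dF1 iG dFG.
have adI : a - d < a < a + d by apply/andP; split; lra.
have G0 y : 0 <= G y by apply: le_trans (dFG a y adI).
have dE t y : a - d < t < a + d -> partial1of2 F t y = dF t y.
  by move=> tI; rewrite partial1of2E (@derive_val _ _ _ _ _ _ _ (dF1 t y tI)).
have h := @cvg_differentiation_under_integral R _ _ (leb2 R) F setT measurableT a
  (a - d) (a + d).
have {}h := h _ _ _ G G0 iG.
have aI : `]a - d, a + d[%classic a by rewrite /= in_itv.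
have {}h := h aI.
have iF' x : `]a - d, a + d[%classic x -> intg (F x) by rewrite /= in_itv /= => /iF.
have {}h := h iF'.
have dF' x y : `]a - d, a + d[%classic x -> setT y -> derivable (F ^~ y) x 1.
  by rewrite /= in_itv /= => xI _; case: (dF1 x y xI).
have {}h := h dF'.
have G' x y : `]a - d, a + d[%classic x -> setT y -> `|partial1of2 F x y| <= G y.
  by rewrite /= in_itv /= => xI _; rewrite dE // dFG.
have {}h := h G'.
have e : \int[leb2 R]_(y in setT) partial1of2 F a y = integral2 (dF a).
  by apply: eq_Rintegral => y _; rewrite dE.
rewrite e in h.
have {}h : h^-1 *: (((fun t => integral2 (F t)) \o shift a) (h *: 1) - integral2 (F a)) @[h --> 0^'] --> integral2 (dF a).
  apply: cvg_trans h; apply: near_eq_cvg; apply: nearW => s /=.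
  by rewrite scaler1.
split; first by apply/cvg_ex; exists (integral2 (dF a)).
exact: cvg_lim h.
Qed.

Lemma conv_is_derive w k b x : meas2 w -> bounded2 w -> schwartz k ->
  is_derive x (e_ R b) (convol w k) (convol w ('D_(e_ R b) k) x).
Proof.
move=> mw bw sk; apply: derivable_slice.
have sdk : schwartz ('D_(e_ R b) k) by exact: (schwartz_partials [:: b]).
have [D D0 kD] := schwartz_shift_dom sdk.
have [B wB] := bw.
have B0 : 0 <= B by apply: le_trans (wB 0).
pose F (t : R) (y : R * R) := w y * k (x + t *: e_ R b - y).
pose dF (t : R) (y : R * R) := w y * 'D_(e_ R b) k (x + t *: e_ R b - y).
pose G (y : R * R) := B * (D * wt (x - y)).
have -> : convol w ('D_(e_ R b) k) x = integral2 (dF 0).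
  by apply: eq_integral2 => y; rewrite /dF scale0r addr0.
apply: (@derive_integral2 F dF G 0 1) => //.
- by move=> t _; apply: intg_conv => //; exact: schwartz_intg.
- move=> t y _; rewrite /F /dF.
  have -> : (fun s : R => w y * k (x + s *: e_ R b - y)) =
     (fun s : R => w y * k (x - y + s *: e_ R b)).
    by apply/funext => s; rewrite addrAC.
  rewrite addrAC.
  have := @slice_derivable R k (x - y) (e_ R b) t (schwartz_derivable sk).
  by move/(is_deriveZ (w y)).
- by do 2 apply: intgZl; apply: intg_refl_shift; exact: integrable_wt.
- move=> t y; rewrite sub0r add0r => /andP[t1 t2].
  rewrite /dF /G normrM ler_pM // addrAC kD // normrZ e_norm mulr1 ler_norml.
  by apply/andP; split; exact: ltW.
Qed.

Lemma slice_lipschitz (F dF : R -> R) (a b B : R) :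
  (forall t : R, is_derive t 1 F (dF t)) ->
  (forall t, (a <= t <= b) || (b <= t <= a) -> `|dF t| <= B) ->
  `|F b - F a| <= B * `|b - a|.
Proof.
move=> hF hB.
have cF (c d : R) : {within `[c, d], continuous F}.
  apply: derivable_within_continuous => t _; exact: ex_derive.
have [ab|ba|->] := ltgtP a b; last by rewrite !subrr normr0 mulr0.
- have [c /andP[]] := @MVT R F dF a b ab (fun t _ => hF t) (cF a b).
  rewrite !bnd_simp => ac cb ->; rewrite normrM ler_wpM2r // hB //.
  by rewrite (ltW ac) (ltW cb).
- have [c /andP[]] := @MVT R F dF b a ba (fun t _ => hF t) (cF b a).
  rewrite !bnd_simp => bc ca; rewrite distrC => ->; rewrite normrM [`|b - a|]distrC ler_wpM2r // hB //.
  by rewrite (ltW bc) (ltW ca) orbT.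
Qed.

Lemma is_derive_slice1 (F F1 : R * R -> R) (x2 t : R) :
  is_derive (t, x2) (e_ R false) F (F1 (t, x2)) ->
  is_derive t 1 (fun s => F (s, x2)) (F1 (t, x2)).
Proof.
move=> [d e]; have := @slice_derivable R F (0, x2) (e_ R false) t.
have E (s : R) : ((0, x2) : R * R) + s *: e_ R false = (s, x2).
  by apply/pair_equal_spec; rewrite /= /GRing.scale /=; split; ring.
rewrite E => /(_ d); rewrite e.
by under eq_fun do rewrite E.
Qed.

Lemma is_derive_slice2 (F F2 : R * R -> R) (x1 t : R) :
  is_derive (x1, t) (e_ R true) F (F2 (x1, t)) ->
  is_derive t 1 (fun s => F (x1, s)) (F2 (x1, t)).
Proof.
move=> [d e]; have := @slice_derivable R F (x1, 0) (e_ R true) t.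
have E (s : R) : ((x1, 0) : R * R) + s *: e_ R true = (x1, s).
  by apply/pair_equal_spec; rewrite /= /GRing.scale /=; split; ring.
rewrite E => /(_ d); rewrite e.
by under eq_fun do rewrite E.
Qed.

(** The path from [x] to [y] runs parallel to the axes, first in the first variable at height [x.2],
    then in the second at abscissa [y.1]. Bounds on the partial derivatives are asked on this path
    only, so that it can be kept inside a ball. *)
Lemma lipschitz2 (F F1 F2 : R * R -> R) (x y : R * R) (B1 B2 : R) :
  (forall z, is_derive z (e_ R false) F (F1 z)) ->
  (forall z, is_derive z (e_ R true) F (F2 z)) ->
  (forall t, (x.1 <= t <= y.1) || (y.1 <= t <= x.1) -> `|F1 (t, x.2)| <= B1) ->
  (forall t, (x.2 <= t <= y.2) || (y.2 <= t <= x.2) -> `|F2 (y.1, t)| <= B2) ->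
  `|F y - F x| <= B1 * `|y.1 - x.1| + B2 * `|y.2 - x.2|.
Proof.
move=> h1 h2 b1 b2; case: x b1 b2 => x1 x2; case: y => y1 y2 /= b1 b2.
have l1 := slice_lipschitz (fun t : R => is_derive_slice1 (h1 (t, x2))) b1.
have l2 := slice_lipschitz (fun t : R => is_derive_slice2 (h2 (y1, t))) b2.
rewrite (_ : F (y1, y2) - F (x1, x2) = (F (y1, x2) - F (x1, x2)) + (F (y1, y2) - F (y1, x2))); last by ring.
by apply: le_trans (ler_normD _ _) _; rewrite lerD.
Qed.

Lemma continuous_lipschitz2 (F : R * R -> R) (B : R) :
  (forall x y, `|F y - F x| <= B * (`|y.1 - x.1| + `|y.2 - x.2|)) -> continuous F.
Proof.
move=> hF x; apply/cvgrPdist_le => e e0.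
have B1 : 0 < `|B| + 1 by rewrite ltr_wpDl.
have d0 : 0 < e / (`|B| + 1) / 2 by rewrite !divr_gt0.
near=> y; rewrite distrC; apply: le_trans (hF x y) _.
have y1 : `|y.1 - x.1| <= e / (`|B| + 1) / 2.
  by rewrite distrC ltW //; near: y; move/cvgrPdist_lt: (@continuous_fst2 R x); apply.
have y2 : `|y.2 - x.2| <= e / (`|B| + 1) / 2.
  by rewrite distrC ltW //; near: y; move/cvgrPdist_lt: (@continuous_snd2 R x); apply.
apply: (@le_trans _ _ ((`|B| + 1) * (`|y.1 - x.1| + `|y.2 - x.2|))).
  by rewrite ler_wpM2r ?addr_ge0 // (le_trans (ler_norm B)) // lerDl.
rewrite -ler_pdivlMl // mulrC; move: y1 y2; lra.
Unshelve. all: by end_near. Qed.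

Lemma conv_continuous w k : meas2 w -> bounded2 w -> schwartz k -> continuous (convol w k).
Proof.
move=> mw bw sk.
have d b z := conv_is_derive b z mw bw sk.
have bd b : bounded2 (convol w ('D_(e_ R b) k)).
  by apply: conv_bounded => //; apply: schwartz_intg; exact: (schwartz_partials [:: b]).
have [B1 h1] := bd false; have [B2 h2] := bd true.
apply: (@continuous_lipschitz2 _ (B1 + B2)) => x y.
have B10 : 0 <= B1 by apply: le_trans (h1 0).
have B20 : 0 <= B2 by apply: le_trans (h2 0).
apply: le_trans (lipschitz2 (d false) (d true) (fun t _ => h1 _) (fun t _ => h2 _)) _.
rewrite mulrDl !mulrDr.
have : 0 <= B1 * `|y.2 - x.2| by rewrite mulr_ge0.
have : 0 <= B2 * `|y.1 - x.1| by rewrite mulr_ge0.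
by lra.
Qed.

(** The weight splits as [1 + |x| <= (1 + |y|) * (1 + |x - y|)]. Of the eight powers of decay taken
    from [k1], four pay for this weight and four for integrability in [y]. *)
Lemma conv_domd k1 k2 : schwartz k1 -> schwartz k2 -> domd (convol k1 k2).
Proof.
move=> s1 s2; have [B1 B10 h1] := schwartz_bound 8 s1.
have [B2 B20 h2] := schwartz_bound 4 s2.
exists (integral2 (fun y => B1 * B2 * wt y)) => x.
apply: (@domd_of_weight (convol k1 k2)) => {}x.
have e0 : 0 <= (1 + `|x|) ^+ 4 by rewrite exprn_ge0 // addr_ge0.
have mB : bounded2 k1.
  exists B1 => y; apply: le_trans (h1 y); rewrite ler_peMl // exprn_ege1 //.
  by rewrite lerDl.
rewrite -[X in X * _](ger0_norm e0) -normrM /convol -integral2Zl; last first.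
  by apply: intg_conv => //; [exact: schwartz_meas|exact: schwartz_intg].
apply: norm_integral2_le_dom.
- apply: measurable_funM => //; apply: measurable_funM; first exact: schwartz_meas.
  by apply: meas2_refl_shift; exact: schwartz_meas.
- by apply: intgZl; exact: integrable_wt.
- move=> y; rewrite normrM [X in X * _ <= _]ger0_norm // normrM.
  have xy : 1 + `|x| <= (1 + `|y|) * (1 + `|x - y|).
    by rewrite -(normrN y); exact: weight_shift.
  have y0 : 0 <= 1 + `|y| by rewrite addr_ge0.
  have xy0 : 0 <= 1 + `|x - y| by rewrite addr_ge0.
  have k1y : (1 + `|y|) ^+ 4 * `|k1 y| <= B1 * wt y.
    have e y' : 0 <= (1 + `|y' : R * R|) ^+ 4 by rewrite exprn_ge0 // addr_ge0.
    have := @domd_of_weight (fun y => (1 + `|y|) ^+ 4 * k1 y) B1 _ y.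
    rewrite normrM ger0_norm //; apply => y'.
    by rewrite normrM ger0_norm // mulrA -exprD; exact: h1.
  apply: (@le_trans _ _ ((1 + `|y|) ^+ 4 * `|k1 y| * ((1 + `|x - y|) ^+ 4 * `|k2 (x - y)|))).
    rewrite [leRHS]mulrACA -[X in _ <= X * _]exprMn ler_wpM2r ?mulr_ge0 // lerXn2r ?nnegrE ?mulr_ge0 ?addr_ge0 //.
  rewrite [leRHS]mulrAC ler_pM ?mulr_ge0 ?exprn_ge0 //.
Qed.

Lemma fubini_Rintegral d (T : measurableType d)
    (m : {sigma_finite_measure set T -> \bar R}) (H : T -> T -> R) (K : T -> R) :
  measurable_fun setT (fun pq : T * T => (H pq.1 pq.2)%:E) ->
  (forall p, m.-integrable setT (EFin \o H p)) ->
  (forall q, m.-integrable setT (EFin \o (H ^~ q))) ->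
  m.-integrable setT (EFin \o K) -> (forall p, 0 <= K p) ->
  (forall p, \int[m]_q `|H p q| <= K p) ->
  \int[m]_p (\int[m]_q (H p q)) = \int[m]_q (\int[m]_p (H p q)).
Proof.
move=> mE i1 i2 iK K0 HK.
have iH : (m \x m)%E.-integrable setT (fun pq : T * T => (H pq.1 pq.2)%:E).
  apply/(integrable12ltyP m m mE).
  apply: (@le_lt_trans _ _ (\int[m]_p (K p)%:E)%E); last first.
    move/integrableP: iK => [mK]; apply: le_lt_trans; apply: ge0_le_integral => //.
    - by move=> p _; rewrite lee_fin.
    - by apply: measurableT_comp.
    - by move=> p _; rewrite /= lee_fin ler_norm.
  apply: ge0_le_integral => //.
  - by move=> p _; apply: integral_ge0.
  - have ma : measurable_fun setT (fun pq : T * T => `|(H pq.1 pq.2)%:E|%E) by exact: measurableT_comp.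
    exact: (@measurable_fun_fubini_tonelli_F _ _ T T R m _ ma).
  - exact: measurable_int iK.
  - move=> p _ /=; have := HK p; rewrite -lee_fin; apply: le_trans.
    rewrite /Rintegral fineK //.
    exact: (integrable_fin_num measurableT (integrable_norm (i1 p))).
have := Fubini iH => /=.
rewrite (eq_integral (fun p => (\int[m]_q (H p q))%:E)); last first.
  by move=> p _; rewrite /Rintegral fineK //; exact: (integrable_fin_num measurableT (i1 p)).
rewrite [RHS](eq_integral (fun q => (\int[m]_p (H p q))%:E)); last first.
  by move=> q _; rewrite /Rintegral fineK //; exact: (integrable_fin_num measurableT (i2 q)).
by move=> e; rewrite [LHS]/Rintegral [RHS]/Rintegral e.
Qed.

Lemma leb2_sigma_finite : sigma_finite setT (leb2 R).
Proof.
exists (fun n => `[- n%:R, n%:R]%classic `*` `[- n%:R, n%:R]%classic).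
  apply/seteqP; split=> // -[x y] _.
  have [n nxy] : exists n : nat, Num.max `|x| `|y| <= n%:R.
    by exists (Num.bound (Num.max `|x| `|y|)); rewrite ltW // archi_boundP // le_max normr_ge0.
  move: nxy; rewrite ge_max !ler_norml => /andP[/andP[a b] /andP[c d]].
  by exists n => //; split; rewrite /= in_itv /=; apply/andP.
move=> n; pose N : R := n%:R; pose A : set (measurableTypeR R) := `[- N, N]%classic.
have mA : measurable A by exact: measurable_itv.
split; first exact: measurableX.
have A1 : (lebesgue_measure A < +oo)%E.
  have -> : lebesgue_measure A = (if (- N)%:E < N%:E then N%:E - (- N)%:E else 0)%E.
    exact: (lebesgue_measure_itv `[- N, N]).
  by case: ifP => _; rewrite -?EFinB ltry.
have -> : leb2 R (A `*` A) = (lebesgue_measure A * lebesgue_measure A)%E.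
  exact: (product_measure1E (@lebesgue_measure R) (@lebesgue_measure R) mA mA).
by rewrite lte_mul_pinfty // ge0_fin_numE.
Qed.

(* [leb2] is a packed measure; the sigma-finiteness instance needs a function as key. *)
Definition leb2sf : set (measurableTypeR R * measurableTypeR R) -> \bar R := leb2 R.
HB.instance Definition _ := Measure.copy leb2sf (leb2 R).
HB.instance Definition _ := Measure_isSigmaFinite.Build _ _ _ leb2sf leb2_sigma_finite.

(** A majorant of convolution form has inner integral [F p] times the integral of [G], hence is
    integrable over the product. The bound [BG] gives integrability in [p] for each fixed [q]. *)
Lemma fubini_conv (H : R * R -> R * R -> R) (F G : R * R -> R) (BG : R) :
  measurable_fun [set: (measurableTypeR R * measurableTypeR R) * (measurableTypeR R * measurableTypeR R)]
    (fun pq => H pq.1 pq.2 : measurableTypeR R) ->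
  intg F -> intg G -> (forall x, 0 <= F x) -> (forall x, 0 <= G x <= BG) ->
  (forall p q, `|H p q| <= F p * G (q - p)) ->
  integral2 (fun p => integral2 (H p)) = integral2 (fun q => integral2 (fun p => H p q)).
Proof.
move=> mH iF iG F0 G0 HFG.
have m1 p : meas2 (H p).
  by have := measurable_fun_pair2 p mH.
have m2 q : meas2 (fun p => H p q).
  by have := measurable_fun_pair1 q mH.
have i1 p : intg (H p).
  apply: (@intg_le _ (H p) (fun q => F p * G (q - p))) => //.
  by apply: intgZl; exact: (intg_shift (- p)).
have i2 q : intg (fun p => H p q).
  apply: (@intg_le _ _ (fun p => BG * F p)) => //; first exact: intgZl.
  move=> p; apply: le_trans (HFG p q) _; rewrite mulrC ler_wpM2r //.
  by have /andP[] := G0 (q - p).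
have mE : measurable_fun [set: (measurableTypeR R * measurableTypeR R) * (measurableTypeR R * measurableTypeR R)]
    (fun pq => (H pq.1 pq.2)%:E) by exact/measurable_EFinP.
apply: (@fubini_Rintegral _ _ leb2sf H (fun p => integral2 G * F p)) => //.
- exact: intgZl.
- by move=> p; rewrite mulr_ge0 // integral2_ge0 // => y; have /andP[] := G0 y.
- move=> p.
  have := le_integral2 (intg_norm (i1 p)) (intgZl (F p) (intg_shift (- p) iG)) (HFG p).
  rewrite integral2Zl; last exact: (intg_shift (- p)).
  by rewrite (integral2_shift (- p) iG) mulrC.
Qed.

Lemma measurable_sub2 :
  measurable_fun [set: (measurableTypeR R * measurableTypeR R) * (measurableTypeR R * measurableTypeR R)]
    (fun pq => (pq.2.1 - pq.1.1, pq.2.2 - pq.1.2) : measurableTypeR R * measurableTypeR R).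
Proof.
have m1 := @measurable_fst _ _ (measurableTypeR R) (measurableTypeR R).
have m2 := @measurable_snd _ _ (measurableTypeR R) (measurableTypeR R).
have M1 := @measurable_fst _ _ (measurableTypeR R * measurableTypeR R)%type (measurableTypeR R * measurableTypeR R)%type.
have M2 := @measurable_snd _ _ (measurableTypeR R * measurableTypeR R)%type (measurableTypeR R * measurableTypeR R)%type.
apply: measurable_fun_pair.
  exact: (@measurable_funB _ _ R setT _ _ (measurableT_comp m1 M2) (measurableT_comp m1 M1)).
exact: (@measurable_funB _ _ R setT _ _ (measurableT_comp m2 M2) (measurableT_comp m2 M1)).
Qed.

Lemma measurable_conv_kernel (h f k : R * R -> R) : meas2 h -> meas2 f -> meas2 k ->
  measurable_fun [set: (measurableTypeR R * measurableTypeR R) * (measurableTypeR R * measurableTypeR R)]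
    (fun pq => h pq.2 * f pq.1 * k (pq.2 - pq.1) : measurableTypeR R).
Proof.
move=> mh mf mk; apply: measurable_funM; last exact: (measurableT_comp mk measurable_sub2).
apply: measurable_funM.
  by apply: (measurableT_comp mh); exact: measurable_snd.
by apply: (measurableT_comp mf); exact: measurable_fst.
Qed.

Lemma schwartz_bounded k : schwartz k -> bounded2 k.
Proof.
by move=> sk; have [B B0 kB] := schwartz_bound 0 sk; exists B => x; have := kB x; rewrite expr0 mul1r.
Qed.

(** Testing a convolution against a bounded [h]. With [h] a cosine or a sine of [dot l], the
    addition formulas turn this into the convolution theorem for the Fourier transform. *)
Lemma integral_conv (h f k : R * R -> R) : meas2 h -> bounded2 h -> intg f ->
  schwartz k ->
  integral2 (fun x => h x * convol f k x) =
  integral2 (fun y => f y * integral2 (fun x => h (x + y) * k x)).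
Proof.
move=> mh [B hB] fi sk; have [Bk kB] := schwartz_bounded sk.
have ik := schwartz_intg sk.
have B0 : 0 <= B by apply: le_trans (hB 0).
transitivity (integral2 (fun x => integral2 (fun y => h x * f y * k (x - y)))).
  apply: eq_integral2 => x; rewrite /convol -integral2Zl; last first.
    have -> : (fun y => f y * k (x - y)) = (fun y => k (x - y) * f y) by apply/funext => y; rewrite mulrC.
    apply: intg_bd_mul => //; first by apply: meas2_refl_shift; exact: schwartz_meas.
    by exists Bk => y.
  by apply: eq_integral2 => y; rewrite mulrA.
rewrite -(@fubini_conv (fun y x => h x * f y * k (x - y)) (fun y => B * `|f y|) (fun x => `|k x|) Bk) //.
- apply: eq_integral2 => y; rewrite -integral2Zl; last first.
    apply: intg_bd_mul => //; last by exists B => x.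
    have := measurableT_comp mh (measurable_affine2 1 1 y.1 y.2).
    apply: eq_measurable_fun => x _ /=; congr h.
    by rewrite [RHS]surjective_pairing /affine2 /affine1 /= !mul1r.
  rewrite -[LHS](integral2_shift y); last first.
    apply: intg_bd_mul; [|by exists (B * `|f y|) => x; rewrite normrM ler_wpM2r|exact: (intg_shift (- y))].
    by apply: measurable_funM.
  by apply: eq_integral2 => x; rewrite addrK mulrAC mulrA mulrC mulrA.
- by apply: measurable_conv_kernel => //; [exact: intg_meas|exact: schwartz_meas].
- by apply: intgZl; exact: intg_norm.
- exact: intg_norm.
- by move=> x; rewrite mulr_ge0.
- by move=> x; rewrite normr_ge0 kB.
- by move=> p q; rewrite !normrM ler_wpM2r // ler_wpM2r.
Qed.

Lemma convolA w k1 k2 x : meas2 w -> bounded2 w -> schwartz k1 -> schwartz k2 ->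
  convol (convol w k1) k2 x = convol w (convol k1 k2) x.
Proof.
move=> mw bw s1 s2.
have [B wB] := bw; have B0 : 0 <= B by apply: le_trans (wB 0).
have i1 := schwartz_intg s1; have i2 := schwartz_intg s2.
have [B1 k1B] := schwartz_bounded s1.
rewrite /convol.
transitivity (integral2 (fun y => integral2 (fun z => w z * k2 (x - y) * k1 (y - z)))).
  apply: eq_integral2 => y; rewrite mulrC -integral2Zl; last exact: intg_conv.
  by apply: eq_integral2 => z; rewrite mulrA [k2 _ * _]mulrC.
rewrite (@fubini_conv (fun y z => w z * k2 (x - y) * k1 (y - z)) (fun y => B * `|k2 (x - y)|) (fun z => `|k1 (- z)|) B1) //.
- apply: eq_integral2 => z.
  have ii : intg (fun y => k1 y * k2 (x - z - y)).
    by apply: intg_conv => //; [exact: schwartz_meas|exact: schwartz_bounded].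
  rewrite -(integral2_shift (- z) ii) -integral2Zl; last exact: (intg_shift (- z) ii).
  by apply: eq_integral2 => y; rewrite opprB addrA subrK -mulrA [k2 _ * _]mulrC.
- have mk : meas2 (fun y => k2 (x - y)) by apply: meas2_refl_shift; exact: schwartz_meas.
  have mk1 : meas2 (fun y => k1 (0 - y)) by apply: meas2_refl_shift; exact: schwartz_meas.
  have := measurable_conv_kernel mw mk mk1.
  by apply: eq_measurable_fun => pq _ /=; rewrite sub0r opprB.
- by apply: intgZl; apply: intg_norm; exact: intg_refl_shift.
- apply: intg_norm; have := intg_refl_shift 0 i1.
  by congr (_.-integrable _ _); apply/funext => z /=; rewrite sub0r.
- by move=> y; rewrite mulr_ge0.
- by move=> z; rewrite normr_ge0 k1B.
- by move=> y z; rewrite !normrM opprB ler_wpM2r // ler_wpM2r.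
Qed.

End Convolution.

(** * Fourier transform and dilations *)

Section FourierRules.
Variable R : realType.
Implicit Types f g k w : R * R -> R.

Lemma dotDr (l x y : R * R) : dot l (x + y) = dot l x + dot l y.
Proof. by rewrite /dot /=; ring. Qed.

Lemma dotNr (l x : R * R) : dot l (- x) = - dot l x.
Proof. by rewrite /dot /=; ring. Qed.

Lemma dotBr (l x y : R * R) : dot l (x - y) = dot l x - dot l y.
Proof. by rewrite dotDr dotNr. Qed.

Lemma meas_cosdot (l : R * R) : meas2 (fun x => cos (dot l x)).
Proof. by apply: continuous_measurable2; exact: continuous_cosdot. Qed.

Lemma meas_sindot (l : R * R) : meas2 (fun x => sin (dot l x)).
Proof. by apply: continuous_measurable2; exact: continuous_sindot. Qed.

Lemma bounded_cosdot (l : R * R) : bounded2 (fun x => cos (dot l x)).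
Proof. by exists 1 => x; exact: norm_cos_le1. Qed.

Lemma bounded_sindot (l : R * R) : bounded2 (fun x => sin (dot l x)).
Proof. by exists 1 => x; exact: norm_sin_le1. Qed.

Lemma fcos_lin (c : R) f g l : intg f -> intg g ->
  fcos (fun x => c * f x + g x) l = c * fcos f l + fcos g l.
Proof.
move=> fi gi; rewrite /fcos -integral2Zl; last exact: intg_cos.
rewrite -integral2D; [|by apply: intgZl; exact: intg_cos|exact: intg_cos].
by apply: eq_integral2 => x; rewrite mulrDl mulrA.
Qed.

Lemma fsin_lin (c : R) f g l : intg f -> intg g ->
  fsin (fun x => c * f x + g x) l = c * fsin f l + fsin g l.
Proof.
move=> fi gi; rewrite /fsin -integral2Zl; last exact: intg_sin.
rewrite -integral2D; [|by apply: intgZl; exact: intg_sin|exact: intg_sin].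
by apply: eq_integral2 => x; rewrite mulrDl mulrA.
Qed.

Lemma fcos_Z (c : R) f l : intg f -> fcos (fun x => c * f x) l = c * fcos f l.
Proof.
move=> fi; rewrite /fcos -integral2Zl; last exact: intg_cos.
by apply: eq_integral2 => x; rewrite mulrA.
Qed.

Lemma fsin_Z (c : R) f l : intg f -> fsin (fun x => c * f x) l = c * fsin f l.
Proof.
move=> fi; rewrite /fsin -integral2Zl; last exact: intg_sin.
by apply: eq_integral2 => x; rewrite mulrA.
Qed.

Lemma fcos_shift k l y : intg k ->
  integral2 (fun x => cos (dot l (x + y)) * k x) =
  cos (dot l y) * fcos k l - sin (dot l y) * fsin k l.
Proof.
move=> ki; rewrite /fcos /fsin -!integral2Zl; [|exact: intg_sin|exact: intg_cos].
rewrite -integral2B; [|by apply: intgZl; exact: intg_cos|by apply: intgZl; exact: intg_sin].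
by apply: eq_integral2 => x; rewrite dotDr cosD; ring.
Qed.

Lemma fsin_shift k l y : intg k ->
  integral2 (fun x => sin (dot l (x + y)) * k x) =
  sin (dot l y) * fcos k l + cos (dot l y) * fsin k l.
Proof.
move=> ki; rewrite /fcos /fsin -!integral2Zl; [|exact: intg_sin|exact: intg_cos].
rewrite -integral2D; [|by apply: intgZl; exact: intg_cos|by apply: intgZl; exact: intg_sin].
by apply: eq_integral2 => x; rewrite dotDr sinD; ring.
Qed.

Lemma fcos_conv k1 k2 l : schwartz k1 -> schwartz k2 ->
  fcos (convol k1 k2) l = fcos k1 l * fcos k2 l - fsin k1 l * fsin k2 l.
Proof.
move=> s1 s2; have i1 := schwartz_intg s1; have i2 := schwartz_intg s2.
transitivity (integral2 (fun x => cos (dot l x) * convol k1 k2 x)).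
  by apply: eq_integral2 => x; rewrite mulrC.
rewrite (integral_conv (@meas_cosdot l) (@bounded_cosdot l) i1 s2).
transitivity (integral2 (fun y => fcos k2 l * (k1 y * cos (dot l y)) - fsin k2 l * (k1 y * sin (dot l y)))).
  by apply: eq_integral2 => y; rewrite fcos_shift //; ring.
rewrite integral2B ?integral2Zl; do ?[exact: intg_cos|exact: intg_sin|by apply: intgZl; exact: intg_cos|by apply: intgZl; exact: intg_sin].
by rewrite -/(fcos k1 l) -/(fsin k1 l); ring.
Qed.

Lemma fsin_conv k1 k2 l : schwartz k1 -> schwartz k2 ->
  fsin (convol k1 k2) l = fsin k1 l * fcos k2 l + fcos k1 l * fsin k2 l.
Proof.
move=> s1 s2; have i1 := schwartz_intg s1; have i2 := schwartz_intg s2.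
transitivity (integral2 (fun x => sin (dot l x) * convol k1 k2 x)).
  by apply: eq_integral2 => x; rewrite mulrC.
rewrite (integral_conv (@meas_sindot l) (@bounded_sindot l) i1 s2).
transitivity (integral2 (fun y => fcos k2 l * (k1 y * sin (dot l y)) + fsin k2 l * (k1 y * cos (dot l y)))).
  by apply: eq_integral2 => y; rewrite fsin_shift //; ring.
rewrite integral2D ?integral2Zl; do ?[exact: intg_cos|exact: intg_sin|by apply: intgZl; exact: intg_cos|by apply: intgZl; exact: intg_sin].
by rewrite -/(fcos k1 l) -/(fsin k1 l); ring.
Qed.

Lemma dot_e (l : R * R) b (t : R) : dot l (0 + t *: e_ R b) = sel l.1 l.2 b * t.
Proof. by rewrite add0r /dot /e_ /sel; case: b => /=; rewrite /GRing.scale /=; ring. Qed.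

Lemma conv_cos_line k l b (t : R) : schwartz k ->
  convol (fun y => cos (dot l y)) k (0 + t *: e_ R b) =
  cos (sel l.1 l.2 b * t) * fcos k l + sin (sel l.1 l.2 b * t) * fsin k l.
Proof.
move=> sk; have ik := schwartz_intg sk.
rewrite convE //; [|exact: meas_cosdot|exact: bounded_cosdot].
rewrite /fcos /fsin -!integral2Zl; [|exact: intg_sin|exact: intg_cos].
rewrite -integral2D; [|by apply: intgZl; exact: intg_cos|by apply: intgZl; exact: intg_sin].
by apply: eq_integral2 => x; rewrite dotBr dot_e cosB; ring.
Qed.

Lemma conv_sin_line k l b (t : R) : schwartz k ->
  convol (fun y => sin (dot l y)) k (0 + t *: e_ R b) =
  sin (sel l.1 l.2 b * t) * fcos k l - cos (sel l.1 l.2 b * t) * fsin k l.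
Proof.
move=> sk; have ik := schwartz_intg sk.
rewrite convE //; [|exact: meas_sindot|exact: bounded_sindot].
rewrite /fcos /fsin -!integral2Zl; [|exact: intg_sin|exact: intg_cos].
rewrite -integral2B; [|by apply: intgZl; exact: intg_cos|by apply: intgZl; exact: intg_sin].
by apply: eq_integral2 => x; rewrite dotBr dot_e sinB; ring.
Qed.

Lemma derive_conv_line w k b : meas2 w -> bounded2 w -> schwartz k ->
  is_derive (0 : R) 1 (fun t : R => convol w k (0 + t *: e_ R b)) (convol w ('D_(e_ R b) k) 0).
Proof.
move=> mw bw sk; have [d dE] := conv_is_derive b (0 + (0 : R) *: e_ R b) mw bw sk.
have := @slice_derivable R (convol w k) 0 (e_ R b) 0 d.
by rewrite dE scale0r addr0.
Qed.

Lemma is_derive_cosl (s : R) : is_derive (0 : R) 1 (fun t : R => cos (s * t)) 0.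
Proof.
have h : is_derive (s * 0) 1 (@cos R) (- sin (s * 0)) by exact: is_derive_cos.
have := is_derive1_comp h (is_derive_mull s 0).
by rewrite mulr0 sin0 oppr0 mul0r.
Qed.

Lemma is_derive_sinl (s : R) : is_derive (0 : R) 1 (fun t : R => sin (s * t)) s.
Proof.
have h : is_derive (s * 0) 1 (@sin R) (cos (s * 0)) by exact: is_derive_sin.
have := is_derive1_comp h (is_derive_mull s 0).
by rewrite mulr0 cos0 mul1r.
Qed.

Lemma is_derive_unique (F : R -> R) (x d1 d2 : R) :
  is_derive x 1 F d1 -> is_derive x 1 F d2 -> d1 = d2.
Proof. by move=> [_ <-] [_ <-]. Qed.

Lemma is_derive_lin2 (F G : R -> R) (x dF dG a b : R) :
  is_derive x 1 F dF -> is_derive x 1 G dG ->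
  is_derive x 1 (fun t => F t * a + G t * b) (dF * a + dG * b).
Proof.
move=> hF hG.
have h := is_deriveD (is_deriveZ a hF) (is_deriveZ b hG).
have -> : (fun t => F t * a + G t * b) = (a \*: F) + (b \*: G).
  by apply/funext => t; rewrite [F t * a]mulrC [G t * b]mulrC.
by rewrite [dF * a]mulrC [dG * b]mulrC.
Qed.

(** In place of an integration by parts, the convolution of [cos (dot l)] with [k] is differentiated
    at the origin along [e_ b] in two ways: under the integral, and from its closed form on that
    line. *)
Lemma fcos_D k l b : schwartz k -> fcos ('D_(e_ R b) k) l = sel l.1 l.2 b * fsin k l.
Proof.
move=> sk; have sD : schwartz ('D_(e_ R b) k) by exact: (schwartz_partials [:: b]).
have h := derive_conv_line b (@meas_cosdot l) (@bounded_cosdot l) sk.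
have e : (fun t : R => convol (fun y => cos (dot l y)) k (0 + t *: e_ R b)) =
   fun t => cos (sel l.1 l.2 b * t) * fcos k l + sin (sel l.1 l.2 b * t) * fsin k l.
  by apply/funext => t; rewrite conv_cos_line.
rewrite e in h.
have := is_derive_unique h (is_derive_lin2 (fcos k l) (fsin k l) (is_derive_cosl (sel l.1 l.2 b)) (is_derive_sinl (sel l.1 l.2 b))).
have := conv_cos_line l b 0 sD.
rewrite scale0r addr0 => ->.
by rewrite mulr0 cos0 sin0 !mul0r addr0 mul1r add0r.
Qed.

Lemma fsin_D k l b : schwartz k -> fsin ('D_(e_ R b) k) l = - sel l.1 l.2 b * fcos k l.
Proof.
move=> sk; have sD : schwartz ('D_(e_ R b) k) by exact: (schwartz_partials [:: b]).
have h := derive_conv_line b (@meas_sindot l) (@bounded_sindot l) sk.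
have e : (fun t : R => convol (fun y => sin (dot l y)) k (0 + t *: e_ R b)) =
   fun t => sin (sel l.1 l.2 b * t) * fcos k l + cos (sel l.1 l.2 b * t) * - fsin k l.
  by apply/funext => t; rewrite conv_sin_line // mulrN.
rewrite e in h.
have := is_derive_unique h (is_derive_lin2 (fcos k l) (- fsin k l) (is_derive_sinl (sel l.1 l.2 b)) (is_derive_cosl (sel l.1 l.2 b))).
have := conv_sin_line l b 0 sD.
rewrite scale0r addr0 => ->.
rewrite mulr0 cos0 sin0 !mul0r addr0 mul1r sub0r => /eqP.
by rewrite eqr_oppLR mulNr => /eqP.
Qed.

Definition scal (r s : R) k : R * R -> R := fun x => (r * s)^-1 * k (x.1 / r, x.2 / s).

Lemma scalE r s k : scal r s k = fun x => (r * s)^-1 * k (aff r^-1 s^-1 0 x).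
Proof. by apply/funext => x; rewrite /scal /aff /= !addr0 [r^-1 * _]mulrC [s^-1 * _]mulrC. Qed.

Lemma schwartz_scal r s k : 0 < r -> 0 < s -> schwartz k -> schwartz (scal r s k).
Proof.
move=> r0 s0 sk; rewrite scalE; apply: schwartzZ.
by apply: schwartz_aff; rewrite ?invr_eq0 ?gt_eqF.
Qed.

Lemma scal_D r s k b : 0 < r -> 0 < s -> schwartz k ->
  'D_(e_ R b) (scal r s k) = fun x => (sel r s b)^-1 * scal r s ('D_(e_ R b) k) x.
Proof.
move=> r0 s0 sk; rewrite !scalE; apply/funext => x.
have d := derive_aff (schwartz_derivable (b := b) (x := aff r^-1 s^-1 0 x) sk).
rewrite -[LHS]/('D_(e_ R b) ((r * s)^-1 *: (fun x => k (aff r^-1 s^-1 0 x))) x).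
rewrite deriveZ; last by case: d.
rewrite (@derive_val _ _ _ _ _ _ _ d) /GRing.scale /= mulrCA; congr (_ * _).
by case: b {d}.
Qed.

Lemma integral_scal r s k (G : R * R -> R) : 0 < r -> 0 < s ->
  intg (fun y => G (r * y.1, s * y.2) * k y) ->
  integral2 (fun x => G x * scal r s k x) =
  integral2 (fun y => G (r * y.1, s * y.2) * k y).
Proof.
move=> r0 s0 ii; rewrite -[RHS](integral2_scale r0 s0 ii).
apply: eq_integral2 => x; rewrite /scal /= ![_ * (_ / _)]mulrC !divfK ?gt_eqF //.
by rewrite -surjective_pairing mulrCA.
Qed.

Lemma fcos_scal r s k l : 0 < r -> 0 < s -> schwartz k ->
  fcos (scal r s k) l = fcos k (l.1 * r, l.2 * s).
Proof.
move=> r0 s0 sk; have ik := schwartz_intg sk.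
transitivity (integral2 (fun x => cos (dot l x) * scal r s k x)).
  by apply: eq_integral2 => x; rewrite mulrC.
rewrite integral_scal //.
  by apply: eq_integral2 => x; rewrite mulrC /dot /= !mulrA.
have := intg_cos (l.1 * r, l.2 * s) ik.
by congr (_.-integrable _ _); apply/funext => x /=; rewrite mulrC /dot /= !mulrA.
Qed.

Lemma fsin_scal r s k l : 0 < r -> 0 < s -> schwartz k ->
  fsin (scal r s k) l = fsin k (l.1 * r, l.2 * s).
Proof.
move=> r0 s0 sk; have ik := schwartz_intg sk.
transitivity (integral2 (fun x => sin (dot l x) * scal r s k x)).
  by apply: eq_integral2 => x; rewrite mulrC.
rewrite integral_scal //.
  by apply: eq_integral2 => x; rewrite mulrC /dot /= !mulrA.
have := intg_sin (l.1 * r, l.2 * s) ik.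
by congr (_.-integrable _ _); apply/funext => x /=; rewrite mulrC /dot /= !mulrA.
Qed.

End FourierRules.

(** * Factorization of the kernel *)

Section KernelCurve.
Variable R : realType.
Implicit Types f g k w : R * R -> R.

Lemma schwartz_D b k : schwartz k -> schwartz ('D_(e_ R b) k).
Proof. exact: (schwartz_partials [:: b]). Qed.

Lemma schwartz_lipschitz k : schwartz k ->
  exists2 L : R, 0 <= L & forall x y, `|k y - k x| <= L * (`|y.1 - x.1| + `|y.2 - x.2|).
Proof.
move=> sk.
have [B1 h1] := schwartz_bounded (schwartz_D false sk).
have [B2 h2] := schwartz_bounded (schwartz_D true sk).
have B10 : 0 <= B1 by apply: le_trans (h1 0).
have B20 : 0 <= B2 by apply: le_trans (h2 0).
exists (B1 + B2); first exact: addr_ge0.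
move=> x y.
have d b z := schwartz_is_derive b z sk.
apply: le_trans (lipschitz2 (d false) (d true) (fun t _ => h1 _) (fun t _ => h2 _)) _.
rewrite mulrDl !mulrDr.
have : 0 <= B1 * `|y.2 - x.2| by rewrite mulr_ge0.
have : 0 <= B2 * `|y.1 - x.1| by rewrite mulr_ge0.
by lra.
Qed.

Lemma is_derive_dot (l z : R * R) b : is_derive z (e_ R b) (dot l) (sel l.1 l.2 b).
Proof.
apply: derivable_slice.
have -> : (fun s : R => dot l (z + s *: e_ R b)) =
    (cst (dot l z)) + (fun s : R => sel l.1 l.2 b * s).
  by apply/funext => s; have := dot_e l b s; rewrite dotDr add0r => ->.
have h := is_deriveD (@is_derive_cst _ _ _ (dot l z) (0 : R) 1) (is_derive_mull (sel l.1 l.2 b) 0).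
by rewrite add0r in h.
Qed.

Lemma schwartz_taylor1 k : schwartz k ->
  exists2 L : R, 0 <= L & forall x y,
    `|k y - k x - ('D_(e_ R false) k x * (y.1 - x.1) + 'D_(e_ R true) k x * (y.2 - x.2))|
      <= L * (`|y.1 - x.1| + `|y.2 - x.2|) ^+ 2.
Proof.
move=> sk.
have [L1 L10 h1] := schwartz_lipschitz (schwartz_D false sk).
have [L2 L20 h2] := schwartz_lipschitz (schwartz_D true sk).
exists (L1 + L2); first exact: addr_ge0.
move=> x y; set A := 'D_(e_ R false) k x; set B := 'D_(e_ R true) k x.
pose l : R * R := (A, B).
pose F := fun z => k z - dot l z.
have dF b z : is_derive z (e_ R b) F ('D_(e_ R b) k z - sel A B b).
  exact: (is_deriveB (schwartz_is_derive b z sk) (is_derive_dot l z b)).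
have e : k y - k x - (A * (y.1 - x.1) + B * (y.2 - x.2)) = F y - F x.
  by rewrite /F /dot /=; ring.
rewrite e; pose d1 : R := `|y.1 - x.1|; pose d2 : R := `|y.2 - x.2|.
rewrite -/d1 -/d2.
have seg (a b t : R) : (a <= t <= b) || (b <= t <= a) -> `|t - a| <= `|b - a|.
  case/orP => /andP[u v].
    by rewrite !ger0_norm ?subr_ge0 ?(le_trans u v) // lerD2r.
  by rewrite !ler0_norm ?subr_le0 ?(le_trans u v) // lerN2 lerD2r.
have d10 : 0 <= d1 by exact: normr_ge0.
have d20 : 0 <= d2 by exact: normr_ge0.
apply: le_trans (lipschitz2 (B1 := L1 * d1) (B2 := L2 * (d1 + d2)) (dF false) (dF true) _ _) _.
- move=> t /seg ht; apply: le_trans (h1 x (t, x.2)) _.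
  by rewrite /= subrr normr0 addr0 ler_wpM2l.
- move=> t /seg ht; apply: le_trans (h2 x (y.1, t)) _.
  by rewrite ler_wpM2l // lerD2l.
- rewrite -/d1 -/d2.
  have : 0 <= L1 * (2 * (d1 * d2) + d2 ^+ 2) by rewrite mulr_ge0 // addr_ge0 ?sqr_ge0 // !mulr_ge0.
  have : 0 <= L2 * (d1 * (d1 + d2)) by rewrite !mulr_ge0 // addr_ge0.
  by nra.
Qed.

Lemma is_derive_cvg (F : R -> R) (t d : R) :
  h^-1 * (F (h + t) - F t) @[h --> 0^'] --> d -> is_derive t 1 F d.
Proof.
move=> h.
have h' : h^-1 *: ((F \o shift t) (h *: 1) - F t) @[h --> 0^'] --> d.
  by apply: cvg_trans h; apply: near_eq_cvg; apply: nearW => s /=; rewrite scaler1.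
split; first by apply/cvg_ex; exists d.
exact: cvg_lim h'.
Qed.

Lemma cvg_is_derive (F : R -> R) (t d : R) : is_derive t 1 F d ->
  h^-1 * (F (h + t) - F t) @[h --> 0^'] --> d.
Proof.
move=> [dF <-].
have h' : h^-1 *: ((F \o shift t) (h *: 1) - F t) @[h --> 0^'] --> 'D_1 F t := dF.
by apply: cvg_trans h'; apply: near_eq_cvg; apply: nearW => s /=; rewrite scaler1.
Qed.

Lemma cvg_incr0 (F : R -> R) (t d : R) : is_derive t 1 F d ->
  F (h + t) - F t @[h --> 0^'] --> (0 : R).
Proof.
move=> /cvg_is_derive hF.
have hid : (h : R) @[h --> (0 : R)^'] --> (0 : R) by exact: cvg_within.
rewrite -[X in _ --> X](mul0r d).
apply: cvg_trans (cvgM hid hF); apply: near_eq_cvg.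
near=> s => /=; rewrite mulrA divff ?mul1r //.
by near: s; exact: nbhs_dnbhs_neq.
Unshelve. all: by end_near. Qed.

(** Smoothness is phrased with derivatives along the two axes. The quadratic Taylor remainder
    supplies the total differentiability behind this chain rule. *)
Lemma schwartz_curve k (p q : R -> R) (t p' q' : R) : schwartz k ->
  is_derive t 1 p p' -> is_derive t 1 q q' ->
  is_derive t 1 (fun s => k (p s, q s))
    ('D_(e_ R false) k (p t, q t) * p' + 'D_(e_ R true) k (p t, q t) * q').
Proof.
move=> sk hp hq; have [L L0 hL] := schwartz_taylor1 sk.
apply: is_derive_cvg.
have cp := cvg_is_derive hp; have cq := cvg_is_derive hq.
set A := 'D_(e_ R false) k _; set B := 'D_(e_ R true) k _.
pose u h := p (h + t) - p t; pose v h := q (h + t) - q t.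
have lin : A * (h^-1 * u h) + B * (h^-1 * v h) @[h --> 0^'] --> A * p' + B * q'.
  by apply: cvgD; apply: cvgM => //; exact: cvg_cst.
apply: cvg_sub0 lin.
have dom : L * ((`|u h| + `|v h|) * (`|h^-1 * u h| + `|h^-1 * v h|)) @[h --> 0^'] --> (0 : R).
  rewrite -[X in _ --> X](mulr0 L); apply: cvgM; first exact: cvg_cst.
  rewrite -[X in _ --> X](mul0r (`|p'| + `|q'|)); apply: cvgM.
    have z : `|0 : R| + `|0 : R| = 0 by rewrite normr0 addr0.
    rewrite -[X in _ --> X]z.
    by apply: cvgD; apply: cvg_norm; [exact: (cvg_incr0 hp)|exact: (cvg_incr0 hq)].
  by apply: cvgD; apply: cvg_norm.
apply: norm_cvg0.
have cz : (fun _ : R => 0 : R) h @[h --> (0 : R)^'] --> (0 : R) by exact: cvg_cst.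
apply: (squeeze_cvgr _ cz dom).
apply: nearW => h; rewrite normr_ge0 /= !fctE.
have := hL (p t, q t) (p (h + t), q (h + t)); rewrite /= -/A -/B -/(u h) -/(v h) => H.
have -> : h^-1 * (k (p (h + t), q (h + t)) - k (p t, q t)) - (A * (h^-1 * u h) + B * (h^-1 * v h)) =
   (h^-1 * (k (p (h + t), q (h + t)) - k (p t, q t) - (A * u h + B * v h))) by ring.
rewrite normrM.
have -> : L * ((`|u h| + `|v h|) * (`|h^-1 * u h| + `|h^-1 * v h|)) =
   `|h^-1| * (L * (`|u h| + `|v h|) ^+ 2) by rewrite !normrM; ring.
by rewrite ler_wpM2l.
Qed.

(* The generator of the anisotropic dilations [tau |-> curve rho tau k] below. *)
Definition theta k : R * R -> R := fun y =>
  - (3 * k y + y.1 * 'D_(e_ R false) k y + 2 * y.2 * 'D_(e_ R true) k y).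

Lemma continuous_theta k : schwartz k -> continuous (theta k).
Proof.
move=> sk.
have c0 := schwartz_continuous sk.
have c1 := schwartz_continuous (schwartz_D false sk).
have c2 := schwartz_continuous (schwartz_D true sk).
have h : continuous (fun y => 3 * k y + y.1 * 'D_(e_ R false) k y + 2 * y.2 * 'D_(e_ R true) k y).
  apply: cont_add2.
    apply: cont_add2; first by apply: cont_mul2; [exact: cont_cst2|exact: c0].
    by apply: cont_mul2; [exact: continuous_fst2|exact: c1].
  apply: cont_mul2; last exact: c2.
  by apply: cont_mul2; [exact: cont_cst2|exact: continuous_snd2].
by move=> x; apply: cvgN; exact: h.
Qed.

(** Five powers of decay: four for [wt], one for the factors [y.1] and [y.2] in [theta]. *)
Lemma domd_theta k : schwartz k -> domd (theta k).
Proof.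
move=> sk.
have [B0 B00 h0] := schwartz_bound 5 sk.
have [B1 B10 h1] := schwartz_bound 5 (schwartz_D false sk).
have [B2 B20 h2] := schwartz_bound 5 (schwartz_D true sk).
exists (3 * B0 + B1 + 2 * B2); apply: domd_of_weight => y.
have n1 := norm_fst_le y; have n2 := norm_snd_le y.
have y0 : 0 <= `|y| by [].
have e : 0 <= (1 + `|y|) ^+ 4 by rewrite exprn_ge0 // addr_ge0.
have := h0 y; have := h1 y; have := h2 y.
rewrite !(exprSr _ 4).
rewrite /theta normrN.
move: (k y) ('D_(e_ R false) k y) ('D_(e_ R true) k y) => K K1 K2 b2 b1 b0.
have t : `|3 * K + y.1 * K1 + 2 * y.2 * K2| <= (1 + `|y|) * (3 * `|K| + `|K1| + 2 * `|K2|).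
  apply: le_trans (ler_normD _ _) _; apply: le_trans (lerD (ler_normD _ _) (lexx _)) _.
  rewrite !normrM (ger0_norm (ler0n R 3)) (ger0_norm (ler0n R 2)).
  have : `|y.1| * `|K1| <= `|y| * `|K1| by rewrite ler_wpM2r.
  have : `|y.2| * `|K2| <= `|y| * `|K2| by rewrite ler_wpM2r.
  have : 0 <= `|K| by []. have : 0 <= `|K1| by []. have : 0 <= `|K2| by [].
  have : 0 <= `|y| * `|K| by rewrite mulr_ge0.
  by lra.
apply: le_trans (ler_wpM2l e t) _; rewrite mulrA.
move: b2 b1 b0; set W := _ * (1 + `|y|) => b2 b1 b0.
by rewrite !mulrDr mulrCA [W * (2 * _)]mulrCA; lra.
Qed.

(* For [k = psi_1] its Fourier transform is [exp (- tau^4 (rho^4 k1^4 + k2^2))]. *)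
Definition curve (rho tau : R) k := scal (rho * tau) (tau ^+ 2) k.

Lemma is_derive_inv (F : R -> R) (t d : R) : F t != 0 -> is_derive t 1 F d ->
  is_derive t 1 (fun s => (F s)^-1) (- (F t) ^- 2 * d).
Proof. by move=> Ft hF; have := is_deriveV Ft hF. Qed.

Lemma curve_derive (rho tau : R) k x : 0 < rho -> 0 < tau -> schwartz k ->
  is_derive tau 1 (fun t => curve rho t k x) (tau^-1 * curve rho tau (theta k) x).
Proof.
move=> rho0 tau0 sk.
have rn : rho != 0 by rewrite gt_eqF.
have tn : tau != 0 by rewrite gt_eqF.
have d1 : is_derive tau 1 (fun t : R => rho * t) rho by exact: is_derive_mull.
have d2 : is_derive tau 1 (fun t : R => t ^+ 2) (2 * tau).
  have h := @is_deriveX _ _ (@id R) 2 tau 1 1 (is_derive_id tau 1).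
  by apply: is_derive_eq; rewrite /GRing.scale /= expr1 mulr1.
have d3 : is_derive tau 1 (fun t : R => rho * t * t ^+ 2) (3 * rho * tau ^+ 2).
  have h := is_deriveM d1 d2.
  by apply: is_derive_eq; rewrite /GRing.scale /=; ring.
have rt : rho * tau != 0 by rewrite mulf_neq0.
have rt3 : rho * tau * tau ^+ 2 != 0 by rewrite !mulf_neq0 // expf_neq0.
have t2 : tau ^+ 2 != 0 by rewrite expf_neq0.
have i1 := is_derive_inv rt d1.
have i2 := @is_derive_inv (fun t : R => t ^+ 2) tau _ t2 d2.
have i3 := @is_derive_inv (fun t : R => rho * t * t ^+ 2) tau _ rt3 d3.
have p1 : is_derive tau 1 (fun t : R => x.1 / (rho * t)) (x.1 * (- (rho * tau) ^- 2 * rho)).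
  exact: (is_deriveZ x.1 i1).
have p2 : is_derive tau 1 (fun t : R => x.2 / t ^+ 2) (x.2 * (- (tau ^+ 2) ^- 2 * (2 * tau))).
  exact: (is_deriveZ x.2 i2).
have hk := schwartz_curve sk p1 p2.
have h := is_deriveM i3 hk.
rewrite /curve /scal /theta /=.
apply: (@is_derive_eq _ _ _ _ _ _ _ _ h).
rewrite /GRing.scale /=.
move: (k _) ('D_(_) k _) ('D_(_) k _) => K K1 K2.
by field; rewrite ?rn ?tn.
Qed.

Lemma wt_scale (r s r1 s1 : R) y : 0 < r -> 0 < s -> r <= r1 -> s <= s1 ->
  wt (y.1 / r, y.2 / s) <= (1 + r1 ^+ 2) * (1 + s1 ^+ 2) * wt y.
Proof.
move=> r0 s0 rr1 ss1.
have h (t a b : R) : 0 < a -> a <= b -> (oneDsqr (t / a))^-1 <= (1 + b ^+ 2) * (oneDsqr t)^-1.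
  move=> a0 ab.
  have d (z : R) : 0 < oneDsqr z by rewrite ltr_pwDl // sqr_ge0.
  rewrite -[leLHS]mul1r ler_pdivrMr // mulrAC ler_pdivlMr // mul1r /oneDsqr.
  have t2 : 0 <= (t / a) ^+ 2 by exact: sqr_ge0.
  have e : t ^+ 2 = (t / a) ^+ 2 * a ^+ 2 by rewrite -exprMn divfK ?gt_eqF.
  have : a ^+ 2 <= b ^+ 2 by rewrite lerXn2r ?nnegrE ?(ltW a0) // (le_trans (ltW a0)).
  rewrite e; move: ((t / a) ^+ 2) t2 => z z0 ab2.
  have : z * a ^+ 2 <= z * b ^+ 2 by rewrite ler_wpM2l.
  by have := sqr_ge0 b; lra.
have o (z : R) : 0 <= (oneDsqr z)^-1 by rewrite invr_ge0 addr_ge0 // sqr_ge0.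
by rewrite /wt /= mulrACA ler_pM // h.
Qed.

Lemma integral_curve_derive W k (rho tau : R) : meas2 W -> bounded2 W ->
  schwartz k -> 0 < rho -> 0 < tau ->
  is_derive tau 1 (fun t => integral2 (fun y => W y * curve rho t k y))
    (integral2 (fun y => W y * (tau^-1 * curve rho tau (theta k) y))).
Proof.
move=> mW [BW hW] sk rho0 tau0.
have BW0 : 0 <= BW by apply: le_trans (hW 0).
have [B B0 hB] := domd_ge0 (domd_theta sk).
pose F (t : R) y := W y * curve rho t k y.
pose dF (t : R) y := W y * (t^-1 * curve rho t (theta k) y).
(* For [t] between [tau / 2] and [3 * tau / 2] the majorant [G] takes the worst scale separately in
   each factor: the small one in the negative powers of [t], the large ones [r1] and [s1] in the
   spatial decay. *)
pose r1 := rho * (2 * tau); pose s1 := (2 * tau) ^+ 2.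
pose G (y : R * R) := BW * ((tau / 2)^-1 * ((rho * (tau / 2) * (tau / 2) ^+ 2)^-1 * (B * ((1 + r1 ^+ 2) * (1 + s1 ^+ 2) * wt y)))).
have tau2 : 0 < tau / 2 by rewrite divr_gt0.
apply: (@derive_integral2 _ F dF G tau (tau / 2)) => //.
- move=> t /andP[t1 t2]; have t0 : 0 < t by lra.
  apply: intg_bd_mul => //; first by exists BW.
  by apply/schwartz_intg/schwartz_scal => //; rewrite ?mulr_gt0 ?exprn_gt0.
- move=> t y /andP[t1 t2]; have t0 : 0 < t by lra.
  exact: (is_deriveZ (W y) (curve_derive y rho0 t0 sk)).
- by rewrite /G; do 5 apply: intgZl; exact: integrable_wt.
- move=> t y /andP[t1 t2]; have t0 : 0 < t by lra.
  have tt : tau / 2 <= t by lra.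
  rewrite /dF /G normrM ler_pM // normrM ler_pM //.
    have ti : 0 <= t^-1 by rewrite invr_ge0 ltW.
    by rewrite ger0_norm // lef_pV2.
  rewrite /curve /scal normrM ler_pM //.
    have p0 : 0 < rho * t * t ^+ 2 by rewrite !mulr_gt0 ?exprn_gt0.
    have q0 : 0 < rho * (tau / 2) * (tau / 2) ^+ 2 by rewrite !mulr_gt0 ?exprn_gt0.
    have pi0 : 0 <= (rho * t * t ^+ 2)^-1 by rewrite invr_ge0 ltW.
    rewrite ger0_norm // lef_pV2 //.
    have a0 : 0 <= rho * (tau / 2) by rewrite mulr_ge0 // ltW.
    have b0 : 0 <= (tau / 2) ^+ 2 by rewrite exprn_ge0 // ltW.
    rewrite ler_pM //; first by rewrite ler_wpM2l // ltW.
    by rewrite lerXn2r // nnegrE ltW.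
  apply: le_trans (hB _) _; rewrite ler_wpM2l //.
  apply: wt_scale; rewrite ?mulr_gt0 ?exprn_gt0 //.
    by rewrite /r1 ler_wpM2l ?(ltW rho0) //; lra.
  by rewrite /s1 lerXn2r ?nnegrE ?(ltW t0) ?mulr_ge0 ?(ltW tau0) //; lra.
Qed.

(** The condition [is_kernel] at [T = 1], in real form: the transform is real, hence the sine part
    vanishes. *)
Definition gauss4 (psi : R * R -> R) := [/\ schwartz psi,
  forall l : R * R, fcos psi l = expR (- (l.1 ^+ 4 + l.2 ^+ 2)) & forall l : R * R, fsin psi l = 0].

Definition heat (a0 : R) k : R * R -> R :=
  fun x => 'D_(e_ R true) k x - a0 * 'D_(e_ R false) ('D_(e_ R false) k) x.

Lemma schwartz_heat a0 k : schwartz k -> schwartz (heat a0 k).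
Proof.
move=> sk; apply: schwartzB; first exact: schwartz_D.
by apply: schwartzZ; do 2 apply: schwartz_D.
Qed.

Lemma heat_lin a0 k : heat a0 k =
  fun x => (- a0) * 'D_(e_ R false) ('D_(e_ R false) k) x + 'D_(e_ R true) k x.
Proof. by apply/funext => x; rewrite /heat mulNr addrC. Qed.

Lemma fcos_heat a0 k l : schwartz k ->
  fcos (heat a0 k) l = a0 * l.1 ^+ 2 * fcos k l + l.2 * fsin k l.
Proof.
move=> sk; have s1 := schwartz_D false sk; have s11 := schwartz_D false s1.
have s2 := schwartz_D true sk.
rewrite heat_lin fcos_lin; try exact: schwartz_intg.
by rewrite (fcos_D l false s1) (fsin_D l false sk) (fcos_D l true sk) /sel; ring.
Qed.

Lemma fsin_heat a0 k l : schwartz k ->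
  fsin (heat a0 k) l = a0 * l.1 ^+ 2 * fsin k l - l.2 * fcos k l.
Proof.
move=> sk; have s1 := schwartz_D false sk; have s11 := schwartz_D false s1.
have s2 := schwartz_D true sk.
rewrite heat_lin fsin_lin; try exact: schwartz_intg.
by rewrite (fsin_D l false s1) (fcos_D l false sk) (fsin_D l true sk) /sel; ring.
Qed.

(* The adjoint factor of [a0^2 k1^4 + k2^2] is the heat operator with [- a0]. *)
Lemma kernel_factorization psi (a0 rho ka r s tau : R) : gauss4 psi ->
  0 < rho -> 0 < ka -> 0 < r -> 0 < s -> 0 < tau ->
  rho ^+ 4 = a0 ^+ 2 -> ka ^+ 4 + r ^+ 4 = rho ^+ 4 -> ka ^+ 4 + s ^+ 2 = 1 ->
  (fun x => tau^-1 * curve rho tau (theta psi) x) =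
  (fun x => 4 * tau ^+ 3 * convol (heat a0 (scal (ka * tau) ((ka * tau) ^+ 2) psi))
     (heat (- a0) (scal (r * tau) (s * tau ^+ 2) psi)) x).
Proof.
move=> [sp hc hs] rho0 ka0 r0 s0 tau0 e1 e2 e3.
have k0 : 0 < ka * tau by rewrite mulr_gt0.
have k20 : 0 < (ka * tau) ^+ 2 by rewrite exprn_gt0.
have rt0 : 0 < r * tau by rewrite mulr_gt0.
have st0 : 0 < s * tau ^+ 2 by rewrite mulr_gt0 ?exprn_gt0.
have S1 : schwartz (scal (ka * tau) ((ka * tau) ^+ 2) psi) by exact: schwartz_scal.
have S2 : schwartz (scal (r * tau) (s * tau ^+ 2) psi) by exact: schwartz_scal.
have H1 := schwartz_heat a0 S1; have H2 := schwartz_heat (- a0) S2.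
have ct : continuous (fun x => tau^-1 * curve rho tau (theta psi) x).
  apply: cont_mul2; first exact: cont_cst2.
  rewrite /curve scalE; apply: cont_mul2; first exact: cont_cst2.
  by apply: continuous_aff; exact: continuous_theta.
have dt : domd (fun x => tau^-1 * curve rho tau (theta psi) x).
  have [B B0 hB] := domd_ge0 (domd_theta sp).
  exists (tau^-1 * ((rho * tau * tau ^+ 2)^-1 * (B * ((1 + (rho * tau) ^+ 2) * (1 + (tau ^+ 2) ^+ 2))))) => x.
  have q0 : 0 <= (rho * tau * tau ^+ 2)^-1 by rewrite invr_ge0 !mulr_ge0 ?exprn_ge0 // ltW.
  have ti : 0 <= tau^-1 by rewrite invr_ge0 ltW.
  rewrite /curve /scal normrM (ger0_norm ti) -[leRHS]mulrA ler_wpM2l // normrM (ger0_norm q0).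
  rewrite -[leRHS]mulrA ler_wpM2l //.
  apply: le_trans (hB _) _; rewrite -[leRHS]mulrA ler_wpM2l //.
  by apply: wt_scale; rewrite ?mulr_gt0 ?exprn_gt0.
have mt := domd_intg ct dt.
have sb1 := schwartz_bounded H1.
have cc : continuous (convol (heat a0 (scal (ka * tau) ((ka * tau) ^+ 2) psi)) (heat (- a0) (scal (r * tau) (s * tau ^+ 2) psi))).
  by apply: conv_continuous => //; exact: schwartz_meas.
have cd := conv_domd H1 H2.
apply: fourier_inj => //.
- by apply: cont_mul2; [exact: cont_cst2|exact: cc].
- have [B hB] := cd; exists (`|4 * tau ^+ 3| * B) => x.
  by rewrite normrM -mulrA ler_wpM2l.
move=> l; have ic := domd_intg cc cd.
set LHSf := fun x : R * R => tau^-1 * curve rho tau (theta psi) x.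
have [CA SA] : fcos (scal (ka * tau) ((ka * tau) ^+ 2) psi) l =
    expR (- ((l.1 * (ka * tau)) ^+ 4 + (l.2 * (ka * tau) ^+ 2) ^+ 2)) /\
    fsin (scal (ka * tau) ((ka * tau) ^+ 2) psi) l = 0.
  by split; [rewrite (fcos_scal l k0 k20 sp) hc|rewrite (fsin_scal l k0 k20 sp) hs].
have [CB SB] : fcos (scal (r * tau) (s * tau ^+ 2) psi) l =
    expR (- ((l.1 * (r * tau)) ^+ 4 + (l.2 * (s * tau ^+ 2)) ^+ 2)) /\
    fsin (scal (r * tau) (s * tau ^+ 2) psi) l = 0.
  by split; [rewrite (fcos_scal l rt0 st0 sp) hc|rewrite (fsin_scal l rt0 st0 sp) hs].
have CH1 := fcos_heat a0 l S1; have SH1 := fsin_heat a0 l S1.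
have CH2 := fcos_heat (- a0) l S2; have SH2 := fsin_heat (- a0) l S2.
rewrite CA SA mulr0 addr0 in CH1; rewrite CA SA mulr0 sub0r in SH1.
rewrite CB SB mulr0 addr0 in CH2; rewrite CB SB mulr0 sub0r in SH2.
rewrite (fcos_Z (4 * tau ^+ 3) l ic) (fsin_Z (4 * tau ^+ 3) l ic).
move: CH1 SH1 CH2 SH2 H1 H2 {sb1 cc cd ic CA SA CB SB}.
move: (heat a0 _) (heat (- a0) _) => h1 h2 CH1 SH1 CH2 SH2 H1 H2.
rewrite (fcos_conv l H1 H2) (fsin_conv l H1 H2) CH1 SH1 CH2 SH2 {CH1 SH1 CH2 SH2 H1 H2 h1 h2}.
(* The transform of [curve rho t psi] at [l] is [exp (- La * t^4)]. The transform of the left side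
   is its derivative at [tau], to be matched with the product of the two heat symbols and of the two
   dilated transforms. *)
set La := rho ^+ 4 * l.1 ^+ 4 + l.2 ^+ 2.
have Ld : is_derive tau 1 (fun t : R => expR (- La * t ^+ 4))
   (expR (- La * tau ^+ 4) * (- La * (4 * tau ^+ 3))).
  have h4 := @is_deriveX _ _ (@id R) 4 tau 1 1 (is_derive_id tau 1).
  have d4 : is_derive tau 1 (fun t : R => t ^+ 4) (4 * tau ^+ 3).
    by apply: is_derive_eq; rewrite /GRing.scale /= mulr1.
  have d5 : is_derive tau 1 (fun t : R => - La * t ^+ 4) (- La * (4 * tau ^+ 3)).
    exact: (is_deriveZ (- La) d4).
  exact: (@is_derive1_comp R expR (fun t : R => - La * t ^+ 4) tau _ _ (is_derive_expR (- La * tau ^+ 4)) d5).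
have near_pos : \forall t \near tau, 0 < t by exact: lt_nbhsr.
have EE : expR (- ((l.1 * (ka * tau)) ^+ 4 + (l.2 * (ka * tau) ^+ 2) ^+ 2)) *
   expR (- ((l.1 * (r * tau)) ^+ 4 + (l.2 * (s * tau ^+ 2)) ^+ 2)) = expR (- La * tau ^+ 4).
  rewrite -expRD /La -e2; congr expR.
  transitivity (- ((ka ^+ 4 + r ^+ 4) * l.1 ^+ 4 + (ka ^+ 4 + s ^+ 2) * l.2 ^+ 2) * tau ^+ 4); first by ring.
  by rewrite e3; ring.
split.
- have h := integral_curve_derive (@meas_cosdot R l) (@bounded_cosdot R l) sp rho0 tau0.
  have {}h : is_derive tau 1 (fun t : R => expR (- La * t ^+ 4))
      (integral2 (fun y => cos (dot l y) * (tau^-1 * curve rho tau (theta psi) y))).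
    apply: (near_eq_is_derive _ h).
    near=> t; have t0 : 0 < t by near: t.
    have -> : integral2 (fun y => cos (dot l y) * curve rho t psi y) = fcos (curve rho t psi) l.
      by apply: eq_integral2 => y; rewrite mulrC.
    rewrite /curve fcos_scal ?mulr_gt0 ?exprn_gt0 // hc; congr expR.
    by rewrite /La /=; ring.
  have := is_derive_unique h Ld.
  rewrite /fcos; under eq_integral2 do rewrite mulrC.
  move=> ->; rewrite -EE.
  move: (expR _) (expR _) => E E'.
  rewrite /La e1; ring.
(* The sine part of the curve is constantly 0. On the other side the mixed terms
   [a0 * l.1 ^+ 2 * l.2] cancel, since the two heat factors have opposite signs of [a0]. *)
- have h := integral_curve_derive (@meas_sindot R l) (@bounded_sindot R l) sp rho0 tau0.
  have {}h : is_derive tau 1 (fun t : R => 0 : R)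
      (integral2 (fun y => sin (dot l y) * (tau^-1 * curve rho tau (theta psi) y))).
    apply: (near_eq_is_derive _ h).
    near=> t; have t0 : 0 < t by near: t.
    have -> : integral2 (fun y => sin (dot l y) * curve rho t psi y) = fsin (curve rho t psi) l.
      by apply: eq_integral2 => y; rewrite mulrC.
    by rewrite /curve fsin_scal ?mulr_gt0 ?exprn_gt0 // hs.
  have := is_derive_unique h (is_derive_cst (0 : R) tau 1).
  rewrite /fsin; under eq_integral2 do rewrite mulrC.
  move=> ->.
  by ring.
Unshelve. all: by end_near. Qed.

End KernelCurve.

(** * Small-scale estimate *)

Section ParabolicNorm.
Variable R : realType.
Implicit Types f g k w : R * R -> R.
Implicit Types x y z : R * R.

Definition nrm z : R := `|z.1| + Num.sqrt `|z.2|.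

Lemma cc_distE x y : cc_dist x y = nrm (x - y).
Proof. by []. Qed.

Lemma nrm_ge0 z : 0 <= nrm z.
Proof. by rewrite addr_ge0 // sqrtr_ge0. Qed.

Lemma nrmN z : nrm (- z) = nrm z.
Proof. by rewrite /nrm /= !normrN. Qed.

Lemma nrmD x y : nrm (x + y) <= nrm x + nrm y.
Proof.
rewrite /nrm addrACA lerD ?ler_normD //=.
rewrite -(@ler_pXn2r _ 2) ?nnegrE ?addr_ge0 ?sqrtr_ge0 // sqr_sqrtr // sqrrD !sqr_sqrtr //.
apply: le_trans (ler_normD _ _) _.
have : 0 <= Num.sqrt `|x.2| * Num.sqrt `|y.2| by rewrite mulr_ge0 ?sqrtr_ge0.
by rewrite mulr2n; lra.
Qed.

Lemma nrm_fst z : `|z.1| <= nrm z.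
Proof. by rewrite lerDl sqrtr_ge0. Qed.

Lemma nrm_snd z : `|z.2| <= nrm z ^+ 2.
Proof.
rewrite -[leLHS](sqr_sqrtr (normr_ge0 _)) lerXn2r ?nnegrE ?sqrtr_ge0 ?nrm_ge0 //.
by rewrite lerDr.
Qed.

Lemma nrm_eq0 z : nrm z = 0 -> z = 0.
Proof.
move=> z0; have := nrm_fst z; have := nrm_snd z; rewrite z0 expr0n /= !normr_le0.
by case: z {z0} => a b /= /eqP -> /eqP ->.
Qed.

Lemma nrm_gt0 z : z != 0 -> 0 < nrm z.
Proof.
move=> z0; rewrite lt_neqAle nrm_ge0 andbT eq_sym; apply/eqP => /nrm_eq0 e.
by rewrite e eqxx in z0.
Qed.

Lemma nrm_scale (r s c tau : R) y : 0 <= r <= c * tau -> 0 <= s <= (c * tau) ^+ 2 ->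
  0 <= c * tau -> nrm (r * y.1, s * y.2) <= c * tau * nrm y.
Proof.
move=> /andP[r0 rc] /andP[s0 sc] ct0; rewrite /nrm /= mulrDr lerD //.
  by rewrite normrM (ger0_norm r0) ler_wpM2r.
have e : c * tau = Num.sqrt ((c * tau) ^+ 2) by rewrite sqrtr_sqr ger0_norm.
rewrite [X in _ <= X * _]e -sqrtrM ?sqr_ge0 // ler_wsqrtr //.
by rewrite normrM (ger0_norm s0) ler_wpM2r.
Qed.

Lemma continuous_nrm : continuous nrm.
Proof.
apply: cont_add2.
  by apply: (@cont_comp2 _ Num.norm); [exact: norm_continuous|exact: continuous_fst2].
apply: (@cont_comp2 _ Num.sqrt); first exact: sqrt_continuous.
by apply: (@cont_comp2 _ Num.norm); [exact: norm_continuous|exact: continuous_snd2].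
Qed.

Lemma measurable_nrm_powR (g : R) : meas2 (fun z => nrm z `^ g).
Proof.
apply: (measurableT_comp (measurable_powR g)).
by apply: continuous_measurable2; exact: continuous_nrm.
Qed.

(** The constant is [2^2], from bounding the sum by twice the larger term; it is uniform over the
    exponents up to 2. *)
Lemma powRD_le (a b g : R) : 0 <= a -> 0 <= b -> 0 <= g <= 2 ->
  (a + b) `^ g <= 4 * (a `^ g + b `^ g).
Proof.
move=> a0 b0 /andP[g0 g2].
wlog ab : a b a0 b0 / a <= b => [H|].
  have [ab|/ltW ba] := leP a b; first exact: H.
  by rewrite addrC [a `^ g + _]addrC; exact: H.
have h : (a + b) `^ g <= (2 * b) `^ g.
  by rewrite ge0_ler_powR ?nnegrE ?addr_ge0 ?mulr_ge0 // mulr_natl mulr2n lerD2r.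
apply: le_trans h _; rewrite powRM //.
have h2 : (2 : R) `^ g <= 4.
  rewrite (_ : 4 = 2 `^ 2 :> R); first by rewrite ler_powR // ler1n.
  by rewrite powR_mulrn //; ring.
have bg : 0 <= b `^ g by exact: powR_ge0.
have ag : 0 <= a `^ g by exact: powR_ge0.
apply: le_trans (ler_wpM2r bg h2) _; rewrite mulrDr lerDr mulr_ge0 //.
Qed.

Lemma powR_le_sqr (a g : R) : 0 <= a -> 0 <= g <= 2 -> a `^ g <= (1 + a) ^+ 2.
Proof.
move=> a0 /andP[g0 g2]; apply: (@le_trans _ _ ((1 + a) `^ g)).
  by rewrite ge0_ler_powR ?nnegrE ?addr_ge0 // lerDr.
rewrite -powR_mulrn ?addr_ge0 // ler_powR // lerDl //.
Qed.

Lemma intg_mom k : schwartz k -> intg (fun y => (1 + nrm y) ^+ 2 * `|k y|).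
Proof.
move=> sk; have [B B0 hB] := schwartz_bound 6 sk.
apply: domd_integrable.
  apply: continuous_measurable2; apply: cont_mul2.
    apply: cont_pow2; apply: cont_add2; [exact: cont_cst2|exact: continuous_nrm].
  by apply: (@cont_comp2 _ Num.norm); [exact: norm_continuous|exact: schwartz_continuous].
exists (4 * B); apply: domd_of_weight => y.
have y0 : 0 <= `|y| by [].
have h : 1 + nrm y <= 2 * (1 + `|y|).
  have := norm_fst_le y; have := norm_snd_le y => y2 y1.
  have : Num.sqrt `|y.2| <= 1 + `|y.2|.
    rewrite -(@ler_pXn2r _ 2) ?nnegrE ?sqrtr_ge0 ?addr_ge0 // sqr_sqrtr //.
    by have : 0 <= `|y.2| by []; nra.
  by rewrite /nrm; lra.
rewrite normrM normr_id ger0_norm ?exprn_ge0 ?addr_ge0 ?nrm_ge0 //.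
have h2 : (1 + nrm y) ^+ 2 <= 4 * (1 + `|y|) ^+ 2.
  rewrite (_ : 4 = 2 ^+ 2); last by ring.
  by rewrite -exprMn lerXn2r ?nnegrE ?mulr_ge0 ?addr_ge0 ?nrm_ge0.
apply: (@le_trans _ _ ((1 + `|y|) ^+ 4 * (4 * (1 + `|y|) ^+ 2 * `|k y|))).
  by rewrite ler_wpM2l ?exprn_ge0 ?addr_ge0 // ler_wpM2r.
have -> : (1 + `|y|) ^+ 4 * (4 * (1 + `|y|) ^+ 2 * `|k y|) = 4 * ((1 + `|y|) ^+ 6 * `|k y|) by ring.
by rewrite ler_wpM2l.
Qed.

(** Since [nrm y ^ g <= (1 + nrm y)^2] for all [g] between 0 and 2, this single moment serves every
    exponent. *)
Definition mom k : R := integral2 (fun y => (1 + nrm y) ^+ 2 * `|k y|).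

Lemma mom_ge0 k : 0 <= mom k.
Proof. by apply: integral2_ge0 => y; rewrite mulr_ge0 // exprn_ge0 // addr_ge0 ?nrm_ge0. Qed.

(** A kernel with scales at most [c * tau] and [(c * tau)^2] lives at parabolic distance about
    [c * tau] from the origin: after rescaling, a growth [nrm z ^ g] is replaced by [(c * tau)^g]
    times a moment. The scales [r] and [s] are independent because the kernels in use are not exact
    parabolic dilates. *)
Lemma integral_scal_bound W k (r s c tau g a b : R) : meas2 W -> schwartz k -> 0 < r <= c * tau -> 0 < s <= (c * tau) ^+ 2 -> 0 <= g <= 2 ->
  0 <= a -> 0 <= b ->
  (forall z, `|W z| <= a + b * nrm z `^ g) ->
  `|integral2 (fun z => W z * scal r s k z)| <= (a + b * (c * tau) `^ g) * mom k.
Proof.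
move=> mW sk /andP[r0 rc] /andP[s0 sc] /andP[g0 g2] a0 b0 hw.
have ct0 : 0 <= c * tau by rewrite (le_trans (ltW r0)).
have sks := schwartz_scal r0 s0 sk.
have mG : meas2 (fun z => a + b * nrm z `^ g).
  apply: measurable_funD => //; apply: measurable_funM => //.
  exact: measurable_nrm_powR.
have Gpt y : a + b * nrm (r * y.1, s * y.2) `^ g <= (a + b * (c * tau) `^ g) * (1 + nrm y) ^+ 2.
  have ny := nrm_ge0 y.
  rewrite mulrDl lerD //.
    by rewrite ler_peMr // exprn_ege1 // lerDl.
  rewrite -mulrA ler_wpM2l //.
  apply: (@le_trans _ _ ((c * tau * nrm y) `^ g)).
    have n0 : 0 <= c * tau * nrm y by exact: mulr_ge0.
    rewrite ge0_ler_powR ?nnegrE ?nrm_ge0 //.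
    by apply: nrm_scale => //; apply/andP; split => //; exact: ltW.
  rewrite powRM // ler_wpM2l ?powR_ge0 //; apply: powR_le_sqr => //.
  by rewrite g0.
have ii : intg (fun y => (a + b * nrm (r * y.1, s * y.2) `^ g) * `|k y|).
  apply: (@intg_le _ _ (fun y => (a + b * (c * tau) `^ g) * ((1 + nrm y) ^+ 2 * `|k y|))).
  - apply: measurable_funM; last first.
      by apply: measurableT_comp => //; exact: schwartz_meas.
    have := measurableT_comp mG (measurable_affine2 r s 0 0).
    by apply: eq_measurable_fun => y _; rewrite /affine2 /affine1 /= !addr0.
  - by apply: intgZl; exact: intg_mom.
  - move=> y; rewrite mulrA normrM normr_id ler_wpM2r // ger0_norm ?Gpt //.
    by rewrite addr_ge0 // mulr_ge0 // powR_ge0.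
have e : (fun z => `|scal r s k z|) = scal r s (fun y => `|k y|).
  by apply/funext => z; rewrite /scal normrM ger0_norm // invr_ge0 mulr_ge0 ?ltW.
have ii2 : intg (fun z => (a + b * nrm z `^ g) * `|scal r s k z|).
  have rs : r * s != 0 by rewrite mulf_neq0 // gt_eqF.
  have := intg_scale r0 s0 ii => /(intgZl (r * s)^-1).
  congr (_.-integrable _ _); apply/funext => z /=; congr (_%:E).
  rewrite ![_ * (_ / _)]mulrC !divfK ?gt_eqF // -surjective_pairing.
  have -> : `|scal r s k z| = scal r s (fun y => `|k y|) z by rewrite -e.
  by rewrite [in RHS]/scal mulrCA.
have mWk : meas2 (fun z => W z * scal r s k z).
  by apply: measurable_funM => //; exact: schwartz_meas.
have hWk z : `|W z * scal r s k z| <= (a + b * nrm z `^ g) * `|scal r s k z|.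
  by rewrite normrM ler_wpM2r.
apply: le_trans (norm_integral2_le_dom mWk ii2 hWk) _.
rewrite (eq_integral2 (g := fun z => (a + b * nrm z `^ g) * scal r s (fun y => `|k y|) z)); last first.
  by move=> z; rewrite -e.
rewrite integral_scal // /mom -integral2Zl; last exact: intg_mom.
apply: le_integral2 => //.
  by apply: intgZl; exact: intg_mom.
by move=> y; rewrite mulrA ler_wpM2r.
Qed.

Lemma convol_scal_bound w k (r s c tau g a b : R) x : meas2 w -> bounded2 w ->
  schwartz k -> 0 < r <= c * tau -> 0 < s <= (c * tau) ^+ 2 -> 0 <= g <= 2 ->
  0 <= a -> 0 <= b ->
  (forall z, `|w (x - z)| <= a + b * nrm z `^ g) ->
  `|convol w (scal r s k) x| <= (a + b * (c * tau) `^ g) * mom k.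
Proof.
move=> mw bw sk /andP[r0 rc] sc g02 a0 b0 hw; have /andP[s0 _] := sc.
rewrite convE //; last by apply/schwartz_intg/schwartz_scal.
by apply: integral_scal_bound => //; [exact: meas2_refl_shift|rewrite r0].
Qed.

End ParabolicNorm.

(** * Integrating a bound on a derivative from scale zero *)

Section Comparison.
Variable R : realType.

Lemma is_derive_powR (p t : R) : 0 < t -> is_derive t 1 (fun s : R => s `^ p) (p * t `^ (p - 1)).
Proof.
move=> t0; have tI : t \in `]0, +oo[ by rewrite in_itv /= t0.
split; first exact: derivable_powR.
by rewrite -derive1E powR_derive1.
Qed.

(** With [H] the primitive of the bound that vanishes at 0, the functions [H - F] and [H + F] are
    nondecreasing by the mean value theorem; this controls [F t - F s] by [H t] for [0 < s < t]. The
    sequence [t / (n + 2)], which stays strictly below [t], then sends [s] to 0. *)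
Lemma comparison (F dF : R -> R) (F0 A B p q T : R) :
  0 < p -> 0 < q -> 0 <= A -> 0 <= B ->
  (forall t : R, 0 < t -> is_derive t 1 F (dF t)) ->
  (forall t, 0 < t <= T -> `|dF t| <= A * t `^ (p - 1) + B * t `^ (q - 1)) ->
  (forall t, 0 < t -> F (t / n.+2%:R) @[n --> \oo] --> F0) ->
  forall t, 0 < t <= T -> `|F t - F0| <= A / p * t `^ p + B / q * t `^ q.
Proof.
move=> p0 q0 A0 B0 hF hd hl t /andP[t0 tT].
pose H s := A / p * s `^ p + B / q * s `^ q.
have H0 s : 0 <= H s by rewrite addr_ge0 // mulr_ge0 ?powR_ge0 ?divr_ge0 // ltW.
have key s : 0 < s < t -> `|F t - F s| <= H t.
  move=> /andP[s0 st].
  pose dH u := A * u `^ (p - 1) + B * u `^ (q - 1).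
  have hH (u : R) : 0 < u -> is_derive u 1 H (dH u).
    move=> u0.
    have h1 := is_deriveZ (A / p) (is_derive_powR p u0).
    have h2 := is_deriveZ (B / q) (is_derive_powR q u0).
    have h := is_deriveD h1 h2.
    apply: (@is_derive_eq _ _ _ _ _ _ _ _ h).
    by rewrite /dH /GRing.scale /=; field; rewrite ?gt_eqF.
  have mono (G dG : R -> R) : (forall u : R, 0 < u -> is_derive u 1 G (dG u)) ->
      (forall u, 0 < u <= T -> 0 <= dG u) -> G s <= G t.
    move=> hG dG0.
    have hG' u : u \in `]s, t[ -> is_derive u 1 G (dG u).
      by rewrite in_itv /= => /andP[su ut]; apply: hG; exact: lt_trans su.
    have cG : {within `[s, t], continuous G}.
      apply: derivable_within_continuous => u; rewrite in_itv /= => /andP[su ut].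
      by have [] := hG u (lt_le_trans s0 su).
    have [c] := MVT st hG' cG; rewrite in_itv /= => /andP[sc ct] e.
    rewrite -subr_ge0 e mulr_ge0 ?subr_ge0 ?(ltW st) //.
    by apply: dG0; rewrite (lt_trans s0 sc) /= (le_trans (ltW ct)).
  have m1 : H s - F s <= H t - F t.
    apply: (mono (fun u => H u - F u) (fun u => dH u - dF u)) => [u u0|u uT].
      exact: (is_deriveB (hH u u0) (hF u _)).
    by rewrite subr_ge0 (le_trans _ (hd u uT)) // ler_norm.
  have m2 : H s + F s <= H t + F t.
    apply: (mono (fun u => H u + F u) (fun u => dH u + dF u)) => [u u0|u uT].
      exact: (is_deriveD (hH u u0) (hF u _)).
    have := hd u uT; rewrite -/(dH u) ler_norml => /andP[h _].
    by move: h; lra.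
  have := H0 s; rewrite ler_norml => hs; apply/andP; split; lra.
have lim : `|F t - F (t / n.+2%:R)| @[n --> \oo] --> `|F t - F0|.
  by apply: cvg_norm; apply: cvgB; [exact: cvg_cst|exact: hl].
rewrite -(cvg_lim _ lim) //; apply: limr_le; first by apply: cvgP lim.
apply: nearW => n; apply: key; rewrite divr_gt0 //= ltr_pdivrMr // ltr_pMr //.
by rewrite ltr1n.
Qed.

End Comparison.

(** * Distance between a function and its mollification *)

Section SmallScale.
Variable R : realType.
Implicit Types f g k w : R * R -> R.
Implicit Types x y z : R * R.

Lemma dot0 x : dot (0 : R * R) x = 0.
Proof. by rewrite /dot /= !mul0r addr0. Qed.

Lemma fcos0 k : fcos k 0 = integral2 k.
Proof. by apply: eq_integral2 => x; rewrite dot0 cos0 mulr1. Qed.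

(** Means are Fourier transforms at frequency 0, where the symbol of a derivative vanishes. *)
Lemma integral_D k b : schwartz k -> integral2 ('D_(e_ R b) k) = 0.
Proof. by move=> sk; rewrite -fcos0 fcos_D // /sel /=; case: b; rewrite mul0r. Qed.

Lemma integral_heat a0 k : schwartz k -> integral2 (heat a0 k) = 0.
Proof. by move=> sk; rewrite -fcos0 fcos_heat //= expr0n /= mulr0 !mul0r addr0. Qed.

Lemma integral_scal1 (r s : R) k : 0 < r -> 0 < s -> schwartz k ->
  integral2 (scal r s k) = integral2 k.
Proof. by move=> r0 s0 sk; rewrite -!fcos0 fcos_scal //= !mul0r. Qed.

Lemma integral_gauss4 (psi : R * R -> R) : gauss4 psi -> integral2 psi = 1.
Proof. by move=> [_ h _]; rewrite -fcos0 h /= !expr0n /= addr0 oppr0 expR0. Qed.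

Lemma derive_Z (c : R) k b : schwartz k ->
  'D_(e_ R b) (fun x => c * k x) = fun x => c * 'D_(e_ R b) k x.
Proof.
move=> sk; have := @partials_lin R [:: b] c k (fun=> 0) (proj1 sk) (proj1 (schwartz0 R)).
rewrite /partials /= => h; apply/funext => x.
rewrite (_ : (fun x => c * k x) = (fun x => c * k x + 0)); last first.
  by apply/funext => y; rewrite addr0.
have /= h0 := congr1 (fun F => F x) (partials_cst0 R [:: b]).
by have := congr1 (fun F => F x) h => /= ->; rewrite h0 addr0.
Qed.

Lemma scal_DD (r s : R) k b1 b2 : 0 < r -> 0 < s -> schwartz k ->
  'D_(e_ R b1) ('D_(e_ R b2) (scal r s k)) =
  fun x => ((sel r s b1)^-1 * (sel r s b2)^-1) * scal r s ('D_(e_ R b1) ('D_(e_ R b2) k)) x.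
Proof.
move=> r0 s0 sk; have sk2 := schwartz_D b2 sk.
apply: (etrans (congr1 (fun F => 'D_(e_ R b1) F) (scal_D b2 r0 s0 sk))).
apply: (etrans (derive_Z _ b1 (schwartz_scal r0 s0 sk2))).
apply/funext => x; have /= -> := congr1 (fun F => F x) (scal_D b1 r0 s0 sk2).
by rewrite mulrA [in RHS](mulrC (sel r s b1)^-1).
Qed.

Lemma convol_Z w k (c : R) x : meas2 w -> bounded2 w -> intg k ->
  convol w (fun z => c * k z) x = c * convol w k x.
Proof.
move=> mw bw ik; rewrite /convol -integral2Zl; last exact: intg_conv.
by apply: eq_integral2 => y; rewrite mulrCA.
Qed.

Lemma subcst_meas2 w (c : R) : meas2 w -> meas2 (fun y => w y - c).
Proof. by move=> mw; apply: measurable_funB. Qed.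

Lemma subcst_bounded2 w (c : R) : bounded2 w -> bounded2 (fun y => w y - c).
Proof.
by move=> [B hB]; exists (B + `|c|) => x; rewrite (le_trans (ler_normB _ _)) // lerD2r.
Qed.

Lemma norm_comb_le (c1 c2 X1 X2 B1 B2 : R) : 0 <= c1 -> 0 <= c2 ->
  `|X1| <= B1 -> `|X2| <= B2 -> `|c1 * X1 + c2 * X2| <= c1 * B1 + c2 * B2.
Proof.
move=> h1 h2 hX1 hX2; apply: le_trans (ler_normD _ _) _.
by rewrite lerD // normrM ger0_norm // ler_wpM2l.
Qed.

Lemma convol_heat_bound h psi (a0 r s c tau g a b k0 : R) z :
  meas2 h -> bounded2 h -> schwartz psi ->
  0 < r <= c -> 0 < s <= c ^+ 2 -> 0 < tau -> 0 <= g <= 2 -> 0 <= a -> 0 <= b -> 0 <= a0 ->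
  (forall y, `|h (z - y) - k0| <= a + b * nrm y `^ g) ->
  `|convol h (heat (- a0) (scal (r * tau) (s * tau ^+ 2) psi)) z| <=
    (a + b * (c * tau) `^ g) *
    ((s^-1 * mom ('D_(e_ R true) psi) + a0 * (r ^- 2 * mom ('D_(e_ R false) ('D_(e_ R false) psi)))) / tau ^+ 2).
Proof.
move=> mh bh sp /andP[r0 rc] /andP[s0 sc] tau0 gg A0 B0 a00 hh.
have rt0 : 0 < r * tau by rewrite mulr_gt0.
have st0 : 0 < s * tau ^+ 2 by rewrite mulr_gt0 ?exprn_gt0.
have rtc : 0 < r * tau <= c * tau by rewrite rt0 ler_wpM2r // ltW.
have stc : 0 < s * tau ^+ 2 <= (c * tau) ^+ 2 by rewrite st0 exprMn ler_wpM2r // exprn_ge0 // ltW.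
have S2 : schwartz (scal (r * tau) (s * tau ^+ 2) psi) by exact: schwartz_scal.
have sp2 := schwartz_D true sp; have sp11 := schwartz_D false (schwartz_D false sp).
pose h' y := h y - k0.
have mh' : meas2 h' by exact: subcst_meas2.
have bh' : bounded2 h' by exact: subcst_bounded2.
have e0 : convol h (heat (- a0) (scal (r * tau) (s * tau ^+ 2) psi)) z =
          convol h' (heat (- a0) (scal (r * tau) (s * tau ^+ 2) psi)) z.
  by rewrite conv_subcst ?integral_heat ?mulr0 ?subr0 //; apply/schwartz_intg/schwartz_heat.
have e1 : heat (- a0) (scal (r * tau) (s * tau ^+ 2) psi) =
    fun x => (a0 * ((r * tau)^-1 * (r * tau)^-1)) *
       scal (r * tau) (s * tau ^+ 2) ('D_(e_ R false) ('D_(e_ R false) psi)) x +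
     (s * tau ^+ 2)^-1 * scal (r * tau) (s * tau ^+ 2) ('D_(e_ R true) psi) x.
  have E1 := scal_DD false false rt0 st0 sp; have E2 := scal_D true rt0 st0 sp.
  apply/funext => x; have /= E1x := congr1 (fun F => F x) E1.
  have /= E2x := congr1 (fun F => F x) E2.
  rewrite /heat E1x E2x mulNr opprK addrC; congr (_ + _); exact: mulrA.
have i1 : intg (scal (r * tau) (s * tau ^+ 2) ('D_(e_ R false) ('D_(e_ R false) psi))).
  by apply/schwartz_intg/schwartz_scal.
have i2 : intg (scal (r * tau) (s * tau ^+ 2) ('D_(e_ R true) psi)).
  by apply/schwartz_intg/schwartz_scal.
have i3 : intg (fun x => (s * tau ^+ 2)^-1 * scal (r * tau) (s * tau ^+ 2) ('D_(e_ R true) psi) x).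
  exact: intgZl.
rewrite e0 e1 (conv_linr _ _ mh' bh' i1 i3) (convol_Z _ _ mh' bh' i2).
have b1 := convol_scal_bound mh' bh' sp11 rtc stc gg A0 B0 hh.
have b2 := convol_scal_bound mh' bh' sp2 rtc stc gg A0 B0 hh.
move: b1 b2; set X1 := convol _ _ _; set X2 := convol _ _ _.
move: (mom _) (mom _) => m1 m2; set Q := a + _ => b1 b2.
have n1 : 0 <= a0 * ((r * tau)^-1 * (r * tau)^-1).
  by rewrite mulr_ge0 // mulr_ge0 // invr_ge0 ltW.
have n2 : 0 <= (s * tau ^+ 2)^-1 by rewrite invr_ge0 ltW.
apply: le_trans (norm_comb_le n1 n2 b1 b2) _.
apply: le_of_eq; field.
by rewrite !gt_eqF.
Qed.

Lemma intg_convol k1 k2 : schwartz k1 -> schwartz k2 -> intg (convol k1 k2).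
Proof.
move=> s1 s2; apply: domd_intg; last exact: conv_domd.
apply: conv_continuous => //; [exact: schwartz_meas|exact: schwartz_bounded].
Qed.

(** Factorization of the kernel combined with associativity: the inner convolution is [w] tested
    with the heat operator on [psi_T], the quantity that the equation controls. *)
Lemma derive_convol_curve psi w (a0 rho ka r s tau : R) z : gauss4 psi ->
  meas2 w -> bounded2 w ->
  0 < rho -> 0 < ka -> 0 < r -> 0 < s -> 0 < tau ->
  rho ^+ 4 = a0 ^+ 2 -> ka ^+ 4 + r ^+ 4 = rho ^+ 4 -> ka ^+ 4 + s ^+ 2 = 1 ->
  is_derive tau 1 (fun t : R => convol w (curve rho t psi) z)
    (4 * tau ^+ 3 * convol (convol w (heat a0 (scal (ka * tau) ((ka * tau) ^+ 2) psi)))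
     (heat (- a0) (scal (r * tau) (s * tau ^+ 2) psi)) z).
Proof.
move=> gp mw bw rho0 ka0 r0 s0 tau0 e1 e2 e3; have [sp _ _] := gp.
have S1 : schwartz (heat a0 (scal (ka * tau) ((ka * tau) ^+ 2) psi)).
  by apply/schwartz_heat/schwartz_scal => //; rewrite ?exprn_gt0 // mulr_gt0.
have S2 : schwartz (heat (- a0) (scal (r * tau) (s * tau ^+ 2) psi)).
  by apply/schwartz_heat/schwartz_scal => //; rewrite mulr_gt0 ?exprn_gt0.
have mW : meas2 (fun y => w (z - y)) by exact: meas2_refl_shift.
have bW : bounded2 (fun y => w (z - y)) by exact: bounded2_refl_shift.
have hd := integral_curve_derive mW bW sp rho0 tau0.
have e4 := kernel_factorization gp rho0 ka0 r0 s0 tau0 e1 e2 e3.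
have ev : integral2 (fun y => w (z - y) * (tau^-1 * curve rho tau (theta psi) y)) =
  4 * tau ^+ 3 * convol (convol w (heat a0 (scal (ka * tau) ((ka * tau) ^+ 2) psi)))
     (heat (- a0) (scal (r * tau) (s * tau ^+ 2) psi)) z.
  rewrite convolA // convE //; last exact: intg_convol.
  rewrite -integral2Zl; last by apply: intg_conv2 => //; exact: intg_convol.
  apply: eq_integral2 => y; have := congr1 (fun F => F y) e4 => /= ->.
  by rewrite mulrCA.
rewrite -ev; apply: near_eq_is_derive hd.
near=> t.
have t0 : 0 < t by near: t; exact: lt_nbhsr.
rewrite convE //; apply/schwartz_intg/schwartz_scal; rewrite ?mulr_gt0 ?exprn_gt0 //.
Unshelve. all: by end_near.
Qed.

Lemma continuous_refl2 w z : continuous w -> continuous (fun y => w (z - y)).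
Proof.
move=> cw y; apply: (cvg_comp (fun y => z - y) w); last exact: cw.
by apply: cvgB; [exact: cvg_cst|exact: cvg_id].
Qed.

(** After rescaling, the kernel is fixed and the argument [z - A n y] tends to [z]. Dominated
    convergence applies with majorant [B * |psi y|], and [psi] has integral 1. *)
Lemma cvg_convol_curve w psi (rho t : R) z : continuous w -> bounded2 w ->
  gauss4 psi -> 0 < rho -> 0 < t ->
  convol w (curve rho (t / n.+2%:R) psi) z @[n --> \oo] --> w z.
Proof.
move=> cw bw gp rho0 t0; have [sp _ _] := gp.
have mw := continuous_measurable2 cw.
have [B hB] := bw.
have tn n : 0 < t / n.+2%:R by rewrite divr_gt0.
pose A n y := aff (rho * (t / n.+2%:R)) ((t / n.+2%:R) ^+ 2) 0 y.
have mA n : meas2 (fun y => w (z - A n y)).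
  apply: continuous_measurable2; apply: (@continuous_aff _ _ _ _ (fun y => w (z - y))).
  exact: continuous_refl2.
have e n : convol w (curve rho (t / n.+2%:R) psi) z =
    integral2 (fun y => w (z - A n y) * psi y).
  rewrite convE //; last by apply/schwartz_intg/schwartz_scal; rewrite ?mulr_gt0 ?exprn_gt0.
  rewrite /curve integral_scal ?mulr_gt0 ?exprn_gt0 //.
    by apply: eq_integral2 => y; rewrite /A /aff /= !addr0.
  apply: (@intg_mulbd _ _ _ B) => //; first exact: schwartz_intg.
  have := mA n; apply: eq_measurable_fun => y _.
  by rewrite /A /aff /= !addr0.
rewrite (_ : (fun n => _) = (fun n => integral2 (fun y => w (z - A n y) * psi y))); last exact/funext.
rewrite (_ : w z = integral2 (fun y => w z * psi y)); last first.
  by rewrite integral2Zl ?(integral_gauss4 gp) ?mulr1 //; exact: schwartz_intg.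
apply: (@dominated2 _ _ _ (fun y => B * `|psi y|)).
- move=> n; apply: measurable_funM; last exact: schwartz_meas.
  by apply: mA.
- by apply: measurable_funM => //; exact: schwartz_meas.
- by apply: intgZl; apply: intg_norm; exact: schwartz_intg.
- by move=> n y; rewrite normrM ler_wpM2r.
move=> y; apply: cvgM; last exact: cvg_cst.
apply: (cvg_comp (fun n => z - A n y) w); last exact: cw.
have hA : A n y @[n --> \oo] --> (0 : R * R).
  have d0 := cvg_divSn t; rewrite -(cvg_shiftS (fun n => t / n.+1%:R)) in d0.
  have hp (u1 u2 : nat -> R) : u1 n @[n --> \oo] --> (0 : R) -> u2 n @[n --> \oo] --> (0 : R) ->
    (u1 n, u2 n) @[n --> \oo] --> ((0 : R), (0 : R)) by move=> h1 h2; have := cvg_pair h1 h2; exact.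
  apply: hp.
    rewrite -[X in _ --> X](_ : rho * 0 * y.1 + 0 = 0); last by rewrite mulr0 mul0r addr0.
    apply: cvgD; last exact: cvg_cst.
    apply: cvgM; last exact: cvg_cst.
    by apply: cvgM; [exact: cvg_cst|exact: d0].
  rewrite -[X in _ --> X](_ : 0 ^+ 2 * y.2 + 0 = 0); last by rewrite expr0n mul0r addr0.
  apply: cvgD; last exact: cvg_cst.
  by apply: cvgM; [exact: (cvgM d0 d0)|exact: cvg_cst].
have := cvgB (cvg_cst z) hA; rewrite subr0; exact.
Qed.

Lemma scale_exponents (t kap p q g : R) : 0 < t -> 0 < kap -> 0 <= q ->
  [/\ t * (kap * t) `^ (g - 2 - p) = kap `^ (g - 2 - p) * t `^ (g - p - 1),
      t * (kap * t) `^ (g - 2) = kap `^ (g - 2) * t `^ (g - 1) &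
      t * ((kap * t) `^ (g - 2 - p) * (q * t) `^ p) =
        kap `^ (g - 2 - p) * t `^ (g - 1) * q `^ p].
Proof.
move=> t0 k0 q0.
have tn (a b : R) : t `^ a * t `^ b = t `^ (a + b).
  by rewrite powRD // (gt_eqF t0) implybT.
have t1 (a : R) : t * t `^ a = t `^ (a + 1).
  by rewrite -[X in X * _]powRr1 ?ltW // tn addrC.
rewrite !powRM ?(ltW t0) ?(ltW k0) //; split.
- by rewrite mulrCA t1; congr (_ * _ `^ _); ring.
- by rewrite mulrCA t1; congr (_ * _ `^ _); ring.
have -> : t * (kap `^ (g - 2 - p) * t `^ (g - 2 - p) * (q `^ p * t `^ p)) =
   kap `^ (g - 2 - p) * q `^ p * (t * (t `^ (g - 2 - p) * t `^ p)) by ring.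
rewrite tn t1 mulrAC; congr (_ * _ `^ _ * _); ring.
Qed.

(** Splitting off [psi_T] leaves [r^4 = a0^2 - ka^4] and [s^2 = 1 - ka^4] with [ka = lam / (2 * T)].
    As [ka^4 <= lam^2 / 16], which is at most a sixteenth of both [a0^2] and 1, the numbers [r] and
    [s] stay bounded below uniformly in [a0] and [T]. *)
Lemma scale_parameters (lam T a0 : R) : 0 < lam <= 1 -> 1 <= T -> lam <= a0 <= lam^-1 ->
  exists r s : R, [/\ [/\ 0 < r <= lam^-1, 0 < s <= lam^-1 ^+ 2,
     s^-1 <= 2 & a0 * r ^- 2 <= 2 * lam ^- 2],
     Num.sqrt a0 ^+ 4 = a0 ^+ 2,
     (lam / (2 * T)) ^+ 4 + r ^+ 4 = Num.sqrt a0 ^+ 4 &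
     (lam / (2 * T)) ^+ 4 + s ^+ 2 = 1].
Proof.
move=> /andP[l0 l1] T1 /andP[la al].
have a00 : 0 < a0 by exact: lt_le_trans la.
have T0 : 0 < T by exact: lt_le_trans T1.
have k0 : 0 < lam / (2 * T) by rewrite divr_gt0 ?mulr_gt0.
have kl : lam / (2 * T) <= lam / 2.
  rewrite ler_pM2l // lef_pV2 ?posrE ?mulr_gt0 // ler_peMr //.
have li1 : 1 <= lam^-1 by rewrite invf_ge1.
move: kl k0; set ka := lam / (2 * T) => kl k0.
have k4 : ka ^+ 4 <= lam ^+ 2 / 16.
  apply: (@le_trans _ _ ((lam / 2) ^+ 4)); first by rewrite lerXn2r ?nnegrE ?(ltW k0) // divr_ge0 // ltW.
  have -> : (lam / 2) ^+ 4 = lam ^+ 2 / 16 * lam ^+ 2 by field.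
  by rewrite ler_piMr ?divr_ge0 ?sqr_ge0 // expr_le1 // ltW.
have k4g : 0 < ka ^+ 4 by rewrite exprn_gt0.
have l2 : lam ^+ 2 <= a0 ^+ 2 by rewrite lerXn2r ?nnegrE // ltW.
have l21 : lam ^+ 2 <= 1 by rewrite expr_le1 // ltW.
have l20 : 0 < lam ^+ 2 by rewrite exprn_gt0.
have e4 : Num.sqrt a0 ^+ 4 = a0 ^+ 2 by rewrite (exprM _ 2 2) sqr_sqrtr // ltW.
pose r2 := Num.sqrt (a0 ^+ 2 - ka ^+ 4).
have r2g : 0 <= a0 ^+ 2 - ka ^+ 4 by lra.
have r22 : r2 ^+ 2 = a0 ^+ 2 - ka ^+ 4 by rewrite sqr_sqrtr.
have r2l : lam / 2 <= r2.
  rewrite -(@ler_pXn2r _ 2) ?nnegrE ?sqrtr_ge0 ?divr_ge0 ?ltW // r22.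
  have -> : (lam / 2) ^+ 2 = lam ^+ 2 / 4 by field.
  lra.
have r2u : r2 <= a0.
  by rewrite -(@ler_pXn2r _ 2) ?nnegrE ?sqrtr_ge0 ?(ltW a00) // r22; lra.
have r20 : 0 < r2 by apply: lt_le_trans r2l; rewrite divr_gt0.
have rE : Num.sqrt r2 ^+ 2 = r2 by rewrite sqr_sqrtr // ltW.
have s2 : Num.sqrt (1 - ka ^+ 4) ^+ 2 = 1 - ka ^+ 4 by rewrite sqr_sqrtr //; lra.
have s0 : 0 <= Num.sqrt (1 - ka ^+ 4) by exact: sqrtr_ge0.
have sl : 2^-1 <= Num.sqrt (1 - ka ^+ 4).
  rewrite -(@ler_pXn2r _ 2) ?nnegrE ?sqrtr_ge0 // s2.
  have -> : (2^-1 : R) ^+ 2 = 1 / 4 by field.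
  lra.
exists (Num.sqrt r2), (Num.sqrt (1 - ka ^+ 4)); split; last 3 first.
- by [].
- by rewrite e4 [X in _ + X](exprM _ 2 2) rE r22 addrC subrK.
- by rewrite s2 addrC subrK.
have r1 : Num.sqrt r2 <= lam^-1.
  rewrite -(@ler_pXn2r _ 2) ?nnegrE ?sqrtr_ge0 ?invr_ge0 ?(ltW l0) // rE.
  by rewrite (le_trans r2u) // (le_trans al) // ler_eXnr.
split.
- by rewrite sqrtr_gt0 r20.
- rewrite (lt_le_trans _ sl) ?invr_gt0 //=.
  apply: (@le_trans _ _ 1); last by rewrite exprn_ege1.
  by rewrite -(@ler_pXn2r _ 2) ?nnegrE ?sqrtr_ge0 // s2 expr1n; lra.
- by rewrite -[leRHS]invrK lef_pV2 ?posrE ?invr_gt0 // (lt_le_trans _ sl) ?invr_gt0.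
rewrite rE; apply: (@le_trans _ _ (lam^-1 * (lam / 2)^-1)).
  apply: ler_pM => //; [exact: ltW|by rewrite invr_ge0 ltW|].
  by rewrite lef_pV2 ?posrE ?divr_gt0.
by rewrite invfM invrK mulrCA mulrA -expr2 exprVn mulrC.
Qed.

(* The parameter [kappa = lam / (2 T)] keeps the scale [kappa tau] at which the
   hypothesis is used below 1; the constants [cs] are annihilated by the second
   factor of [kernel_factorization], which has mean zero. *)
Lemma small_scale psi (lam T beta gam : R) : gauss4 psi -> 0 < lam <= 1 -> 1 <= T ->
  0 <= beta < gam -> gam < 2 ->
  exists2 C : R, 0 <= C & forall (a0 : R) w (cs : R -> R) (K : R) x0,
    lam <= a0 <= lam^-1 -> continuous w -> bounded2 w -> 0 <= K ->
    (forall (s : R) z, 0 < s <= 1 ->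
       `|convol w (heat a0 (scal s (s ^+ 2) psi)) z - cs s| <=
       K * (nrm (z - x0) `^ beta * s `^ (gam - 2 - beta) + s `^ (gam - 2))) ->
    forall (t : R) z, 0 < t <= T ->
      `|w z - convol w (curve (Num.sqrt a0) t psi) z| <=
      C * K * (nrm (z - x0) `^ beta * t `^ (gam - beta) + t `^ gam).
Proof.
move=> gp l01 T1 /andP[b0 bg] g2; have [sp _ _] := gp; have /andP[l0 l1] := l01.
have T0 : 0 < T by exact: lt_le_trans T1.
pose ka : R := lam / (2 * T).
have k0 : 0 < ka by rewrite divr_gt0 ?mulr_gt0.
pose c : R := lam^-1.
have c0 : 0 <= c by rewrite invr_ge0 ltW.
have gb0 : 0 < gam - beta by rewrite subr_gt0.
have g0 : 0 < gam by exact: le_lt_trans bg.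
have [m2 [m20 m2E]] : exists m2 : R, 0 <= m2 /\ mom ('D_(e_ R true) psi) = m2.
  by exists (mom ('D_(e_ R true) psi)); split => //; exact: mom_ge0.
have [m11 [m110 m11E]] : exists m11 : R, 0 <= m11 /\ mom ('D_(e_ R false) ('D_(e_ R false) psi)) = m11.
  by exists (mom ('D_(e_ R false) ('D_(e_ R false) psi))); split => //; exact: mom_ge0.
have [m mE] : exists m, 2 * m2 + 2 * lam ^- 2 * m11 = m by eexists.
have m0 : 0 <= m.
  rewrite -mE addr_ge0 //; first exact: mulr_ge0.
  by rewrite mulr_ge0 // mulr_ge0 // invr_ge0 exprn_ge0 // ltW.
(* These constants come from integrating the two powers of [u] in [bound] below. The factor 4 is
   that of the derivative in [tau]; a further 4 comes from [powRD_le]. *)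
pose C1 := 16 * m * ka `^ (gam - 2 - beta) / (gam - beta).
pose C2 := 4 * m * (ka `^ (gam - 2) + 4 * ka `^ (gam - 2 - beta) * c `^ beta) / gam.
have C10 : 0 <= C1 by rewrite divr_ge0 ?(ltW gb0) // mulr_ge0 ?powR_ge0 // mulr_ge0.
have C20 : 0 <= C2.
  rewrite divr_ge0 ?(ltW g0) // mulr_ge0 ?mulr_ge0 // addr_ge0 ?powR_ge0 //.
  by rewrite mulr_ge0 ?powR_ge0 // mulr_ge0 ?powR_ge0.
exists (C1 + C2); first exact: addr_ge0.
move=> a0 w cs K x0 la cw bw K0 hyp t z tT.
have a00 : 0 < a0 by have /andP[+ _] := la; exact: lt_le_trans.
have mw := continuous_measurable2 cw.
have [r [s [[rc sc si ri] e1 e2 e3]]] := scale_parameters l01 T1 la.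
have /andP[r0 _] := rc; have /andP[s0 _] := sc.
have rho0 : 0 < Num.sqrt a0 by rewrite sqrtr_gt0.
set D := nrm (z - x0).
pose A := 16 * m * ka `^ (gam - 2 - beta) * K * D `^ beta.
pose B := 4 * m * (ka `^ (gam - 2) + 4 * ka `^ (gam - 2 - beta) * c `^ beta) * K.
have A0 : 0 <= A by rewrite mulr_ge0 ?powR_ge0 // mulr_ge0 // mulr_ge0 ?powR_ge0 // mulr_ge0.
have B0 : 0 <= B.
  rewrite mulr_ge0 // mulr_ge0 ?mulr_ge0 // addr_ge0 ?powR_ge0 //.
  by rewrite mulr_ge0 ?powR_ge0 // mulr_ge0 ?powR_ge0.
have hd (u : R) : 0 < u -> is_derive u 1 (fun t => convol w (curve (Num.sqrt a0) t psi) z) _ :=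
  fun u0 => derive_convol_curve z gp mw bw rho0 k0 r0 s0 u0 e1 e2 e3.
have bound u : 0 < u <= T -> `|4 * u ^+ 3 *
    convol (convol w (heat a0 (scal (ka * u) ((ka * u) ^+ 2) psi)))
     (heat (- a0) (scal (r * u) (s * u ^+ 2) psi)) z| <=
     A * u `^ (gam - beta - 1) + B * u `^ (gam - 1).
  move=> /andP[u0 uT].
  have ku0 : 0 < ka * u by rewrite mulr_gt0.
  have ku1 : ka * u <= 1.
    rewrite /ka mulrAC ler_pdivrMr ?mulr_gt0 // mul1r.
    apply: (@le_trans _ _ (1 * T)); first by rewrite ler_pM // ltW.
    by rewrite ler_pM2r // ler1n.
  have S1 : schwartz (heat a0 (scal (ka * u) ((ka * u) ^+ 2) psi)).
    by apply/schwartz_heat/schwartz_scal => //; rewrite exprn_gt0.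
  set h := convol w _.
  have mh : meas2 h by apply: continuous_measurable2; exact: (@conv_continuous R w _ mw bw S1).
  have bh : bounded2 h by apply: conv_bounded => //; exact: schwartz_intg.
  have a1 : 0 <= K * (4 * D `^ beta * (ka * u) `^ (gam - 2 - beta) + (ka * u) `^ (gam - 2)).
    by rewrite mulr_ge0 // addr_ge0 ?powR_ge0 // mulr_ge0 ?powR_ge0 // mulr_ge0 ?powR_ge0.
  have b1 : 0 <= 4 * K * (ka * u) `^ (gam - 2 - beta).
    by rewrite mulr_ge0 ?powR_ge0 // mulr_ge0.
  have b2 : 0 <= beta <= 2 by rewrite b0 ltW // (lt_trans bg).
  (* The growth bound is recentred from [x0] to [z]: the distance from [z - y] to [x0] is at most
     [D + nrm y], so [D] becomes part of the constant and only [nrm y] is left to integrate against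
     the second kernel. *)
  have hh y : `|h (z - y) - cs (ka * u)| <=
     K * (4 * D `^ beta * (ka * u) `^ (gam - 2 - beta) + (ka * u) `^ (gam - 2)) +
     4 * K * (ka * u) `^ (gam - 2 - beta) * nrm y `^ beta.
    have /hyp h1 : 0 < ka * u <= 1 by rewrite ku0.
    apply: le_trans (h1 (z - y)) _.
    have h2 : nrm (z - y - x0) `^ beta <= 4 * (D `^ beta + nrm y `^ beta).
      apply: le_trans (powRD_le (nrm_ge0 _) (nrm_ge0 _) b2).
      rewrite ge0_ler_powR ?nnegrE ?addr_ge0 ?nrm_ge0 //.
      by rewrite addrAC -[nrm y]nrmN; exact: nrmD.
    have h3 := ler_wpM2r (powR_ge0 (ka * u) (gam - 2 - beta)) h2.
    have h4 : 0 <= (ka * u) `^ (gam - 2) by exact: powR_ge0.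
    move: h3 h4; move: (_ `^ (gam - 2 - beta)) (_ `^ (gam - 2)) (D `^ _) (nrm y `^ _).
    move: (nrm _ `^ _) => X p q d n h3 h4.
    rewrite -subr_ge0.
    have -> : K * (4 * d * p + q) + 4 * K * p * n - K * (X * p + q) =
      K * (4 * (d + n) * p - X * p) by ring.
    by rewrite mulr_ge0 // subr_ge0.
  have hb := convol_heat_bound mh bh sp rc sc u0 b2 a1 b1 (ltW a00) hh.
  rewrite normrM ger0_norm ?mulr_ge0 ?exprn_ge0 ?(ltW u0) //.
  have u3 : 0 <= 4 * u ^+ 3 by rewrite mulr_ge0 ?exprn_ge0 ?(ltW u0).
  apply: le_trans (ler_wpM2l u3 hb) _.
  have hm : s^-1 * mom ('D_(e_ R true) psi) + a0 * (r ^- 2 * mom ('D_(e_ R false) ('D_(e_ R false) psi))) <= m.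
    by rewrite m2E m11E -mE mulrA lerD // ler_wpM2r.
  set Q := _ + _ * _ `^ beta.
  have Q0 : 0 <= Q by rewrite addr_ge0 // mulr_ge0 ?powR_ge0.
  apply: (@le_trans _ _ (4 * u ^+ 3 * (Q * (m / u ^+ 2)))).
    by rewrite ler_wpM2l // ler_wpM2l // ler_wpM2r // invr_ge0 exprn_ge0 // ltW.
  have -> : 4 * u ^+ 3 * (Q * (m / u ^+ 2)) = 4 * m * (u * Q) by field; rewrite gt_eqF.
  have [E1 E2 E3] := scale_exponents beta gam u0 k0 c0.
  have -> : u * Q = K * (4 * D `^ beta * (u * (ka * u) `^ (gam - 2 - beta)) + u * (ka * u) `^ (gam - 2)) +
     4 * K * (u * ((ka * u) `^ (gam - 2 - beta) * (c * u) `^ beta)).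
    by rewrite /Q -/c; ring.
  rewrite E1 E2 E3 /A /B; apply: le_of_eq; ring.
have lim (u : R) : 0 < u -> convol w (curve (Num.sqrt a0) (u / n.+2%:R) psi) z @[n --> \oo] --> w z.
  by move=> u0; exact: cvg_convol_curve.
have := comparison gb0 g0 A0 B0 hd bound lim tT.
rewrite distrC => /le_trans; apply.
have t0 : 0 <= t `^ (gam - beta) by exact: powR_ge0.
have t1 : 0 <= t `^ gam by exact: powR_ge0.
have D0 : 0 <= D `^ beta by exact: powR_ge0.
have -> : A / (gam - beta) = C1 * K * D `^ beta by rewrite /A /C1; ring.
have -> : B / gam = C2 * K by rewrite /B /C2; ring.
rewrite -subr_ge0.
have -> : (C1 + C2) * K * (D `^ beta * t `^ (gam - beta) + t `^ gam) -
  (C1 * K * D `^ beta * t `^ (gam - beta) + C2 * K * t `^ gam) =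
  C1 * K * t `^ gam + C2 * K * (D `^ beta * t `^ (gam - beta)) by ring.
by rewrite addr_ge0 // mulr_ge0 // mulr_ge0.
Qed.

End SmallScale.

(** * Hoelder estimate *)

Section Periodic.
Variable R : realType.
Implicit Types f g k w : R * R -> R.
Implicit Types x y z : R * R.

Definition translate (m n : int) x : R * R := (x.1 + m%:~R, x.2 + n%:~R).

Lemma periodic2_nat w (m n : nat) x : periodic2 w -> w (x.1 + m%:R, x.2 + n%:R) = w x.
Proof.
move=> pw; have h1 z : w (z.1 + 1, z.2) = w z 
  by rewrite -[RHS](pw false z); congr w; apply: injective_projections; rewrite /= ?addr0.
have h2 z : w (z.1, z.2 + 1) = w z 
  by rewrite -[RHS](pw true z); congr w; apply: injective_projections; rewrite /= ?addr0.
elim: m => [|m IH] in x *; last first.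
  by rewrite -natr1 addrA (h1 (_, _)) IH.
rewrite addr0; elim: n => [|n IH]; first by rewrite addr0 -surjective_pairing.
by rewrite -natr1 addrA (h2 (_, _)) IH.
Qed.

Lemma periodic2_translate w m n x : periodic2 w -> w (translate m n x) = w x.
Proof.
move=> pw; rewrite /translate.
have [m1 [m2 ->]] : exists m1 m2 : nat, m = m1%:Z - m2%:Z.
  case: m => k; first by exists k, 0%N; rewrite subr0.
  by exists 0%N, k.+1; rewrite sub0r NegzE.
have [n1 [n2 ->]] : exists n1 n2 : nat, n = n1%:Z - n2%:Z.
  case: n => k; first by exists k, 0%N; rewrite subr0.
  by exists 0%N, k.+1; rewrite sub0r NegzE.
rewrite !intrB -!pmulrn -[LHS](periodic2_nat m2 n2) //= !addrA !addrNK.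
exact: periodic2_nat.
Qed.

Lemma cell_translate x y : exists m n : int,
  0 <= (translate m n y - x).1 <= 1 /\ 0 <= (translate m n y - x).2 <= 1.
Proof.
exists (- Num.floor (y.1 - x.1)), (- Num.floor (y.2 - x.2)).
rewrite /translate /= !intrN.
have /andP[a1 b1] := floor_itv (y.1 - x.1).
have /andP[a2 b2] := floor_itv (y.2 - x.2).
rewrite !intrD !mulr1z in b1 b2; move: a1 b1 a2 b2.
move: ((Num.floor (y.1 - x.1))%:~R : R) ((Num.floor (y.2 - x.2))%:~R : R) => p q.
by move=> a1 b1 a2 b2; split; apply/andP; split; lra.
Qed.

Lemma nrm_le2 z : `|z.1| <= 1 -> `|z.2| <= 1 -> nrm z <= 2.
Proof.
move=> h1 h2; rewrite -[2](natrD _ 1 1) /nrm lerD //.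
by rewrite -[1]sqrtr1 ler_wsqrtr.
Qed.

Lemma nrm_cell z : 0 <= z.1 <= 1 -> 0 <= z.2 <= 1 -> nrm z <= 2.
Proof. by move=> /andP[a b] /andP[c d]; rewrite nrm_le2 // ger0_norm. Qed.

Lemma periodic2_bounded w : continuous w -> periodic2 w -> bounded2 w.
Proof.
move=> cw pw.
have cK : compact (`[0, 1]%classic `*` `[0, 1]%classic : set (R * R)).
  by apply: compact_setX; exact: segment_compact.
have ci : compact [set w x | x in (`[0, 1]%classic `*` `[0, 1]%classic : set (R * R))].
  by apply: continuous_compact => //; exact: continuous_subspaceT.
have [B [_ hB]] := @compact_bounded R R _ ci.
exists (`|B| + 1) => x; have [m [n [h1 h2]]] := cell_translate 0 x.
rewrite -(periodic2_translate m n x pw); apply: hB.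
  by rewrite (le_lt_trans (ler_norm B)) // ltrDl.
exists (translate m n x) => //.
by rewrite subr0 in h1 h2; split => /=; rewrite in_itv.
Qed.

(* Stands for dividing by the best constant: iterating [step] from [A0] gives
   [2 H + A0 / 2^n] for all [n]. *)
Lemma absorb (T : Type) (X F : T -> R) (H A0 : R) : (forall i, 0 <= F i) ->
  0 <= H -> 0 <= A0 -> (forall i, X i <= A0 * F i) ->
  (forall A, 0 <= A -> (forall i, X i <= A * F i) -> forall i, X i <= (H + A / 2) * F i) ->
  forall i, X i <= 2 * H * F i.
Proof.
move=> F0 H0 A00 h0 step i.
have it n j : X j <= (2 * H + A0 / 2 ^+ n) * F j.
  elim: n j => [|n IH] j.
    by rewrite expr0 divr1; apply: le_trans (h0 j) _; rewrite ler_wpM2r // lerDr mulr_ge0.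
  have An : 0 <= 2 * H + A0 / 2 ^+ n by rewrite addr_ge0 ?mulr_ge0 // divr_ge0 // exprn_ge0.
  apply: le_trans (step _ An IH j) _; rewrite ler_wpM2r // exprS.
  by apply: le_of_eq; field; rewrite expf_neq0.
have lim : (2 * H + A0 / 2 ^+ n) * F i @[n --> \oo] --> (2 * H + 0) * F i.
  apply: cvgM; last exact: cvg_cst.
  apply: cvgD; first exact: cvg_cst.
  have /= := @cvg_geometric R A0 2^-1.
  rewrite ger0_norm // invf_lt1 // ltr1n => /(_ isT).
  rewrite (_ : geometric A0 2^-1 = (fun n => A0 / 2 ^+ n)) //.
  by apply/funext => n; rewrite /geometric /= exprVn.
rewrite addr0 in lim; rewrite -(cvg_lim _ lim) //; apply: limr_ge; first by apply: cvgP lim.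
by apply: nearW => n; exact: it.
Qed.

End Periodic.

(** * Hoelder bound for solutions with constant coefficient *)

Section HolderEstimate.
Variable R : realType.
Implicit Types f g k w : R * R -> R.
Implicit Types x y z : R * R.

Lemma curve_D w psi (rho t : R) b p : meas2 w -> bounded2 w -> schwartz psi ->
  0 < rho -> 0 < t ->
  is_derive p (e_ R b) (convol w (curve rho t psi))
    ((sel (rho * t) (t ^+ 2) b)^-1 * convol w (curve rho t ('D_(e_ R b) psi)) p).
Proof.
move=> mw bw sp rho0 t0.
have r0 : 0 < rho * t by rewrite mulr_gt0.
have s0 : 0 < t ^+ 2 by rewrite exprn_gt0.
have sb := schwartz_D b sp.
have h := @conv_is_derive R w _ b p mw bw (schwartz_scal r0 s0 sp).
rewrite (scal_D b r0 s0 sp) convol_Z // in h.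
by apply/schwartz_intg/schwartz_scal.
Qed.

Lemma curve_scales (lam a0 t : R) : 0 < lam <= 1 -> lam <= a0 <= lam^-1 -> 0 < t ->
  0 < Num.sqrt a0 * t <= lam^-1 * t /\ 0 < t ^+ 2 <= (lam^-1 * t) ^+ 2.
Proof.
move=> /andP[l0 l1] /andP[la al] t0.
have a00 : 0 < a0 by exact: lt_le_trans la.
have li1 : 1 <= lam^-1 by rewrite invf_ge1.
have rl : Num.sqrt a0 <= lam^-1.
  rewrite -(@ler_pXn2r _ 2) ?nnegrE ?sqrtr_ge0 ?invr_ge0 ?(ltW l0) //.
  by rewrite sqr_sqrtr ?(ltW a00) // (le_trans al) // ler_eXnr.
split; first by rewrite mulr_gt0 ?sqrtr_gt0 //= ler_wpM2r // ltW.
by rewrite exprn_gt0 //= exprMn ler_peMl ?exprn_ege1 // ltW // exprn_gt0.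
Qed.

Lemma curve_bound w k (lam a0 t g a b k0 : R) p : meas2 w -> bounded2 w -> schwartz k ->
  integral2 k = 0 -> 0 < lam <= 1 -> lam <= a0 <= lam^-1 -> 0 < t -> 0 <= g <= 2 ->
  0 <= a -> 0 <= b ->
  (forall z, `|w (p - z) - k0| <= a + b * nrm z `^ g) ->
  `|convol w (curve (Num.sqrt a0) t k) p| <= (a + b * (lam^-1 * t) `^ g) * mom k.
Proof.
move=> mw bw sk k0' l01 la t0 gg A0 B0 hw.
have [rr ss] := curve_scales l01 la t0; have /andP[r0 _] := rr; have /andP[s0 _] := ss.
have mw' := subcst_meas2 k0 mw; have bw' := subcst_bounded2 k0 bw.
have := convol_scal_bound mw' bw' sk rr ss gg A0 B0 hw.
rewrite conv_subcst //; last by apply/schwartz_intg/schwartz_scal.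
by rewrite integral_scal1 // k0' mulr0 subr0.
Qed.

Lemma sqrt_inv_le (lam a0 : R) : 0 < lam <= 1 -> lam <= a0 -> (Num.sqrt a0)^-1 <= lam^-1.
Proof.
move=> /andP[l0 l1] la; have a00 : 0 < a0 by exact: lt_le_trans la.
rewrite lef_pV2 ?posrE ?sqrtr_gt0 //.
rewrite -(@ler_pXn2r _ 2) ?nnegrE ?sqrtr_ge0 ?(ltW l0) // sqr_sqrtr ?(ltW a00) //.
by rewrite (le_trans _ la) // expr2 ler_piMr // ltW.
Qed.

(* The seminorm with [nrm (y - x) + eps] in place of [nrm (y - x)] is finite a priori,
   so that it can be absorbed; then [eps] is taken comparable to the distance. *)
Lemma holder_estimate psi (lam alpha : R) : gauss4 psi -> 0 < lam <= 1 -> 0 < alpha < 1 ->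
  exists2 C : R, 0 <= C & forall (a0 : R) w (cs : R -> R) (K : R),
    lam <= a0 <= lam^-1 -> continuous w -> periodic2 w -> 0 <= K ->
    (forall (s : R) z, 0 < s <= 1 ->
       `|convol w (heat a0 (scal s (s ^+ 2) psi)) z - cs s| <= K * s `^ (alpha - 2)) ->
    forall x y, `|w y - w x| <= C * K * nrm (y - x) `^ alpha.
Proof.
move=> gp l01 /andP[al0 al1]; have [sp _ _] := gp; have /andP[l0 l1] := l01.
have c0 : 0 <= lam^-1 by rewrite invr_ge0 ltW.
have al2 : 0 <= alpha <= 2 by rewrite (ltW al0) /= (le_trans (ltW al1)) // ler1n.
have [m1 [m10 m1E]] : exists m1 : R, 0 <= m1 /\ mom ('D_(e_ R false) psi) = m1.
  by exists (mom ('D_(e_ R false) psi)); split => //; exact: mom_ge0.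
have [m2 [m20 m2E]] : exists m2 : R, 0 <= m2 /\ mom ('D_(e_ R true) psi) = m2.
  by exists (mom ('D_(e_ R true) psi)); split => //; exact: mom_ge0.
have [C' [C'0 C'E]] : exists C' : R, 0 <= C' /\
    4 * (1 + lam^-1 `^ alpha) * (lam^-1 * m1 + m2) = C'.
  eexists; split; last by [].
  rewrite mulr_ge0 //; first by rewrite mulr_ge0 // addr_ge0 // powR_ge0.
  by rewrite addr_ge0 // mulr_ge0.
(* Since [alpha < 1], the power [L ^ (alpha - 1)] is small for large [L]. The choice makes it
   [1 / (1 + 2 * C')], which leaves at most half of the seminorm in the Taylor term [mid]. *)
have [L [L1 hL]] : exists L : R, 1 <= L /\ C' * L `^ (alpha - 1) <= 2^-1.
  have p0 : 0 < 1 - alpha by rewrite subr_gt0.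
  pose L := (1 + 2 * C') `^ (1 - alpha)^-1.
  have q1 : 1 <= 1 + 2 * C' by rewrite lerDl mulr_ge0.
  have q0 : 0 < 1 + 2 * C' by exact: lt_le_trans q1.
  exists L; split.
    rewrite -(powRr0 (1 + 2 * C')) ler_powR // invr_ge0 ltW //.
  have -> : L `^ (alpha - 1) = (1 + 2 * C')^-1.
    have e : (1 - alpha)^-1 * (alpha - 1) = -1 by field; rewrite gt_eqF.
    by rewrite /L -powRrM e powR_inv1 // ltW.
  rewrite (ler_pdivrMr _ _ q0).
  have -> : 2^-1 * (1 + 2 * C') = C' + 2^-1 by field.
  by rewrite lerDl invr_ge0.
have L0 : 0 < L by exact: lt_le_trans L1.
(* The scale will be [t = L * (d + eps)] with [d <= 2], by periodicity, and [eps <= 1]. *)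
have T1 : 1 <= 3 * L by rewrite -[leLHS]mulr1 ler_pM // ler1n.
have bg : (0 : R) <= 0 < alpha by apply/andP; split.
have g2 : alpha < 2 by rewrite (lt_trans al1) // ltr1n.
have [C0 C00 hA] := small_scale gp l01 T1 bg g2.
pose H := 4 * C0 * L `^ alpha.
have H0 : 0 <= H by rewrite mulr_ge0 ?powR_ge0 // mulr_ge0.
exists (4 * H); first exact: mulr_ge0.
move=> a0 w cs K la cw pw K0 hyp.
have /andP[la1 la2] := la.
have a00 : 0 < a0 by exact: lt_le_trans la1.
have rho0 : 0 < Num.sqrt a0 by rewrite sqrtr_gt0.
have bw := periodic2_bounded cw pw; have mw := continuous_measurable2 cw.
(* The case [beta = 0] of [small_scale]: the weight is then constantly 1, and the centre is put at
   [z] itself. *)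
have sm (t : R) z : 0 < t <= 3 * L ->
    `|w z - convol w (curve (Num.sqrt a0) t psi) z| <= 2 * C0 * K * t `^ alpha.
  move=> tL.
  have -> : 2 * C0 * K * t `^ alpha = C0 * K * (1 * t `^ alpha + t `^ alpha) by ring.
  rewrite -[X in 1 * t `^ X]subr0 -(powRr0 (nrm (z - z))); apply: hA => //.
  move=> s z' s01; apply: le_trans (hyp s z' s01) _.
  by rewrite powRr0 mul1r subr0 ler_wpM2l // lerDl powR_ge0.
have key (eps : R) : 0 < eps <= 1 -> forall x y,
    `|w y - w x| <= 2 * (H * K) * (nrm (y - x) + eps) `^ alpha.
  move=> /andP[e0 e1] x y.
  have [B hB] := bw; have B0 : 0 <= B by apply: le_trans (hB 0).
  pose X (p : (R * R) * (R * R)) := `|w p.2 - w p.1|.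
  pose F (p : (R * R) * (R * R)) := (nrm (p.2 - p.1) + eps) `^ alpha.
  apply: (@absorb R _ X F (H * K) (2 * B / eps `^ alpha) _ _ _ _ _ (x, y)).
  - by move=> p; exact: powR_ge0.
  - exact: mulr_ge0.
  - by rewrite divr_ge0 ?powR_ge0 // mulr_ge0.
  - move=> [p q]; rewrite /X /F /=.
    have ea : 0 < eps `^ alpha by exact: powR_gt0.
    apply: (@le_trans _ _ (2 * B / eps `^ alpha * eps `^ alpha)).
      rewrite divfK ?gt_eqF // mulr2n mulrDl mul1r.
      by rewrite (le_trans (ler_normB _ _)) // lerD.
    rewrite ler_wpM2l ?divr_ge0 ?(ltW ea) ?mulr_ge0 //.
    by rewrite ge0_ler_powR ?nnegrE ?addr_ge0 ?nrm_ge0 ?(ltW al0) ?(ltW e0) // lerDr nrm_ge0.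
  move=> A A0 hP.
  have near2 p q : nrm (q - p) <= 2 ->
      `|w q - w p| <= (H * K + A / 2) * (nrm (q - p) + eps) `^ alpha.
    set d := nrm _ => d2.
    have d0 : 0 <= d by exact: nrm_ge0.
    have de0 : 0 < d + eps by rewrite addrC ltr_wpDr.
    have [t tE] : exists t : R, t = L * (d + eps) by exists (L * (d + eps)).
    have t0 : 0 < t by rewrite tE mulr_gt0.
    have tL : 0 < t <= 3 * L.
      have h3 : d + eps <= 3 by move: d2 e1; clear; lra.
      by rewrite t0 /= tE [3 * L]mulrC ler_pM2l.
    have et : eps <= t.
      by apply: (@le_trans _ _ (1 * (d + eps))); [rewrite mul1r lerDr|rewrite tE ler_pM2r].
    have dt : d <= t / L by rewrite tE mulrC mulKf ?gt_eqF // lerDl ltW.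
    have d2t : d ^+ 2 <= t ^+ 2 / L.
      apply: (@le_trans _ _ ((t / L) ^+ 2)); first by rewrite lerXn2r ?nnegrE // divr_ge0 // ltW.
      rewrite exprMn ler_wpM2l ?exprn_ge0 ?(ltW t0) // expr2 ler_piMr ?invr_ge0 ?(ltW L0) //.
      by rewrite invf_le1.
    have [Q QE] : exists Q : R, Q = 4 * A * (1 + lam^-1 `^ alpha) * t `^ alpha by eexists.
    have Q0 : 0 <= Q by rewrite QE mulr_ge0 ?powR_ge0 // mulr_ge0 ?mulr_ge0 // addr_ge0 ?powR_ge0.
    (* A kernel of mean zero allows [w z] to be subtracted, and the current constant [A] bounds the
       remaining increment. The factor [Q] thus carries the [A] to be absorbed. *)
    have cb k z : schwartz k -> integral2 k = 0 ->
        `|convol w (curve (Num.sqrt a0) t k) z| <= Q * mom k.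
      move=> sk ik.
      have A1 : 0 <= 4 * A * eps `^ alpha by rewrite mulr_ge0 ?powR_ge0 // mulr_ge0.
      have A2 : 0 <= 4 * A by rewrite mulr_ge0.
      apply: le_trans (curve_bound (k0 := w z) mw bw sk ik l01 la t0 al2 A1 A2 _) _.
        move=> v; have := hP (z, z - v); rewrite /X /F /= (_ : z - v - z = - v); last by rewrite addrAC subrr sub0r.
        rewrite nrmN => /le_trans; apply.
        have := powRD_le (nrm_ge0 v) (ltW e0) al2 => /(ler_wpM2l A0) /le_trans; apply.
        by apply: le_of_eq; ring.
      rewrite ler_wpM2r ?mom_ge0 // powRM ?(ltW t0) // QE.
      have -> : 4 * A * (1 + lam^-1 `^ alpha) * t `^ alpha =
        4 * A * t `^ alpha + 4 * A * (lam^-1 `^ alpha * t `^ alpha) by ring.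
      rewrite lerD2r ler_wpM2l // ge0_ler_powR ?nnegrE ?(ltW al0) ?(ltW e0) ?(ltW t0) //.
    have sD b := schwartz_D b sp.
    have B1 z : `|(sel (Num.sqrt a0 * t) (t ^+ 2) false)^-1 *
        convol w (curve (Num.sqrt a0) t ('D_(e_ R false) psi)) z| <= Q * (lam^-1 * m1) / t.
      have rt0 : 0 <= (Num.sqrt a0 * t)^-1 by rewrite invr_ge0 (mulr_ge0 (ltW rho0) (ltW t0)).
      rewrite normrM (ger0_norm rt0).
      apply: le_trans (ler_wpM2l rt0 (cb _ z (sD false) (integral_D false sp))) _.
      rewrite m1E invfM.
      have -> : Q * (lam^-1 * m1) / t = lam^-1 / t * (Q * m1) by ring.
      apply: ler_wpM2r; first exact: mulr_ge0.
      apply: ler_wpM2r; first by rewrite invr_ge0 ltW.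
      exact: sqrt_inv_le.
    have B2 z : `|(sel (Num.sqrt a0 * t) (t ^+ 2) true)^-1 *
        convol w (curve (Num.sqrt a0) t ('D_(e_ R true) psi)) z| <= Q * m2 / t ^+ 2.
      have rt0 : 0 <= (t ^+ 2)^-1 by rewrite invr_ge0 exprn_ge0 // ltW.
      rewrite normrM (ger0_norm rt0).
      apply: le_trans (ler_wpM2l rt0 (cb _ z (sD true) (integral_D true sp))) _.
      by rewrite m2E mulrC.
    have lip := lipschitz2 (x := p) (y := q)
      (fun z => curve_D false z mw bw sp rho0 t0) (fun z => curve_D true z mw bw sp rho0 t0)
      (fun s _ => B1 (s, p.2)) (fun s _ => B2 (q.1, s)).
    have q1 : 0 <= Q * (lam^-1 * m1) / t by rewrite divr_ge0 ?(ltW t0) // mulr_ge0 // mulr_ge0.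
    have q2 : 0 <= Q * m2 / t ^+ 2 by exact: (divr_ge0 (mulr_ge0 Q0 m20) (exprn_ge0 2 (ltW t0))).
    have mid : `|convol w (curve (Num.sqrt a0) t psi) q - convol w (curve (Num.sqrt a0) t psi) p| <=
        A / 2 * (d + eps) `^ alpha.
      apply: le_trans lip _.
      have l1' : `|q.1 - p.1| <= t / L by exact: (le_trans (nrm_fst (q - p)) dt).
      have l2' : `|q.2 - p.2| <= t ^+ 2 / L by exact: (le_trans (nrm_snd (q - p)) d2t).
      apply: le_trans (lerD (ler_wpM2l q1 l1') (ler_wpM2l q2 l2')) _.
      have -> : Q * (lam^-1 * m1) / t * (t / L) + Q * m2 / t ^+ 2 * (t ^+ 2 / L) =
          A * (4 * (1 + lam^-1 `^ alpha) * (lam^-1 * m1 + m2)) * (t `^ alpha / L).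
        by rewrite QE; field; rewrite !gt_eqF.
      rewrite C'E tE powRM ?(ltW L0) ?(ltW de0) //.
      have -> : A * C' * (L `^ alpha * (d + eps) `^ alpha / L) =
          A * (C' * (L `^ alpha / L)) * (d + eps) `^ alpha by ring.
      rewrite ler_wpM2r ?powR_ge0 // ler_wpM2l //.
      by move: hL; rewrite powRD ?(gt_eqF L0) ?implybT // powR_inv1 // ltW.
    have s1 := sm t p tL; have s2 := sm t q tL.
    have -> : w q - w p = (w q - convol w (curve (Num.sqrt a0) t psi) q) -
       (w p - convol w (curve (Num.sqrt a0) t psi) p) +
       (convol w (curve (Num.sqrt a0) t psi) q - convol w (curve (Num.sqrt a0) t psi) p) by ring.
    rewrite mulrDl; apply: le_trans (ler_normD _ _) _; rewrite lerD //.
    apply: le_trans (ler_normB _ _) _; apply: le_trans (lerD s2 s1) _.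
    rewrite tE /H powRM ?(ltW L0) ?(ltW de0) //.
    by apply: le_of_eq; ring.
  move=> [p q]; rewrite /X /F /=.
  have [d2|d2] := leP (nrm (q - p)) 2; first exact: near2.
  (* For distant points [q] is translated into the unit cell at [p]: [w] does not change and the
     distance decreases. *)
  have [m [n [h1 h2]]] := cell_translate p q.
  rewrite -(periodic2_translate m n q pw).
  have n2 := nrm_cell h1 h2.
  apply: le_trans (near2 _ _ n2) _.
  rewrite ler_wpM2l //; first exact: (addr_ge0 (mulr_ge0 H0 K0) (divr_ge0 A0 (ler0n _ 2))).
  rewrite ge0_ler_powR ?nnegrE ?addr_ge0 ?nrm_ge0 ?(ltW al0) ?(ltW e0) // lerD2r.
  by rewrite (le_trans n2) // ltW.
move=> x y; have [->|] := eqVneq y x.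
  rewrite subrr normr0.
  exact: (mulr_ge0 (mulr_ge0 (mulr_ge0 (ler0n _ 4) H0) K0) (powR_ge0 _ _)).
rewrite -subr_eq0 => /nrm_gt0 d0; set d := nrm _ in d0 *.
pose eps := Num.min d 1.
have eb : 0 < eps <= 1 by rewrite lt_min d0 ltr01 ge_min lexx orbT.
have ed : eps <= d by rewrite ge_min lexx.
apply: le_trans (key eps eb x y) _; rewrite -/d.
apply: (@le_trans _ _ (2 * (H * K) * (2 * d `^ alpha))).
  apply: ler_wpM2l; first exact: (mulr_ge0 (ler0n _ 2) (mulr_ge0 H0 K0)).
  apply: (@le_trans _ _ ((2 * d) `^ alpha)).
    have /andP[eb0 _] := eb.
    rewrite ge0_ler_powR ?nnegrE ?addr_ge0 ?nrm_ge0 ?mulr_ge0 ?(ltW al0) ?(ltW eb0) ?(ltW d0) //.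
    by rewrite mulr_natl mulr2n lerD2l.
  rewrite powRM ?(ltW d0) // ler_wpM2r ?powR_ge0 //.
  by rewrite -[leRHS](@powRr1 _ 2) // ler_powR ?ler1n // ltW.
apply: le_of_eq; ring.
Qed.

End HolderEstimate.

(** * Second-order estimate *)

Section SecondOrder.
Variable R : realType.
Implicit Types f g k w : R * R -> R.
Implicit Types x y z : R * R.

Definition even1 k := forall x, k (- x.1, x.2) = k x.

Lemma intg_fst k : schwartz k -> intg (fun y => y.1 * k y).
Proof.
move=> sk; apply: (intg_le _ (intg_mom sk)).
  apply: measurable_funM; last exact: schwartz_meas.
  by apply: continuous_measurable2; exact: continuous_fst2.
move=> y; rewrite normrM ler_wpM2r //.
have := nrm_fst y; have := nrm_ge0 y => n0 h; rewrite expr2; nra.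
Qed.

(* By evenness in [x1], the derivatives [d_1^2 psi_1] and [d_2 psi_1] annihilate affine
   functions of [x1], so that [nu] does not enter the bounds on second derivatives. *)
Lemma integral_even1_fst k : schwartz k -> even1 k -> integral2 (fun y => y.1 * k y) = 0.
Proof.
move=> sk ek.
have ik := intg_fst sk.
have n1 : (-1 : R) != 0 by rewrite oppr_eq0 oner_eq0.
have e : integral2 ((fun y => y.1 * k y) \o affine2 (-1) 1 0 0) = -1 * integral2 (fun y => y.1 * k y).
  rewrite -integral2Zl //; apply: eq_integral2 => y.
  by rewrite /= /affine2 /affine1 /= !addr0 mul1r !mulN1r ek mulNr.
have := integral2_affine 0 0 n1 (oner_neq0 R) ik.
by rewrite e mulr1 normrN normr1 mul1r mulN1r; move: (integral2 _) => X; lra.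
Qed.

Lemma schwartz_fourier_inj k1 k2 : schwartz k1 -> schwartz k2 ->
  (forall l, fcos k1 l = fcos k2 l /\ fsin k1 l = fsin k2 l) -> k1 = k2.
Proof.
by move=> s1 s2; apply: fourier_inj;
  [exact: schwartz_continuous|exact: schwartz_continuous|exact: schwartz_domd|exact: schwartz_domd].
Qed.

(** The transform is even in the first frequency, so the reflected kernel has the same transform,
    and injectivity identifies the two. *)
Lemma even1_gauss4 psi : gauss4 psi -> even1 psi.
Proof.
move=> [sp hc hs] x.
have n1 : (-1 : R) != 0 by rewrite oppr_eq0 oner_eq0.
have sa : schwartz (fun x => psi (aff (-1) 1 0 x)) by apply: schwartz_aff => //; exact: oner_neq0.
have e : (fun x => psi (aff (-1) 1 0 x)) = psi.
  apply: schwartz_fourier_inj => // l; rewrite hc hs; split.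
    have i1 : intg (fun y => psi y * cos (dot (- l.1, l.2) y)) by apply: intg_cos; exact: schwartz_intg.
    have := hc (- l.1, l.2); rewrite /fcos /= (integral2_affine 0 0 n1 (oner_neq0 R) i1).
    rewrite mulr1 normrN normr1 mul1r (_ : (- l.1) ^+ 4 = l.1 ^+ 4); last by ring.
    move=> <-.
    apply: eq_integral2 => y; rewrite /= affE; congr (_ * cos _).
    by rewrite /dot /affine2 /affine1 /= !addr0 mul1r mulN1r mulrNN.
  have i1 : intg (fun y => psi y * sin (dot (- l.1, l.2) y)) by apply: intg_sin; exact: schwartz_intg.
  have := hs (- l.1, l.2); rewrite /fsin /= (integral2_affine 0 0 n1 (oner_neq0 R) i1).
  rewrite mulr1 normrN normr1 mul1r => <-.
  apply: eq_integral2 => y; rewrite /= affE; congr (_ * sin _).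
  by rewrite /dot /affine2 /affine1 /= !addr0 mul1r mulN1r mulrNN.
have := congr1 (fun F => F x) e; rewrite /aff /= !addr0 mul1r mulN1r; exact.
Qed.

Lemma D_aff k b x : schwartz k ->
  'D_(e_ R b) (fun x => k (aff (-1) 1 0 x)) x = sel (-1) 1 b * 'D_(e_ R b) k (aff (-1) 1 0 x).
Proof.
move=> sk; have h := derive_aff (schwartz_derivable (b := b) (x := aff (-1) 1 0 x) sk).
by rewrite (@derive_val _ _ _ _ _ _ _ h).
Qed.

Lemma affN x : aff (-1) 1 0 x = (- x.1, x.2).
Proof. by rewrite /aff /= !addr0 mul1r mulN1r. Qed.

Lemma even1_D2 k : schwartz k -> even1 k -> even1 ('D_(e_ R true) k).
Proof.
move=> sk ek x; have e : (fun x => k (aff (-1) 1 0 x)) = k by apply/funext => y; rewrite affN ek.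
by have := D_aff true x sk; rewrite e /sel mul1r affN => ->.
Qed.

Lemma D1_parity (c : R) k : schwartz k -> (forall x, k (- x.1, x.2) = c * k x) ->
  forall x, 'D_(e_ R false) k (- x.1, x.2) = - c * 'D_(e_ R false) k x.
Proof.
move=> sk ek x.
have e : (fun x => k (aff (-1) 1 0 x)) = (fun x => c * k x).
  by apply/funext => y; rewrite affN ek.
have h : c * 'D_(e_ R false) k x = -1 * 'D_(e_ R false) k (aff (-1) 1 0 x).
  apply: (etrans (esym (congr1 (fun F => F x) (derive_Z c false sk)))).
  exact: (etrans (esym (congr1 (fun F => 'D_(e_ R false) F x) e)) (D_aff false x sk)).
by rewrite mulNr h affN mulN1r opprK.
Qed.

Lemma even1_D11 k : schwartz k -> even1 k -> even1 ('D_(e_ R false) ('D_(e_ R false) k)).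
Proof.
move=> sk ek x; have e1 y : k (- y.1, y.2) = 1 * k y by rewrite mul1r ek.
by rewrite (D1_parity (schwartz_D false sk) (D1_parity sk e1)) opprK mul1r.
Qed.

Lemma curve_bound_affine w k (lam a0 t g a b k0 n1 : R) p : meas2 w -> bounded2 w ->
  schwartz k -> integral2 k = 0 -> integral2 (fun y => y.1 * k y) = 0 ->
  0 < lam <= 1 -> lam <= a0 <= lam^-1 -> 0 < t -> 0 <= g <= 2 ->
  0 <= a -> 0 <= b ->
  (forall z, `|w (p - z) - (k0 + n1 * z.1)| <= a + b * nrm z `^ g) ->
  `|convol w (curve (Num.sqrt a0) t k) p| <= (a + b * (lam^-1 * t) `^ g) * mom k.
Proof.
move=> mw bw sk ik0 ik1 l01 la t0 gg A0 B0 hw.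
have [rr ss] := curve_scales l01 la t0; have /andP[r0 _] := rr; have /andP[s0 _] := ss.
have sK : schwartz (curve (Num.sqrt a0) t k) by exact: schwartz_scal.
pose W z := w (p - z) - (k0 + n1 * z.1).
have mW : meas2 W.
  apply: measurable_funB; first exact: meas2_refl_shift.
  apply: continuous_measurable2; apply: cont_add2; first exact: cont_cst2.
  by apply: cont_mul2; [exact: cont_cst2|exact: continuous_fst2].
have -> : convol w (curve (Num.sqrt a0) t k) p =
    integral2 (fun z => W z * scal (Num.sqrt a0 * t) (t ^+ 2) k z).
  rewrite convE //; last exact: schwartz_intg.
  rewrite (eq_integral2 (f := fun z => W z * _)
     (g := fun z => w (p - z) * curve (Num.sqrt a0) t k z -
        (k0 * curve (Num.sqrt a0) t k z + n1 * (z.1 * curve (Num.sqrt a0) t k z)))); last first.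
    by move=> z; rewrite /W /curve; ring.
  have i1 := schwartz_intg sK; have i2 := intg_fst sK.
  have c0 : integral2 (curve (Num.sqrt a0) t k) = 0 by rewrite (integral_scal1 r0 s0 sk) ik0.
  have c1 : integral2 (fun z => z.1 * curve (Num.sqrt a0) t k z) = 0.
    rewrite (@integral_scal R _ _ k fst r0 s0); last first.
      by under eq_fun do rewrite -mulrA; apply: intgZl; exact: intg_fst.
    rewrite (eq_integral2 (g := fun y => Num.sqrt a0 * t * (y.1 * k y))); last first.
      by move=> y; rewrite /= mulrA.
    by rewrite integral2Zl ?ik1 ?mulr0 //; exact: intg_fst.
  move: sK i1 i2 c0 c1; move: (curve _ _ _) => Kc sK i1 i2 c0 c1.
  rewrite integral2B; [|exact: intg_conv2|by apply: intgD; exact: intgZl].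
  rewrite integral2D ?integral2Zl //; try exact: intgZl.
  by rewrite c0 c1 !mulr0 addr0 subr0.
exact: integral_scal_bound.
Qed.

Lemma between_dist (a b t : R) : (a <= t <= b) || (b <= t <= a) -> `|t - a| <= `|b - a|.
Proof.
case/orP => /andP[p q]; first by rewrite !ger0_norm; lra.
by rewrite !ler0_norm; lra.
Qed.

Lemma taylor_line (F F1 F2 : R -> R) (a b B : R) :
  (forall t : R, is_derive t 1 F (F1 t)) -> (forall t : R, is_derive t 1 F1 (F2 t)) ->
  (forall t, (a <= t <= b) || (b <= t <= a) -> `|F2 t| <= B) ->
  `|F b - F a - F1 a * (b - a)| <= B * `|b - a| ^+ 2.
Proof.
move=> h1 h2 hB.
have B0 : 0 <= B.
  by apply: le_trans (hB a _) => //; rewrite !lexx /=; case: (leP a b) => // /ltW ->.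
have h3 t : is_derive (t : R) 1 (fun t => F t - F1 a * t) (F1 t - F1 a).
  have := is_deriveB (h1 t) (is_derive_mull (F1 a) t); exact.
have -> : F b - F a - F1 a * (b - a) = (F b - F1 a * b) - (F a - F1 a * a) by ring.
have -> : B * `|b - a| ^+ 2 = B * `|b - a| * `|b - a| by ring.
apply: (slice_lipschitz h3) => t ht.
apply: (@le_trans _ _ (B * `|t - a|)).
  apply: (slice_lipschitz h2) => u hu; apply: hB.
  by case/orP: ht => /andP[p q]; case/orP: hu => /andP[p' q']; apply/orP; [left|left|right|right]; apply/andP; split; lra.
by apply: ler_wpM2l => //; exact: between_dist.
Qed.

(** Expansion of second order in the first variable and of first order in the second: in parabolic
    scaling [d_1^2] and [d_2] both cost [t^-2]. *)
Lemma taylor2 (F F1 F2 F11 : R * R -> R) x y (B1 B2 : R) :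
  (forall z, is_derive z (e_ R false) F (F1 z)) ->
  (forall z, is_derive z (e_ R true) F (F2 z)) ->
  (forall z, is_derive z (e_ R false) F1 (F11 z)) ->
  (forall t, (x.1 <= t <= y.1) || (y.1 <= t <= x.1) -> `|F11 (t, x.2)| <= B1) ->
  (forall t, (x.2 <= t <= y.2) || (y.2 <= t <= x.2) -> `|F2 (y.1, t)| <= B2) ->
  `|F y - F x - F1 x * (y.1 - x.1)| <= B1 * `|y.1 - x.1| ^+ 2 + B2 * `|y.2 - x.2|.
Proof.
move=> h1 h2 h11 b1 b2; case: x b1 b2 => x1 x2; case: y => y1 y2 /= b1 b2.
have l1 := taylor_line (fun t : R => is_derive_slice1 (h1 (t, x2)))
  (fun t : R => is_derive_slice1 (h11 (t, x2))) b1.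
have l2 := slice_lipschitz (fun t : R => is_derive_slice2 (h2 (y1, t))) b2.
rewrite (_ : F (y1, y2) - F (x1, x2) - F1 (x1, x2) * (y1 - x1) =
  (F (y1, x2) - F (x1, x2) - F1 (x1, x2) * (y1 - x1)) + (F (y1, y2) - F (y1, x2))); last by ring.
by apply: le_trans (ler_normD _ _) _; rewrite lerD.
Qed.

(** Let [F] be the convolution of [w] with the kernel at scale [t]. Replacing [w] by [F] costs
    [2 * E]; the Taylor remainder of [F] is bounded through the growth bound with constant [M], at
    the rate [M * t^(g - 2)]. This yields an expansion with slope [F1 x0]; dividing by [s] at the
    point at distance [s] along [e_1] bounds [F1 x0 - nu]. The parameter [s] remains free, to be
    optimized separately from [t]. *)
Lemma curve_taylor psi w x0 (lam a0 t g nu M E C11 C2 : R) : gauss4 psi ->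
  0 < lam <= 1 -> lam <= a0 <= lam^-1 -> meas2 w -> bounded2 w -> 0 < t ->
  1 <= g <= 2 -> 0 <= M ->
  4 * (1 + lam^-1 `^ g) * (lam ^- 2 * mom ('D_(e_ R false) ('D_(e_ R false) psi))) = C11 ->
  4 * (1 + lam^-1 `^ g) * mom ('D_(e_ R true) psi) = C2 ->
  (forall z, `|w z - w x0 - nu * (z - x0).1| <= M * nrm (z - x0) `^ g) ->
  (forall z, nrm (z - x0) <= t -> `|w z - convol w (curve (Num.sqrt a0) t psi) z| <= E) ->
  forall (s : R) y, 0 < s <= t -> nrm (y - x0) <= t ->
  `|w y - w x0 - nu * (y - x0).1| <=
    2 * E + M * t `^ g / t ^+ 2 * (C11 * `|(y - x0).1| ^+ 2 + C2 * `|(y - x0).2|) +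
    (2 * E + M * s `^ g + M * t `^ g / t ^+ 2 * C11 * s ^+ 2) / s * `|(y - x0).1|.
Proof.
move=> gp l01 la mw bw t0 /andP[g1 g2] M0 hC11 hC2 hR hE.
have [sp _ _] := gp; have ep := even1_gauss4 gp.
have /andP[l0 l1] := l01; have /andP[la1 la2] := la.
have a00 : 0 < a0 by exact: lt_le_trans la1.
have rho0 : 0 < Num.sqrt a0 by rewrite sqrtr_gt0.
have s1 := schwartz_D false sp; have s11 := schwartz_D false s1.
have s2 := schwartz_D true sp.
have g0 : 0 <= g by exact: le_trans ler01 g1.
have g02 : 0 <= g <= 2 by rewrite g0.
pose r := Num.sqrt a0.
pose F := convol w (curve r t psi).
pose F1 p := (r * t)^-1 * convol w (curve r t ('D_(e_ R false) psi)) p.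
pose F11 p := (r * t)^-1 * ((r * t)^-1 * convol w (curve r t ('D_(e_ R false) ('D_(e_ R false) psi))) p).
pose F2 p := (t ^+ 2)^-1 * convol w (curve r t ('D_(e_ R true) psi)) p.
have hF1 z : is_derive z (e_ R false) F (F1 z) by exact: (curve_D false z mw bw sp rho0 t0).
have hF2 z : is_derive z (e_ R true) F (F2 z) by exact: (curve_D true z mw bw sp rho0 t0).
have hF11 z : is_derive z (e_ R false) F1 (F11 z).
  exact: (is_deriveZ (r * t)^-1 (curve_D false z mw bw s1 rho0 t0)).
have tg0 : 0 <= t `^ g by exact: powR_ge0.
(* Seen from [p], the affine part of the growth bound is [w x0 + nu * (p - x0).1 - nu * z.1]. The
   even kernels annihilate it, so the estimate involves [M] but not [nu]. *)
have cb k p : schwartz k -> integral2 k = 0 -> even1 k -> nrm (p - x0) <= t ->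
    `|convol w (curve r t k) p| <= M * (4 * (1 + lam^-1 `^ g)) * t `^ g * mom k.
  move=> sk ik ek pt.
  have A1 : 0 <= 4 * M * t `^ g by rewrite mulr_ge0 // mulr_ge0.
  have A2 : 0 <= 4 * M by rewrite mulr_ge0.
  have hz z : `|w (p - z) - (w x0 + nu * (p - x0).1 + (- nu) * z.1)| <=
      4 * M * t `^ g + 4 * M * nrm z `^ g.
    have -> : w (p - z) - (w x0 + nu * (p - x0).1 + (- nu) * z.1) =
        w (p - z) - w x0 - nu * (p - z - x0).1 by rewrite /=; ring.
    apply: le_trans (hR _) _.
    apply: (@le_trans _ _ (M * (4 * (t `^ g + nrm z `^ g)))); last by apply: le_of_eq; ring.
    apply: ler_wpM2l => //; apply: le_trans (powRD_le (ltW t0) (nrm_ge0 z) g02).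
    rewrite ge0_ler_powR ?nnegrE ?nrm_ge0 ?addr_ge0 ?(ltW t0) //.
    rewrite addrAC; apply: le_trans (nrmD _ _) _; by rewrite nrmN lerD2r.
  apply: le_trans (curve_bound_affine mw bw sk ik (integral_even1_fst sk ek) l01 la t0 g02 A1 A2 hz) _.
  have li0 : 0 <= lam^-1 by rewrite invr_ge0 ltW.
  apply: ler_wpM2r; first exact: mom_ge0.
  rewrite powRM ?(ltW t0) //; apply: le_of_eq; ring.
have B11 p : nrm (p - x0) <= t -> `|F11 p| <= M * t `^ g / t ^+ 2 * C11.
  move=> pt; have := cb _ p s11 (integral_D false s1) (even1_D11 sp ep) pt.
  rewrite /F11; move: (convol _ _ p) => X hX.
  have rt0 : 0 <= (r * t)^-1 by rewrite invr_ge0 (mulr_ge0 (ltW rho0) (ltW t0)).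
  have rt1 : (r * t)^-1 <= lam^-1 / t.
    rewrite invfM; apply: ler_wpM2r; first by rewrite invr_ge0 ltW.
    exact: sqrt_inv_le.
  have lt0 : 0 <= lam^-1 / t by exact: le_trans rt0 rt1.
  rewrite mulrA normrM ger0_norm; last exact: mulr_ge0.
  apply: (@le_trans _ _ (lam^-1 / t * (lam^-1 / t) * (M * (4 * (1 + lam^-1 `^ g)) * t `^ g *
    mom ('D_(e_ R false) ('D_(e_ R false) psi))))).
    by apply: ler_pM => //; [exact: mulr_ge0|apply: ler_pM].
  rewrite -hC11; move: (mom _) => m; apply: le_of_eq; field.
  by rewrite !gt_eqF.
have B2 p : nrm (p - x0) <= t -> `|F2 p| <= M * t `^ g / t ^+ 2 * C2.
  move=> pt; have := cb _ p s2 (integral_D true sp) (even1_D2 sp ep) pt.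
  rewrite /F2; move: (convol _ _ p) => X hX.
  have rt0 : 0 <= (t ^+ 2)^-1 by rewrite invr_ge0 exprn_ge0 // ltW.
  rewrite normrM ger0_norm //; apply: le_trans (ler_wpM2l rt0 hX) _.
  by rewrite -hC2; move: (mom _) => m; apply: le_of_eq; field; rewrite gt_eqF.
have tay y : nrm (y - x0) <= t ->
    `|F y - F x0 - F1 x0 * (y - x0).1| <=
      M * t `^ g / t ^+ 2 * C11 * `|(y - x0).1| ^+ 2 + M * t `^ g / t ^+ 2 * C2 * `|(y - x0).2|.
  move=> yt; apply: (taylor2 (x := x0) (y := y) hF1 hF2 hF11) => u hu.
    apply: B11; apply: le_trans yt; rewrite /nrm /= subrr normr0 sqrtr0 addr0.
    apply: (@le_trans _ _ `|y.1 - x0.1|); last by rewrite lerDl sqrtr_ge0.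
    exact: between_dist.
  apply: B2; apply: le_trans yt; rewrite /nrm /= lerD2l ler_wsqrtr //.
  exact: between_dist.
move=> s y /andP[s0 st] yt.
have E0 : nrm (x0 - x0) <= t by rewrite subrr /nrm /= normr0 sqrtr0 addr0 ltW.
have Ex := hE _ E0.
have decomp z : nrm (z - x0) <= t ->
    `|w z - w x0 - F1 x0 * (z - x0).1| <= 2 * E +
      (M * t `^ g / t ^+ 2 * C11 * `|(z - x0).1| ^+ 2 + M * t `^ g / t ^+ 2 * C2 * `|(z - x0).2|).
  move=> zt; have -> : w z - w x0 - F1 x0 * (z - x0).1 =
    (w z - F z) - (w x0 - F x0) + (F z - F x0 - F1 x0 * (z - x0).1) by ring.
  apply: le_trans (ler_normD _ _) _; rewrite lerD ?tay //.
  apply: le_trans (ler_normB _ _) _; rewrite mulr2n mulrDl mul1r lerD //; exact: hE.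
have slope : `|F1 x0 - nu| <= (2 * E + M * s `^ g + M * t `^ g / t ^+ 2 * C11 * s ^+ 2) / s.
  rewrite ler_pdivlMr // -[X in _ * X](ger0_norm (ltW s0)) -normrM.
  pose z : R * R := (x0.1 + s, x0.2).
  have zx : z - x0 = (s, 0) by apply: injective_projections; rewrite /z /= ?subrr // addrC addKr.
  have nz : nrm (z - x0) = s by rewrite zx /nrm /= normr0 sqrtr0 addr0 ger0_norm // ltW.
  have zt : nrm (z - x0) <= t by rewrite nz.
  have := decomp z zt; have := hR z; rewrite nz zx /= normr0 mulr0 addr0 (ger0_norm (ltW s0)).
  move=> h1 h2; have -> : (F1 x0 - nu) * s = (w z - w x0 - nu * s) - (w z - w x0 - F1 x0 * s) by ring.
  by apply: le_trans (ler_normB _ _) _; apply: le_trans (lerD h1 h2) _; rewrite addrA [M * s `^ g + _]addrC.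
have -> : w y - w x0 - nu * (y - x0).1 =
  (w y - w x0 - F1 x0 * (y - x0).1) + (F1 x0 - nu) * (y - x0).1 by ring.
apply: le_trans (ler_normD _ _) _; apply: lerD.
  by apply: le_trans (decomp y yt) _; apply: le_of_eq; ring.
by rewrite normrM; apply: ler_wpM2r.
Qed.

(** As [g < 2], a large [L] makes [L ^ (g - 2)] small; as [g > 1], a small [e] then makes
    [e ^ (g - 1) + C11 * e] small against the fixed [L ^ (g - 1)]. Each part is brought below 1/12.
    The sum 1/6 becomes 1/2 after the factor 3 lost in passing to distant points. *)
Lemma schauder_parameters (g C11 Cs : R) : 1 < g < 2 -> 0 <= C11 -> 0 <= Cs ->
  exists L e : R, [/\ 1 <= L, 0 < e <= 1 &
    Cs * L `^ (g - 2) + (e `^ (g - 1) + C11 * e) * L `^ (g - 1) <= 6^-1].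
Proof.
move=> /andP[g1 g2] C110 Cs0.
have p0 : 0 < 2 - g by rewrite subr_gt0.
have q0 : 0 < g - 1 by rewrite subr_gt0.
have [X XE] : exists X : R, X = 1 + 12 * Cs by eexists.
have X1 : 1 <= X by rewrite XE lerDl mulr_ge0.
have X0 : 0 < X by exact: lt_le_trans X1.
have [L LE] : exists L : R, L = X `^ (2 - g)^-1 by eexists.
have L1 : 1 <= L by rewrite LE -[leLHS](powRr0 X); apply: ler_powR => //; rewrite invr_ge0 ltW.
have hL : L `^ (g - 2) = X^-1.
  have e : (2 - g)^-1 * (g - 2) = -1 by field; rewrite gt_eqF.
  by rewrite LE -powRrM e powR_inv1 // ltW.
have [Y YE] : exists Y : R, Y = 12 * (1 + C11) * L `^ (g - 1) by eexists.
have Lg1 : 1 <= L `^ (g - 1) by rewrite -[leLHS](powRr0 L); apply: ler_powR => //; exact: ltW.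
have Y1 : 1 <= Y.
  rewrite YE -[leLHS]mulr1; apply: ler_pM => //.
  by rewrite -[leLHS]mulr1; apply: ler_pM => //; [rewrite ler1n|rewrite lerDl].
have Y0 : 0 < Y by exact: lt_le_trans Y1.
have [e eE] : exists e : R, e = (Y^-1) `^ (g - 1)^-1 by eexists.
have Yi0 : 0 < Y^-1 by rewrite invr_gt0.
have Yi1 : Y^-1 <= 1 by rewrite invf_le1.
have e0 : 0 < e by rewrite eE powR_gt0.
have e1 : e <= 1.
  have e' : 1 `^ (g - 1)^-1 = 1 :> R by rewrite powR1.
  by rewrite eE -[leRHS]e' ge0_ler_powR ?nnegrE ?invr_ge0 ?(ltW Yi0) ?(ltW Y0) ?(ltW q0).
have he : e `^ (g - 1) = Y^-1.
  by rewrite eE -powRrM mulVf ?gt_eqF // powRr1 // ltW.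
have ele : e <= Y^-1.
  rewrite -he -[leLHS]powRr1 ?(ltW e0) //; apply: ger_powR; rewrite ?e0 //.
  by rewrite lerBlDr -[leRHS](natrD _ 1 1) ltW.
exists L, e; split; [by []|by rewrite e0|].
have h1 : Cs * L `^ (g - 2) <= 12^-1.
  rewrite hL ler_pdivrMr // XE mulrDr mulr1 mulKf //; lra.
have h2 : (e `^ (g - 1) + C11 * e) * L `^ (g - 1) <= 12^-1.
  apply: (@le_trans _ _ ((Y^-1 + C11 * Y^-1) * L `^ (g - 1))).
    by apply: ler_wpM2r; [exact: powR_ge0|rewrite he lerD2l ler_wpM2l].
  have -> : (Y^-1 + C11 * Y^-1) * L `^ (g - 1) = 12 * (1 + C11) * L `^ (g - 1) * Y^-1 / 12 by field; rewrite gt_eqF.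
  by rewrite -YE divff ?gt_eqF // mul1r.
lra.
Qed.

(* The slope of [w * k_tau] at [x0] is compared to [nu] through the point
   [x0 + e tau e_1]: first [L], then [e] is chosen to absorb the terms in [M]. *)
Lemma schauder_estimate psi (lam b g : R) : gauss4 psi -> 0 < lam <= 1 ->
  1 < g < 2 -> 0 <= b < g ->
  exists2 C : R, 0 <= C & forall (a0 : R) w (cs : R -> R) (K M nu : R) x0,
    lam <= a0 <= lam^-1 -> continuous w -> periodic2 w -> 0 <= K -> 0 <= M ->
    (forall (s : R) z, 0 < s <= 1 ->
       `|convol w (heat a0 (scal s (s ^+ 2) psi)) z - cs s| <=
       K * (nrm (z - x0) `^ b * s `^ (g - 2 - b) + s `^ (g - 2))) ->
    (forall z, `|w z - w x0 - nu * (z - x0).1| <= M * nrm (z - x0) `^ g) ->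
    forall z, `|w z - w x0 - nu * (z - x0).1| <= (C * K + M / 2) * nrm (z - x0) `^ g.
Proof.
move=> gp l01 g12 /andP[b0 bg]; have /andP[g1 g2] := g12; have [sp _ _] := gp.
have g0 : 0 < g by exact: lt_trans g1.
have g12' : 1 <= g <= 2 by rewrite !ltW.
have [C11 hC11] : exists C11 : R, 4 * (1 + lam^-1 `^ g) *
    (lam ^- 2 * mom ('D_(e_ R false) ('D_(e_ R false) psi))) = C11 by eexists.
have [C2 hC2] : exists C2 : R, 4 * (1 + lam^-1 `^ g) * mom ('D_(e_ R true) psi) = C2 by eexists.
have q0 : 0 <= 4 * (1 + lam^-1 `^ g) by rewrite mulr_ge0 // addr_ge0 // powR_ge0.
have C110 : 0 <= C11.
  rewrite -hC11 mulr_ge0 // mulr_ge0 ?mom_ge0 // invr_ge0 sqr_ge0 //.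
have C20 : 0 <= C2 by rewrite -hC2 mulr_ge0 // mom_ge0.
have [L [e [L1 e01 hLe]]] := schauder_parameters g12 C110 (addr_ge0 C110 C20).
have /andP[e0 e1] := e01.
have L0 : 0 < L by exact: lt_le_trans L1.
(* The scale will be [t = L * d] with [d <= 2]; distant points are treated at the end by
   periodicity. *)
have T1 : 1 <= 2 * L by rewrite -[leLHS]mulr1 ler_pM // ler1n.
have bg' : 0 <= b < g by rewrite b0.
have [C0 C00 hA] := small_scale gp l01 T1 bg' g2.
(* Twice the small-scale error [2 * C0 * K * t^g] at [t = L * d] gives [4 * C0 * L^g]; it enters a
   second time in the comparison of slopes, divided by [e * L], and [L >= 1]. *)
have [H HE] : exists H : R, H = 4 * C0 * L `^ g * (1 + e^-1) by eexists.
have Lg0 : 0 <= L `^ g by exact: powR_ge0.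
have H0 : 0 <= H.
  by rewrite HE mulr_ge0 ?addr_ge0 ?invr_ge0 ?(ltW e0) // mulr_ge0 // mulr_ge0.
exists (3 * H); first exact: mulr_ge0.
move=> a0 w cs K M nu x0 la cw pw K0 M0 hyp hR.
have bw := periodic2_bounded cw pw; have mw := continuous_measurable2 cw.
have [X XE] : exists X : R, X = H * K + M / 6 by eexists.
have X0 : 0 <= X by rewrite XE addr_ge0 ?mulr_ge0 // invr_ge0.
have near2 y : nrm (y - x0) <= 2 ->
    `|w y - w x0 - nu * (y - x0).1| <= X * nrm (y - x0) `^ g.
  have [->|] := eqVneq y x0.
    by rewrite !subrr mulr0 subr0 normr0 mulr_ge0 // powR_ge0.
  rewrite -subr_eq0 => /nrm_gt0; have dn1 := nrm_fst (y - x0); have dn2 := nrm_snd (y - x0).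
  move Ed : (nrm (y - x0)) dn1 dn2 => d dn1 dn2 d0 d2.
  have [t tE] : exists t : R, t = L * d by eexists.
  have t0 : 0 < t by rewrite tE mulr_gt0.
  have tL : 0 < t <= 2 * L by rewrite t0 /= tE [2 * L]mulrC ler_pM2l.
  have dt : d <= t by rewrite tE ler_peMl // ltW.
  have tg0 : 0 <= t `^ g by exact: powR_ge0.
  have hE z : nrm (z - x0) <= t ->
      `|w z - convol w (curve (Num.sqrt a0) t psi) z| <= 2 * C0 * K * t `^ g.
    move=> zt; apply: le_trans (hA a0 w cs K x0 la cw bw K0 hyp t z tL) _.
    have h : nrm (z - x0) `^ b * t `^ (g - b) <= t `^ g.
      have -> : t `^ g = t `^ b * t `^ (g - b).
        by rewrite -powRD ?(gt_eqF t0) ?implybT // addrC subrK.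
      apply: ler_wpM2r; first exact: powR_ge0.
      by rewrite ge0_ler_powR ?nnegrE ?nrm_ge0 ?(ltW t0).
    have -> : 2 * C0 * K * t `^ g = C0 * K * (t `^ g + t `^ g) by ring.
    by apply: ler_wpM2l; [exact: mulr_ge0|rewrite lerD2r].
  have st : 0 < e * t <= t by rewrite mulr_gt0 //= ler_piMl // ltW.
  have yt : nrm (y - x0) <= t by rewrite Ed.
  have := curve_taylor gp l01 la mw bw t0 g12' M0 hC11 hC2 hR hE st yt.
  move=> /le_trans; apply.
  have d1t : `|(y - x0).1| <= t / L by rewrite tE mulrC mulKf ?gt_eqF.
  have d11 : `|(y - x0).1| ^+ 2 <= (t / L) ^+ 2 by rewrite lerXn2r ?nnegrE // divr_ge0 // ltW.
  have d2t : `|(y - x0).2| <= (t / L) ^+ 2 by rewrite tE mulrC mulKf ?gt_eqF.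
  have li : 0 <= L^-1 by rewrite invr_ge0 ltW.
  have eg : (e * t) `^ g = e `^ (g - 1) * e * t `^ g.
    rewrite powRM ?(ltW e0) ?(ltW t0) //; congr (_ * _).
    by rewrite -{3}(powRr1 (ltW e0)) -powRD ?subrK // (gt_eqF e0) implybT.
  have eL2 : L `^ g / L ^+ 2 = L `^ (g - 2).
    by rewrite powRD ?(gt_eqF L0) ?implybT // powRN powR_mulrn // ltW.
  have eL1 : L `^ g / L = L `^ (g - 1).
    by rewrite powRD ?(gt_eqF L0) ?implybT // powR_inv1 // ltW.
  have tq : t `^ g = L `^ g * d `^ g by rewrite tE powRM // ltW.
  have dg0 : 0 <= d `^ g by exact: powR_ge0.
  have eg0 : 0 <= e `^ (g - 1) by exact: powR_ge0.
  have A0 : 0 <= M * t `^ g / t ^+ 2 by rewrite divr_ge0 ?sqr_ge0 // mulr_ge0.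
  have E0 : 0 <= 2 * (2 * C0 * K * t `^ g).
    by rewrite mulr_ge0 // mulr_ge0 // mulr_ge0 // mulr_ge0.
  apply: (@le_trans _ _ (2 * (2 * C0 * K * t `^ g) +
      M * t `^ g / t ^+ 2 * (C11 * (t / L) ^+ 2 + C2 * (t / L) ^+ 2) +
      (2 * (2 * C0 * K * t `^ g) + M * (e * t) `^ g + M * t `^ g / t ^+ 2 * C11 * (e * t) ^+ 2)
        / (e * t) * (t / L))).
    apply: lerD.
      by rewrite lerD2l; apply: ler_wpM2l => //; apply: lerD; apply: ler_wpM2l.
    apply: ler_wpM2l => //; apply: divr_ge0; last exact: mulr_ge0 (ltW e0) (ltW t0).
    apply: addr_ge0; first by apply: addr_ge0 => //; apply: mulr_ge0 => //; exact: powR_ge0.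
    by apply: mulr_ge0; [exact: mulr_ge0|exact: sqr_ge0].
  rewrite eg XE; move: (e `^ (g - 1)) (L `^ (g - 2)) (L `^ (g - 1)) (L `^ g) (t `^ g) (d `^ g)
     hLe eL2 eL1 tq dg0 eg0 Lg0 HE {E0 A0 hE hA eg tg0} => E1 L2 L1' Lg q D hLe eL2 eL1 tq D0 E10 Lg0 HE.
  apply: (@le_trans _ _ (4 * C0 * Lg * (1 + e^-1 / L) * K * D +
     M * ((C11 + C2) * L2 + (E1 + C11 * e) * L1') * D)).
    rewrite -eL1 -eL2 tq; apply: le_of_eq; field.
    by rewrite !gt_eqF.
  rewrite [leRHS]mulrDl; apply: lerD.
    rewrite HE; apply: ler_wpM2r => //; apply: ler_wpM2r => //; apply: ler_wpM2l.
      by rewrite mulr_ge0 // mulr_ge0.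
    rewrite lerD2l ler_piMr ?invr_ge0 ?(ltW e0) //; by rewrite invf_le1.
  by apply: ler_wpM2r => //; apply: ler_wpM2l.
(* The slope is read off at [x0 + e_1], where [w] takes the same value as at [x0] and the distance
   is 1. *)
have hnu : `|nu| <= X.
  pose z : R * R := x0 + e_ R false.
  have zx : z - x0 = e_ R false by rewrite /z addrC addKr.
  have nz : nrm (z - x0) = 1 by rewrite zx /nrm /= normr0 sqrtr0 addr0 normr1.
  have n2 : nrm (z - x0) <= 2 by rewrite nz ler1n.
  have := near2 z n2; rewrite nz zx /z pw subrr sub0r normrN powR1 !mulr1; exact.
move=> y; have [d2|d2] := leP (nrm (y - x0)) 2.
  apply: le_trans (near2 y d2) _; apply: ler_wpM2r; first exact: powR_ge0.
  have h1 : 0 <= H * K by exact: mulr_ge0.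
  by rewrite XE -mulrA; move: (H * K) h1 M0 => HK; clear; lra.
(* Unlike [w], the affine term is not periodic: translating [y] by [m] in the first variable leaves
   the error [nu * m], where [|m|] is at most 1 plus the distance. With the bound on [nu] this
   accounts for two of the three multiples of [X] below. *)
have [m [n [h1 h2]]] := cell_translate x0 y.
have n2 := nrm_cell h1 h2.
have hw := near2 _ n2; rewrite (periodic2_translate m n y pw) in hw.
have e1' : (translate m n y - x0).1 = (y - x0).1 + m%:~R by rewrite /translate /= addrAC.
rewrite e1' in hw h1.
have hm : `|m%:~R : R| <= 1 + nrm (y - x0).
  have -> : (m%:~R : R) = ((y - x0).1 + m%:~R) - (y - x0).1 by rewrite addrC addKr.
  apply: le_trans (ler_normB _ _) _; apply: lerD; last exact: nrm_fst.
  by have /andP[p q] := h1; rewrite ger0_norm.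
have -> : w y - w x0 - nu * (y - x0).1 = (w y - w x0 - nu * ((y - x0).1 + m%:~R)) + nu * m%:~R by ring.
apply: le_trans (ler_normD _ _) _; rewrite normrM.
have D0 : 0 < nrm (y - x0) by exact: lt_trans d2.
have D1 : 1 <= nrm (y - x0) `^ g.
  have e' : 1 `^ g = 1 :> R by rewrite powR1.
  by rewrite -[leLHS]e' ge0_ler_powR ?nnegrE ?(ltW g0) ?(ltW D0) // (le_trans _ (ltW d2)) // ler1n.
have D2 : nrm (y - x0) <= nrm (y - x0) `^ g.
  rewrite -[leLHS](powRr1 (ltW D0)); apply: ler_powR; last exact: ltW.
  by rewrite (le_trans _ (ltW d2)) // ler1n.
have D3 : nrm (translate m n y - x0) `^ g <= nrm (y - x0) `^ g.
  by rewrite ge0_ler_powR ?nnegrE ?nrm_ge0 ?(ltW g0) // (le_trans n2) // ltW.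
apply: (@le_trans _ _ (X * nrm (y - x0) `^ g + X * (1 + nrm (y - x0)))).
  apply: lerD; first by apply: le_trans hw _; apply: ler_wpM2l.
  exact: ler_pM.
move: D1 D2; move: (nrm (y - x0)) (nrm (y - x0) `^ g) => d P D1' D2'.
apply: (@le_trans _ _ (3 * X * P)).
  have -> : 3 * X * P = X * P + X * (P + P) by ring.
  by rewrite lerD2l; apply: ler_wpM2l => //; exact: lerD.
by rewrite XE; apply: le_of_eq; field.
Qed.

End SecondOrder.

(** * Periodic distributions and the mollified equation *)

Section Translation.
Variable R : realType.
Implicit Types (k w : R * R -> R) (psi : R -> R * R -> R).
Implicit Types x y z : R * R.

Lemma kernel_fourier psi (T : R) l : is_kernel psi -> 0 < T ->
  fcos (psi T) l = expR (- T * (l.1 ^+ 4 + l.2 ^+ 2)) /\ fsin (psi T) l = 0.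
Proof.
move=> hp T0; have [_ /(_ l)] := hp T T0.
rewrite /fourier => -[h1 h2]; split; first exact: h1.
by apply: oppr_inj; rewrite oppr0; exact: h2.
Qed.

Lemma gauss4_kernel psi : is_kernel psi -> gauss4 (psi 1).
Proof.
move=> hp; split; first by have [] := hp 1 ltr01.
  by move=> l; have [-> _] := kernel_fourier l hp ltr01; rewrite mulN1r.
by move=> l; have [_ ->] := kernel_fourier l hp ltr01.
Qed.

Lemma gauss4_unique (k1 k2 : R * R -> R) : gauss4 k1 -> gauss4 k2 -> k1 = k2.
Proof.
move=> [s1 c1 i1] [s2 c2 i2]; apply: schwartz_fourier_inj => // l.
by rewrite c1 c2 i1 i2.
Qed.

Lemma kernel_scal psi (s : R) : is_kernel psi -> 0 < s ->
  psi (s ^+ 4) = scal s (s ^+ 2) (psi 1).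
Proof.
move=> hp s0; have s40 : 0 < s ^+ 4 by rewrite exprn_gt0.
have s20 : 0 < s ^+ 2 by rewrite exprn_gt0.
have [sp _ _] := gauss4_kernel hp.
apply: schwartz_fourier_inj; [by have [] := hp _ s40|exact: schwartz_scal|move=> l].
rewrite fcos_scal // fsin_scal //.
have [-> ->] := kernel_fourier l hp s40.
have [-> ->] := kernel_fourier (l.1 * s, l.2 * s ^+ 2) hp ltr01.
by split => //; congr expR; rewrite /=; ring.
Qed.

Lemma derive_convol w k b : meas2 w -> bounded2 w -> schwartz k ->
  'D_(e_ R b) (convol w k) = convol w ('D_(e_ R b) k).
Proof.
move=> mw bw sk; apply/funext => x.
have h := @conv_is_derive R w k b x mw bw sk.
exact: (@derive_val _ _ _ _ _ _ _ h).
Qed.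

(** The substitution [T = s ^+ 4] passes to the length scale [s = T^(1/4)], in which all estimates
    are written. *)
Lemma scale_supP (p N : R) (g : R -> R * R -> R) : (scale_sup p g <= N%:E)%E ->
  forall (s : R) x, 0 < s <= 1 -> `|g (s ^+ 4) x| <= N * s `^ (- p).
Proof.
move=> hg s x /andP[s0 s1].
have s4 : 0 < s ^+ 4 <= 1 by rewrite exprn_gt0 //= exprn_ile1 // ltW.
have h1 : ((((s ^+ 4) `^ 4^-1) `^ p)%:E * supnorm (g (s ^+ 4)%R) <= N%:E)%E.
  by apply: le_trans hg; apply: ereal_sup_ubound; exists (s ^+ 4).
have e : (s ^+ 4) `^ 4^-1 = s.
  by rewrite -powR_mulrn ?(ltW s0) // -powRrM divff ?powRr1 // ltW.
rewrite e in h1.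
have h2 : ((s `^ p)%:E * (`|g (s ^+ 4)%R x|)%:E <= N%:E)%E.
  apply: le_trans h1; apply: lee_wpmul2l; first by rewrite lee_fin powR_ge0.
  by apply: ereal_sup_ubound; exists x.
move: h2; rewrite -EFinM lee_fin => h2.
by rewrite powRN ler_pdivlMr ?powR_gt0 // mulrC.
Qed.

Lemma schwartz_refl k x : schwartz k -> schwartz (fun y => k (x - y)).
Proof.
move=> sk; have n1 : (-1 : R) != 0 by rewrite oppr_eq0 oner_eq0.
have := schwartz_aff x n1 n1 sk; congr schwartz; apply/funext => y; congr k.
by apply: injective_projections; rewrite /aff /= mulN1r addrC.
Qed.

Lemma derive_refl k x b : schwartz k ->
  'D_(e_ R b) (fun y => k (x - y)) = fun y => -1 * 'D_(e_ R b) k (x - y).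
Proof.
move=> sk; apply/funext => y.
have affB z : aff (-1) (-1) x z = x - z.
  by apply: injective_projections; rewrite /aff /= mulN1r addrC.
have h := derive_aff (schwartz_derivable (b := b) (x := aff (-1) (-1) x y) sk).
rewrite (_ : (fun y => k (x - y)) = (fun y => k (aff (-1) (-1) x y))); last first.
  by apply/funext => z; rewrite affB.
rewrite -affB; by rewrite (@derive_val _ _ _ _ _ _ _ h); case: b {h}.
Qed.

(** The equation is tested with the reflected kernel [y |-> k (x - y)]: the reflection undoes the
    signs of the adjoint operator and leaves [heat a0 k]. The mean of [F] becomes a term constant in
    [x], one of the constants [cs] of the estimates. *)
Lemma solves_convol (a0 : R) (F : functional R) v k : solves a0 F v -> schwartz k ->
  forall x, convol v (heat a0 k) x = dist_conv F k x - dist_mean F * integral2 k.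
Proof.
move=> [cv pv _ hv] sk x; have bv := periodic2_bounded cv pv.
have mv := continuous_measurable2 cv.
have sr := schwartz_refl x sk.
have := hv _ sr; rewrite /dist_proj0 integral2_refl_shift; last exact: schwartz_intg.
rewrite -/(dist_conv F k x) => <-; rewrite /heat_op /dist_of_fun.
have s1 := schwartz_D false sk.
have e2 y := congr1 (fun f => f y) (derive_refl x true sk).
have e11 y : 'D_(e_ R false) ('D_(e_ R false) (fun y => k (x - y))) y =
    'D_(e_ R false) ('D_(e_ R false) k) (x - y).
  rewrite (derive_refl x false sk).
  have /= -> := congr1 (fun f => f y) (derive_Z (-1) false (schwartz_refl x s1)).
  have /= -> := congr1 (fun f => f y) (derive_refl x false s1).
  by rewrite mulrA mulrNN !mul1r.
apply: eq_integral2 => y; apply: (congr1 (fun t => v y * t)).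
rewrite /d1 /d2 e11; have /= -> := e2 y.
by rewrite mulN1r opprK.
Qed.

(** The limit within [[l, u]] is an ordinary derivative at interior points and yields a local
    Lipschitz bound, hence continuity, at every point including the end points. This is what the
    mean value theorem on [[s, t]] requires. *)
Lemma one_sided_lipschitz (g dg : R -> R) (l u B : R) :
  (forall s, s \in `[l, u] ->
     (g (s + h) - g s) / h @[h --> within [set h | s + h \in `[l, u]] 0^'] --> dg s) ->
  (forall s, s \in `[l, u] -> `|dg s| <= B) ->
  forall s t, s \in `[l, u] -> t \in `[l, u] -> `|g t - g s| <= B * `|t - s|.
Proof.
move=> hg hB s t.
wlog st : s t / s < t => [H sl tl|].
  have [st|ts|->] := ltgtP s t; first exact: H.
    by rewrite distrC [`|t - s|]distrC; exact: H.
  by rewrite !subrr normr0 mulr0.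
rewrite !in_itv /= => /andP[ls su] /andP[lt tu].
have loc p : l <= p <= u -> exists2 d : R, 0 < d & forall q, l <= q <= u -> `|q - p| < d ->
    `|g q - g p| <= (`|dg p| + 1) * `|q - p|.
  move=> pl; have /cvgrPdist_lt /(_ 1 ltr01) := hg p pl.
  move=> [d /= d0 hd]; exists d => // q ql qp.
  have [->|qp0] := eqVneq q p; first by rewrite !subrr normr0 mulr0.
  have qp1 : q - p != 0 by rewrite subr_eq0.
  have := hd (q - p); rewrite /= sub0r normrN addrCA subrr addr0 => /(_ qp qp1).
  rewrite in_itv /= => /(_ ql) h1.
  have -> : g q - g p = (g q - g p) / (q - p) * (q - p) by rewrite divfK.
  rewrite normrM; apply: ler_wpM2r => //.
  move: h1; set X := _ / _ => h1.
  have -> : X = dg p - (dg p - X) by ring.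
  by apply: le_trans (ler_normB _ _) _; rewrite lerD2l ltW.
have cont p (e : R) : l <= p <= u -> 0 < e -> exists2 d : R, 0 < d &
    forall q, l <= q <= u -> `|q - p| < d -> `|g p - g q| < e.
  move=> pl e0; have [d d0 hd] := loc p pl.
  have c0 : 0 < `|dg p| + 1 by rewrite ltr_wpDl.
  exists (Num.min d (e / (`|dg p| + 1))); first by rewrite lt_min d0 divr_gt0.
  move=> q ql; rewrite lt_min => /andP[h1 h2]; rewrite distrC.
  by apply: le_lt_trans (hd q ql h1) _; rewrite mulrC -ltr_pdivlMr.
have hd p : p \in `]s, t[ -> is_derive p 1 g (dg p).
  rewrite in_itv /= => /andP[sp pt].
  have pl : p \in `[l, u] by rewrite in_itv /= (ltW (le_lt_trans ls sp)) (ltW (lt_le_trans pt tu)).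
  apply: is_derive_cvg; apply/cvgrPdist_lt => e e0.
  have /cvgrPdist_lt /(_ e e0) hn := hg p pl.
  near=> h.
  have hl : p + h \in `[l, u].
    rewrite in_itv /=; have : `|h| < Num.min (p - s) (t - p).
      near: h; apply: cvg_within; exists (Num.min (p - s) (t - p)) => /=.
        by rewrite lt_min !subr_gt0 sp pt.
      by move=> h'; rewrite /= sub0r normrN.
    rewrite lt_min !ltr_norml => /andP[/andP[a1 _] /andP[_ b1]].
    by apply/andP; split; lra.
  rewrite mulrC [h + p]addrC; move: hl; near: h; exact: hn.
have cg : {within `[s, t], continuous g}.
  apply/continuous_within_itvP => //; split.
  - move=> p pst; have [dp _] := hd p pst.
    by apply: differentiable_continuous; apply/derivable1_diffP.
  - apply/cvgrPdist_lt => e e0; have sl : l <= s <= u by rewrite ls.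
    have [d d0 hc] := cont s e sl e0; near=> q; apply: hc.
      rewrite (le_trans ls) /=; last by near: q; exact: nbhs_right_ge.
      by apply: le_trans tu; near: q; exact: nbhs_right_le.
    by near: q; exists d => //= q0 + _; rewrite /= distrC.
  apply/cvgrPdist_lt => e e0; have tl : l <= t <= u by rewrite lt.
  have [d d0 hc] := cont t e tl e0; near=> q; apply: hc.
    rewrite (le_trans ls) /=; last by near: q; exact: nbhs_left_ge.
    by apply: le_trans tu; near: q; exact: nbhs_left_le.
  by near: q; exists d => //= q0 + _; rewrite /= distrC.
have [c] := MVT st hd cg; rewrite in_itv /= => /andP[sc ct] ->.
rewrite normrM; apply: ler_wpM2r => //; apply: hB.
by rewrite in_itv /= (ltW (le_lt_trans ls sc)) (ltW (lt_le_trans ct tu)).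
Unshelve. all: by end_near. Qed.

Lemma neg_norm1P psi (lam alpha N : R) (F dF : R -> functional R) (a0 : R) :
  (neg_norm1 psi lam alpha F dF <= N%:E)%E -> a0 \in `[lam, lam^-1] ->
  forall (s : R) x, 0 < s <= 1 ->
    `|mollify psi (F a0) (s ^+ 4) x| <= N * s `^ (alpha - 2) /\
    `|mollify psi (dF a0) (s ^+ 4) x| <= N * s `^ (alpha - 2).
Proof.
move=> hN la s x s01.
have : (maxe (neg_norm psi alpha (F a0)) (neg_norm psi alpha (dF a0)) <= N%:E)%E.
  by apply: le_trans hN; apply: ereal_sup_ubound; exists a0.
rewrite ge_max => /andP[h1 h2].
by rewrite -(opprB 2 alpha); split; [exact: scale_supP h1 _ _ s01|exact: scale_supP h2 _ _ s01].
Qed.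

(** The place where the [a0]-derivative enters: for fixed [x] and [s] the mollified family is a real
    function of [a0], with derivative bounded by the second half of [neg_norm1]. *)
Lemma mollify_lipschitz psi (lam alpha N : R) (F dF : R -> functional R) :
  is_kernel psi -> is_family_derivative lam F dF ->
  (neg_norm1 psi lam alpha F dF <= N%:E)%E ->
  forall (s : R) x a0 a1, 0 < s <= 1 -> a0 \in `[lam, lam^-1] -> a1 \in `[lam, lam^-1] ->
    `|mollify psi (F a1) (s ^+ 4) x - mollify psi (F a0) (s ^+ 4) x| <=
      N * s `^ (alpha - 2) * `|a1 - a0|.
Proof.
move=> hp hF hN s x a0 a1 s01 h0 h1; have /andP[s0 _] := s01.
have s40 : 0 < s ^+ 4 by rewrite exprn_gt0.
have [sp _] := hp _ s40; have sr := schwartz_refl x sp.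
apply: (@one_sided_lipschitz (fun b => F b (fun y => psi (s ^+ 4) (x - y)))
  (fun b => dF b (fun y => psi (s ^+ 4) (x - y))) lam lam^-1) => //.
  by move=> b hb; exact: hF.
by move=> b hb; have [] := neg_norm1P hN hb x s01.
Qed.

End Translation.

(** * Modelled functions *)

Section Modelled.
Variable R : realType.
Implicit Types (k w u : R * R -> R) (x y z : R * R).

Definition cperiodic w := continuous w /\ periodic2 w.

Lemma cperiodic_meas w : cperiodic w -> meas2 w.
Proof. by case=> cw _; exact: continuous_measurable2. Qed.

Lemma cperiodic_bounded w : cperiodic w -> bounded2 w.
Proof. by case=> cw pw; exact: periodic2_bounded. Qed.

Lemma cperiodic_lin (c : R) w1 w2 : cperiodic w1 -> cperiodic w2 ->
  cperiodic (fun y => c * w1 y + w2 y).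
Proof.
move=> [c1 p1] [c2 p2]; split; last by move=> b x; rewrite p1 p2.
apply: cont_add2; last exact: c2.
by apply: cont_mul2; [exact: cont_cst2|exact: c1].
Qed.

Lemma cperiodic_sum (I : Type) (r : seq I) (s : I -> R) (V : I -> R * R -> R) :
  (forall i, cperiodic (V i)) -> cperiodic (fun y => \sum_(i <- r) s i * V i y).
Proof.
move=> hV; elim: r => [|i r IH].
  under eq_fun do rewrite big_nil; split; [exact: cont_cst2|by []].
by under eq_fun do rewrite big_cons; exact: cperiodic_lin.
Qed.

Lemma convol_sum (I : Type) (r : seq I) (s : I -> R) (V : I -> R * R -> R) k x :
  (forall i, cperiodic (V i)) -> intg k ->
  convol (fun y => \sum_(i <- r) s i * V i y) k x = \sum_(i <- r) s i * convol (V i) k x.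
Proof.
move=> hV ik; elim: r => [|i r IH].
  rewrite big_nil; under eq_fun do rewrite big_nil.
  rewrite /convol -[RHS](mul0r (integral2 (fun y => k (x - y)))) -integral2Zl //.
  exact: intg_refl_shift.
rewrite big_cons -IH -conv_linl //; try exact: cperiodic_meas; try exact: cperiodic_bounded.
- by congr convol; apply/funext => y; rewrite big_cons.
- by apply: cperiodic_meas; exact: cperiodic_sum.
- by apply: cperiodic_bounded; exact: cperiodic_sum.
Qed.

(** Taking [y = x + e_1], where all increments vanish by periodicity, gives [|nu| <= M]. For
    distances up to 1 every power is dominated by the one with exponent [alpha]. Otherwise [y] is
    translated into the unit cell at [x], where the powers with exponents [2 * alpha], [alpha] and 1
    are at most 4, 2 and 2; this gives [6 = 4 + 2] in front of [M]. *)
Lemma modelled_holder (alpha : R) (n : nat) u x (V : 'I_n -> R * R -> R)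
    (s Nf : 'I_n -> R) (CV nu M : R) :
  0 < alpha < 1 -> periodic2 u -> (forall i, periodic2 (V i)) ->
  0 <= CV -> (forall i, 0 <= Nf i) -> 0 <= M ->
  (forall i y, `|V i y - V i x| <= CV * Nf i * nrm (y - x) `^ alpha) ->
  (forall y, `|u y - u x - \sum_(i < n) s i * (V i y - V i x) - nu * (y - x).1|
     <= M * nrm (y - x) `^ (2 * alpha)) ->
  forall y, `|u y - u x| <= (6 * M + 2 * (CV * \sum_(i < n) Nf i * `|s i|)) * nrm (y - x) `^ alpha.
Proof.
move=> /andP[al0 al1] pu pV CV0 N0 M0 hV hR.
have [S SE] : exists S : R, S = CV * \sum_(i < n) Nf i * `|s i| by eexists.
have S0 : 0 <= S by rewrite SE mulr_ge0 // sumr_ge0 // => i _; rewrite mulr_ge0.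
have hnu : `|nu| <= M.
  have := hR (x + e_ R false).
  have zx : x + e_ R false - x = e_ R false by rewrite addrC addKr.
  have nz : nrm (e_ R false) = 1 by rewrite /nrm /= normr0 sqrtr0 addr0 normr1.
  rewrite zx nz powR1 pu subrr big1 => [|i _]; last by rewrite pV subrr mulr0.
  by rewrite subr0 sub0r normrN !mulr1.
have base y : `|u y - u x| <= M * nrm (y - x) `^ (2 * alpha) + S * nrm (y - x) `^ alpha + M * nrm (y - x).
  have -> : u y - u x = (u y - u x - \sum_(i < n) s i * (V i y - V i x) - nu * (y - x).1) +
    \sum_(i < n) s i * (V i y - V i x) + nu * (y - x).1 by move: (\sum_(i < n) _) => Z; ring.
  apply: le_trans (ler_normD _ _) _; apply: lerD; last first.
    by rewrite normrM; apply: ler_pM => //; exact: nrm_fst.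
  apply: le_trans (ler_normD _ _) _; apply: lerD; first exact: hR.
  apply: le_trans (ler_norm_sum _ _ _) _.
  rewrite SE mulr_sumr mulr_suml; apply: ler_sum => i _; rewrite normrM.
  have -> : CV * (Nf i * `|s i|) * nrm (y - x) `^ alpha = `|s i| * (CV * Nf i * nrm (y - x) `^ alpha) by ring.
  by apply: ler_wpM2l.
move=> y; rewrite -SE.
have al20 : 0 <= 2 * alpha by rewrite mulr_ge0 // ltW.
have ale : alpha <= 2 * alpha by rewrite mulr_natl mulr2n lerDl ltW.
have [->|] := eqVneq y x.
  rewrite !subrr normr0 mulr_ge0 ?powR_ge0 // addr_ge0 //; exact: mulr_ge0.
rewrite -subr_eq0 => /nrm_gt0 d0.
have [d1|d1] := leP (nrm (y - x)) 1.
  apply: le_trans (base y) _; move: (nrm (y - x)) d0 d1 => d d0 d1.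
  have d01 : 0 < d <= 1 by rewrite d0.
  have h1 : d `^ (2 * alpha) <= d `^ alpha by exact: ger_powR.
  have h2 : d <= d `^ alpha.
    by rewrite -[leLHS](powRr1 (ltW d0)); apply: ger_powR => //; exact: ltW.
  have h3 := ler_wpM2l M0 h1; have h4 := ler_wpM2l M0 h2.
  have h5 : 0 <= M * d `^ alpha by rewrite mulr_ge0 // powR_ge0.
  have h6 : 0 <= S * d `^ alpha by rewrite mulr_ge0 // powR_ge0.
  rewrite [leRHS]mulrDl -[6 * M * _]mulrA -[2 * S * _]mulrA; move: h3 h4 h5 h6.
  move: (M * d) (M * d `^ alpha) (M * d `^ (2 * alpha)) (S * d `^ alpha) => p q r t; clear; lra.
have [m [j [h1 h2]]] := cell_translate x y.
have n2 := nrm_cell h1 h2.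
have := base (translate m j y); rewrite periodic2_translate // => /le_trans; apply.
have D1 : 1 <= nrm (y - x) `^ alpha.
  rewrite -[leLHS](powRr0 (nrm (y - x))); apply: ler_powR; exact: ltW.
have pow2 (p : R) : 0 <= p <= 2 -> nrm (translate m j y - x) `^ p <= 2 `^ p.
  by move=> /andP[p0 p2]; rewrite ge0_ler_powR ?nnegrE ?nrm_ge0.
have P1 : nrm (translate m j y - x) `^ (2 * alpha) <= 4.
  have -> : 4 = 2 `^ 2 :> R by rewrite powR_mulrn //; ring.
  apply: le_trans (pow2 _ _) _.
    by rewrite al20 -[leRHS]mulr1; apply: ler_wpM2l => //; exact: ltW.
  apply: ler_powR; first by rewrite ler1n.
  by rewrite -[leRHS]mulr1; apply: ler_wpM2l => //; exact: ltW.
have P2 : nrm (translate m j y - x) `^ alpha <= 2.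
  apply: le_trans (pow2 _ _) _; first by rewrite (ltW al0) (le_trans (ltW al1)) // ler1n.
  by rewrite -[leRHS](@powRr1 _ 2) //; apply: ler_powR; [rewrite ler1n|exact: ltW].
apply: (@le_trans _ _ (M * 4 + S * 2 + M * 2)).
  by apply: lerD; [apply: lerD|]; apply: ler_wpM2l.
apply: (@le_trans _ _ ((6 * M + 2 * S) * 1)).
  by rewrite mulr1; move: M S {hR M0 S0 SE base hnu} => M S; lra.
apply: ler_wpM2l => //; apply: addr_ge0; exact: mulr_ge0.
Qed.

Lemma derive_convol2 w k b1 b2 : meas2 w -> bounded2 w -> schwartz k ->
  'D_(e_ R b1) ('D_(e_ R b2) (convol w k)) = convol w ('D_(e_ R b1) ('D_(e_ R b2) k)).
Proof.
move=> mw bw sk; rewrite (derive_convol b2 mw bw sk).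
exact: (derive_convol b1 mw bw (schwartz_D b2 sk)).
Qed.

Lemma convol_heat w k (a0 : R) x : meas2 w -> bounded2 w -> schwartz k ->
  convol w (heat a0 k) x = 'D_(e_ R true) (convol w k) x -
    a0 * 'D_(e_ R false) ('D_(e_ R false) (convol w k)) x.
Proof.
move=> mw bw sk; have s11 := schwartz_D false (schwartz_D false sk).
have /= -> := congr1 (fun F => F x) (derive_convol2 false false mw bw sk).
have /= -> := congr1 (fun F => F x) (derive_convol true mw bw sk).
rewrite heat_lin conv_linr //; try exact: schwartz_intg.
  by rewrite mulNr addrC.
exact/schwartz_intg/schwartz_D.
Qed.

(** The constant may depend on [x]: in the application it contains the values [sigma i x], for which
    no uniform bound is available. *)
Lemma holder_continuous (f : R * R -> R) (alpha : R) : 0 < alpha ->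
  (forall x, exists H : R, forall y, `|f y - f x| <= H * nrm (y - x) `^ alpha) -> continuous f.
Proof.
move=> al0 hf x; have [H hH] := hf x; apply/cvgrPdist_lt => e e0.
have H1 : 0 < `|H| + 1 by rewrite ltr_wpDl.
have d0 : 0 < (e / (`|H| + 1)) `^ alpha^-1 by apply: powR_gt0; rewrite divr_gt0.
have cn : nrm (y - x) @[y --> x] --> (0 : R).
  have n0 : nrm (x - x) = 0 by rewrite subrr /nrm /= normr0 sqrtr0 addr0.
  have hs : (y - x) @[y --> x] --> x - x by apply: cvgB; [exact: cvg_id|exact: cvg_cst].
  have := cvg_comp _ _ hs (@continuous_nrm R (x - x)); rewrite n0; exact.
near=> y; rewrite distrC; apply: le_lt_trans (hH y) _.
have yd : nrm (y - x) < (e / (`|H| + 1)) `^ alpha^-1.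
  near: y; move/cvgrPdist_lt: cn => /(_ _ d0); apply: filterS => y.
  by rewrite sub0r normrN ger0_norm // nrm_ge0.
have yd' : nrm (y - x) `^ alpha < e / (`|H| + 1).
  rewrite -[ltRHS]powRr1 ?divr_ge0 ?(ltW e0) ?(ltW H1) //.
  rewrite -[X in _ < _ `^ X](mulVf (lt0r_neq0 al0)) powRrM.
  by apply: gt0_ltr_powR; rewrite ?nnegrE ?nrm_ge0 // powR_ge0.
apply: (@le_lt_trans _ _ ((`|H| + 1) * nrm (y - x) `^ alpha)).
  by apply: ler_wpM2r; [exact: powR_ge0|rewrite (le_trans (ler_norm H)) // lerDl].
by rewrite mulrC -ltr_pdivlMr.
Unshelve. all: by end_near. Qed.

(** The kernel [d_1^2] of the mollifier has mean zero, so [u z] may be subtracted. Increments are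
    taken from the base point [z] only, since the Hoelder constant of a modelled [u] varies with the
    base point. *)
Lemma second_derivative_bound u k z (alpha s H : R) : cperiodic u -> schwartz k ->
  0 < s -> 0 < alpha < 1 -> 0 <= H ->
  (forall y, `|u y - u z| <= H * nrm (y - z) `^ alpha) ->
  `|'D_(e_ R false) ('D_(e_ R false) (convol u (scal s (s ^+ 2) k))) z| <=
    mom ('D_(e_ R false) ('D_(e_ R false) k)) * H * s `^ (alpha - 2).
Proof.
move=> gu sk s0 /andP[al0 al1] H0 hu.
have mu := cperiodic_meas gu; have bu := cperiodic_bounded gu.
have s20 : 0 < s ^+ 2 by rewrite exprn_gt0.
have S1 := schwartz_scal s0 s20 sk.
have s11 := schwartz_D false (schwartz_D false sk).
have /= -> := congr1 (fun F => F z) (etrans (derive_convol2 false false mu bu S1)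
  (congr1 (convol u) (scal_DD false false s0 s20 sk))).
rewrite (convol_Z _ _ mu bu (schwartz_intg (schwartz_scal s0 s20 s11))).
have mu' := subcst_meas2 (u z) mu; have bu' := subcst_bounded2 (u z) bu.
have := conv_subcst (u z) z mu bu (schwartz_intg (schwartz_scal s0 s20 s11)).
rewrite (integral_scal1 s0 s20 s11) integral_D; last exact: schwartz_D.
rewrite mulr0 subr0 => <-.
have ss1 : 0 < s <= 1 * s by rewrite s0 mul1r lexx.
have ss2 : 0 < s ^+ 2 <= (1 * s) ^+ 2 by rewrite s20 mul1r lexx.
have al02 : 0 <= alpha <= 2 by rewrite (ltW al0) (le_trans (ltW al1)) // ler1n.
have hw y : `|u (z - y) - u z| <= 0 + H * nrm y `^ alpha.
  by rewrite add0r -[nrm y]nrmN -[X in nrm X](addrK z (- y)) [- y + z]addrC; exact: hu.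
have := convol_scal_bound mu' bu' s11 ss1 ss2 al02 (lexx 0) H0 hw.
rewrite add0r mul1r; move: (convol _ _ _) (mom _) => X m hX; rewrite /sel.
rewrite normrM ger0_norm; last by rewrite -invfM invr_ge0 mulr_ge0 // ltW.
have sa : s `^ (alpha - 2) = s `^ alpha * (s^-1 * s^-1).
  rewrite powRD ?(gt_eqF s0) ?implybT // powRN powR_mulrn ?(ltW s0) //.
  by rewrite expr2 invfM.
rewrite sa; have -> : m * H * (s `^ alpha * (s^-1 * s^-1)) = s^-1 * s^-1 * (H * s `^ alpha * m) by ring.
by apply: ler_wpM2l => //; rewrite -invfM invr_ge0 mulr_ge0 // ltW.
Qed.

Lemma modelled_estimate (psi : R * R -> R) (lam alpha : R) : gauss4 psi ->
  0 < lam <= 1 -> 2^-1 < alpha < 1 ->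
  exists2 C : R, 0 <= C & forall (n : nat) u (a : R * R -> R)
    (v : 'I_n -> R -> R * R -> R) (sigma : 'I_n -> R * R -> R)
    (g : 'I_n -> R -> R -> R * R -> R) (m : 'I_n -> R -> R -> R)
    (Nf : 'I_n -> R) (nu : R * R -> R) (M : R),
  periodic2 u -> (forall x, lam <= a x <= lam^-1) -> (forall i, 0 <= Nf i) -> 0 <= M ->
  (forall i b, lam <= b <= lam^-1 -> cperiodic (v i b)) ->
  (forall i b (s : R) z, lam <= b <= lam^-1 -> 0 < s <= 1 ->
     convol (v i b) (heat b (scal s (s ^+ 2) psi)) z = g i b s z - m i b s) ->
  (forall i b (s : R) z, lam <= b <= lam^-1 -> 0 < s <= 1 ->
     `|g i b s z| <= Nf i * s `^ (alpha - 2)) ->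
  (forall i b b' (s : R) z, lam <= b <= lam^-1 -> lam <= b' <= lam^-1 -> 0 < s <= 1 ->
     `|g i b' s z - g i b s z| <= Nf i * s `^ (alpha - 2) * `|b' - b|) ->
  (forall x y, `|u y - u x - \sum_(i < n) sigma i x * (v i (a x) y - v i (a x) x) - nu x * (y - x).1|
     <= M * nrm (y - x) `^ (2 * alpha)) ->
  (forall x y, `|u y - u x| <= C * (M + \sum_(i < n) Nf i * `|sigma i x|) * nrm (y - x) `^ alpha) /\
  (forall (K : R) (c : R -> R), 0 <= K ->
    (forall (s : R) z, 0 < s <= 1 ->
      `|'D_(e_ R true) (convol u (scal s (s ^+ 2) psi)) z -
        (a z * 'D_(e_ R false) ('D_(e_ R false) (convol u (scal s (s ^+ 2) psi))) z +
         \sum_(i < n) sigma i z * g i (a z) s z - c s)| <= K * s `^ (2 * alpha - 2)) ->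
    (forall x z, `|a z - a x| * M <= K * nrm (z - x) `^ alpha) ->
    (forall x z, `|a z - a x| * \sum_(i < n) Nf i * `|sigma i z| <= K * nrm (z - x) `^ alpha) ->
    (forall x z, \sum_(i < n) Nf i * (`|sigma i z - sigma i x| + `|sigma i x| * `|a z - a x|)
       <= K * nrm (z - x) `^ alpha) ->
    forall x y, `|u y - u x - \sum_(i < n) sigma i x * (v i (a x) y - v i (a x) x) - nu x * (y - x).1|
     <= (C * K + M / 2) * nrm (y - x) `^ (2 * alpha)).
Proof.
move=> gp l01 /andP[ah al1]; have [sp _ _] := gp.
have al0 : 0 < alpha by apply: lt_trans ah; rewrite invr_gt0.
have al01 : 0 < alpha < 1 by rewrite al0.
have [CV CV0 hV] := holder_estimate gp l01 al01.
have g12 : 1 < 2 * alpha < 2.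
  by rewrite -[ltLHS](@divff _ 2) // ltr_pM2l // ah -[ltRHS]mulr1 ltr_pM2l.
have bg : 0 <= alpha < 2 * alpha by rewrite (ltW al0) mulr_natl mulr2n ltrDl.
(* With [b = alpha] and [g = 2 * alpha]: freezing the coefficients produces an error of size
   [nrm (z - x0) ^ alpha * s ^ (alpha - 2)], and the assumed equation one of size
   [s ^ (2 * alpha - 2)]. *)
have [CU CU0 hU] := schauder_estimate gp l01 g12 bg.
have [m11 [m110 m11E]] : exists m11 : R, 0 <= m11 /\ mom ('D_(e_ R false) ('D_(e_ R false) psi)) = m11.
  by exists (mom ('D_(e_ R false) ('D_(e_ R false) psi))); split => //; exact: mom_ge0.
have [C1 C1E] : exists C1 : R, C1 = 6 + 2 * CV by eexists.
have C10 : 0 <= C1 by rewrite C1E addr_ge0 // mulr_ge0.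
(* The equation contributes [K], freezing [sigma] and [f] another [K], and freezing [a] in front of
   the second derivative [2 * m11 * C1 * K]. *)
have [C2 C2E] : exists C2 : R, C2 = CU * (2 + 2 * m11 * C1) by eexists.
have C20 : 0 <= C2 by rewrite C2E mulr_ge0 // addr_ge0 // mulr_ge0 // mulr_ge0.
exists (C1 + C2); first exact: addr_ge0.
move=> n u a v sigma g m Nf nu M pu la N0 M0 hv hg1 hg2 hg3 hR.
have hvH i b : lam <= b <= lam^-1 -> forall x y,
    `|v i b y - v i b x| <= CV * Nf i * nrm (y - x) `^ alpha.
  move=> lb; have [cv pv] := hv i b lb.
  apply: (hV b (v i b) (fun s => - m i b s)) => // s z s01.
  by rewrite opprK hg1 // subrK; exact: hg2.
have S0 x : 0 <= \sum_(i < n) Nf i * `|sigma i x| by rewrite sumr_ge0 // => i _; rewrite mulr_ge0.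
have hu x y : `|u y - u x| <= C1 * (M + \sum_(i < n) Nf i * `|sigma i x|) * nrm (y - x) `^ alpha.
  apply: le_trans (modelled_holder al01 pu (fun i => proj2 (hv i _ (la x))) CV0 N0 M0
    (fun i y => hvH i _ (la x) x y) (hR x) y) _.
  apply: ler_wpM2r; first exact: powR_ge0.
  have := S0 x; move: (\sum_(i < n) _) => S hS.
  rewrite C1E -subr_ge0.
  have -> : (6 + 2 * CV) * (M + S) - (6 * M + 2 * (CV * S)) = 6 * S + 2 * CV * M by ring.
  by rewrite addr_ge0 // mulr_ge0 // mulr_ge0.
split.
  move=> x y; apply: le_trans (hu x y) _; apply: ler_wpM2r; first exact: powR_ge0.
  by apply: ler_wpM2r; [exact: addr_ge0|rewrite lerDl].
move=> K c K0 hN h2 h3 h4 x0 y.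
(* Continuity of [u] is a consequence of the modelling: the increments are Hoelder at each base
   point. *)
have cu : continuous u.
  by apply: (holder_continuous al0) => x; exists (C1 * (M + \sum_(i < n) Nf i * `|sigma i x|)).
have gu : cperiodic u by [].
have mu := cperiodic_meas gu; have bu := cperiodic_bounded gu.
have gv i : cperiodic (v i (a x0)) by exact: hv.
pose w y := -1 * (\sum_(i < n) sigma i x0 * v i (a x0) y) + u y.
have [cw pw] : cperiodic w.
  by apply: cperiodic_lin => //; apply: (cperiodic_sum _ (sigma^~ x0)).
have wE z : w z - w x0 - nu x0 * (z - x0).1 =
    u z - u x0 - \sum_(i < n) sigma i x0 * (v i (a x0) z - v i (a x0) x0) - nu x0 * (z - x0).1.
  have -> : \sum_(i < n) sigma i x0 * (v i (a x0) z - v i (a x0) x0) =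
     \sum_(i < n) sigma i x0 * v i (a x0) z - \sum_(i < n) sigma i x0 * v i (a x0) x0.
    by rewrite -sumrB; apply: eq_bigr => i _; rewrite mulrBr.
  by rewrite /w; move: (\sum_(i < n) _) (\sum_(i < n) _) => A B; ring.
have [K' K'E] : exists K' : R, K' = (2 + 2 * m11 * C1) * K by eexists.
have K'0 : 0 <= K' by rewrite K'E mulr_ge0 // addr_ge0 // mulr_ge0 // mulr_ge0.
rewrite -wE; apply: (@le_trans _ _ ((CU * K' + M / 2) * nrm (y - x0) `^ (2 * alpha))); last first.
  apply: ler_wpM2r; first exact: powR_ge0.
  rewrite lerD2r K'E mulrA -C2E; apply: ler_wpM2r => //; by rewrite lerDr.
apply: (hU (a x0) w (fun s => - c s + \sum_(i < n) sigma i x0 * m i (a x0) s)) => //; last first.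
  by move=> z; rewrite wE; exact: hR.
move=> s z s01; have /andP[s0 s1] := s01.
have s20 : 0 < s ^+ 2 by rewrite exprn_gt0.
have sk := schwartz_scal s0 s20 sp; have skh := schwartz_heat (a x0) sk.
have eW : convol w (heat (a x0) (scal s (s ^+ 2) psi)) z =
    'D_(e_ R true) (convol u (scal s (s ^+ 2) psi)) z -
    a x0 * 'D_(e_ R false) ('D_(e_ R false) (convol u (scal s (s ^+ 2) psi))) z -
    \sum_(i < n) sigma i x0 * (g i (a x0) s z - m i (a x0) s).
  have gs := cperiodic_sum (index_enum 'I_n) (sigma^~ x0) gv.
  rewrite conv_linl //; try exact: schwartz_intg.
  - rewrite (convol_sum _ (sigma^~ x0) _ gv (schwartz_intg skh)) convol_heat // mulN1r addrC.
    by congr (_ - _); apply: eq_bigr => i _; rewrite hg1.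
  - exact: cperiodic_meas gs.
  - exact: cperiodic_bounded gs.
have hN' := hN s z s01.
have hD := second_derivative_bound gu sp s0 al01 (mulr_ge0 C10 (addr_ge0 M0 (S0 z))) (hu z).
rewrite m11E in hD.
rewrite eW; move: hN' hD; move: ('D_(e_ R true) _ z) ('D_(e_ R false) ('D_(e_ R false) _) z) => D2 D11 hN' hD {eW}.
have [A0 AE] : exists A : R, A = \sum_(i < n) sigma i x0 * g i (a x0) s z by eexists.
have [B0 BE] : exists B : R, B = \sum_(i < n) sigma i x0 * m i (a x0) s by eexists.
have [A1 A1E] : exists A : R, A = \sum_(i < n) sigma i z * g i (a z) s z by eexists.
rewrite -BE; rewrite -A1E in hN'.
have -> : \sum_(i < n) sigma i x0 * (g i (a x0) s z - m i (a x0) s) = A0 - B0.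
  by rewrite AE BE -sumrB; apply: eq_bigr => i _; rewrite mulrBr.
have sp0 : 0 <= s `^ (alpha - 2) by exact: powR_ge0.
have h5 : `|A1 - A0| <= K * nrm (z - x0) `^ alpha * s `^ (alpha - 2).
  rewrite A1E AE -sumrB; apply: le_trans (ler_norm_sum _ _ _) _.
  apply: le_trans (ler_wpM2r sp0 (h4 x0 z)); rewrite mulr_suml; apply: ler_sum => i _.
  have -> : sigma i z * g i (a z) s z - sigma i x0 * g i (a x0) s z =
    (sigma i z - sigma i x0) * g i (a z) s z + sigma i x0 * (g i (a z) s z - g i (a x0) s z) by ring.
  apply: le_trans (ler_normD _ _) _; rewrite !normrM.
  have -> : Nf i * (`|sigma i z - sigma i x0| + `|sigma i x0| * `|a z - a x0|) * s `^ (alpha - 2) =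
    `|sigma i z - sigma i x0| * (Nf i * s `^ (alpha - 2)) +
    `|sigma i x0| * (Nf i * s `^ (alpha - 2) * `|a z - a x0|) by ring.
  by apply: lerD; apply: ler_wpM2l => //; [exact: hg2|exact: hg3].
(* The second derivative at [z] is bounded by the Hoelder constant of [u] at [z], not at [x0]; this
   is why [h3] carries [sigma i z]. *)
have h6 : `|(a z - a x0) * D11| <= m11 * C1 * (2 * K * nrm (z - x0) `^ alpha) * s `^ (alpha - 2).
  rewrite normrM; apply: le_trans (ler_wpM2l (normr_ge0 _) hD) _.
  have -> : `|a z - a x0| * (m11 * (C1 * (M + \sum_(i < n) Nf i * `|sigma i z|)) * s `^ (alpha - 2)) =
    m11 * C1 * (`|a z - a x0| * M + `|a z - a x0| * \sum_(i < n) Nf i * `|sigma i z|) * s `^ (alpha - 2).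
    by move: (\sum_(i < n) _) => Z; ring.
  apply: ler_wpM2r => //; apply: ler_wpM2l; first exact: mulr_ge0.
  apply: le_trans (lerD (h2 x0 z) (h3 x0 z)) _.
  by rewrite -mulrA mulr_natl mulr2n.
have -> : D2 - a x0 * D11 - (A0 - B0) - (- c s + B0) =
  (D2 - (a z * D11 + A1 - c s)) + (a z - a x0) * D11 + (A1 - A0) by ring.
apply: le_trans (ler_normD _ _) _.
apply: le_trans (lerD (ler_normD _ _) (lexx _)) _.
apply: le_trans (lerD (lerD hN' h6) h5) _.
have -> : 2 * alpha - 2 - alpha = alpha - 2 by ring.
have sg0 : 0 <= s `^ (2 * alpha - 2) by exact: powR_ge0.
have d0 : 0 <= nrm (z - x0) `^ alpha by exact: powR_ge0.
rewrite K'E; move: (nrm _ `^ _) (s `^ (2 * alpha - 2)) (s `^ (alpha - 2)) d0 sg0 sp0 => d P Q d0 P0 Q0.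
rewrite -subr_ge0.
have -> : (2 + 2 * m11 * C1) * K * (d * Q + P) - (K * P + m11 * C1 * (2 * K * d) * Q + K * d * Q) =
  (1 + 2 * m11 * C1) * K * P + K * (d * Q) by ring.
apply: addr_ge0; last by apply: mulr_ge0 => //; exact: mulr_ge0.
apply: mulr_ge0 => //; apply: mulr_ge0 => //; apply: addr_ge0 => //.
by apply: mulr_ge0 => //; exact: mulr_ge0.
Qed.

End Modelled.

(** * Extended-real seminorms and the conclusion *)

Section Seminorms.
Variable R : realType.
Implicit Types (f u a : R * R -> R) (x y z : R * R).

Lemma neq0e : (0 : R * R) <> e_ R false.
Proof. by case=> /eqP; rewrite eq_sym oner_eq0. Qed.

Lemma holder_semi_ub (alpha : R) f x y : x <> y ->
  ((`|f y - f x| / nrm (y - x) `^ alpha)%:E <= holder_semi alpha f)%E.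
Proof.
by move=> xy; apply: ereal_sup_ubound; exists (y, x) => //= h; exact: xy.
Qed.

Lemma holder_semi_ge0 (alpha : R) f : (0 <= holder_semi alpha f)%E.
Proof.
have h := holder_semi_ub alpha f (@neq0e); apply: (@le_trans _ _ _ _ _ _ h).
by rewrite lee_fin divr_ge0 // powR_ge0.
Qed.

Lemma supnorm_ub f x : (`|f x|%:E <= supnorm f)%E.
Proof. by apply: ereal_sup_ubound; exists x. Qed.

Lemma supnorm_ge0 f : (0 <= supnorm f)%E.
Proof. by apply: (@le_trans _ _ _ _ _ _ (supnorm_ub f 0)); rewrite lee_fin. Qed.

End Seminorms.

Theorem lemma3p6 (R : realType) (alpha lambda : R)
    (halpha : 2^-1 < alpha < 1) (hlambda : 0 < lambda <= 1) :
  exists C : R,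
    forall (psi : R -> R * R -> R) (n : nat)
      (f df : 'I_n -> R -> functional R) (Nf : 'I_n -> R)
      (v : 'I_n -> R * R -> R -> R)
      (u a : R * R -> R) (sigma : 'I_n -> R * R -> R) (M N : R),
    is_kernel psi ->
    (forall (i : 'I_n) (a0 : R), a0 \in `[lambda, lambda^-1] ->
       periodic_distribution (f i a0) /\ periodic_distribution (df i a0)) ->
    (forall i : 'I_n, is_family_derivative lambda (f i) (df i)) ->
    (forall i : 'I_n,
       (neg_norm1 psi lambda alpha (f i) (df i) <= (Nf i)%:E)%E) ->
    (forall (i : 'I_n) (a0 : R), a0 \in `[lambda, lambda^-1] ->
       solves a0 (f i a0) (fun x => v i x a0)) ->
    periodic2 u -> periodic2 a -> (forall i : 'I_n, periodic2 (sigma i)) ->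
    (forall x : R * R, a x \in `[lambda, lambda^-1]) ->
    modelled_with_constant alpha u v a sigma M ->
    (scale_sup (2 - 2 * alpha) (fun T x => (
       d2 (mollify psi (dist_of_fun u) T) x
       - proj0 (fun z =>
           a z * d1 (d1 (mollify psi (dist_of_fun u) T)) z
           + \sum_(i < n) sigma i z * mollify psi (f i (a z)) T z) x)%R)
     <= (N ^+ 2)%:E)%E ->
    (M%:E <= C%:E * ((N ^+ 2)%:E + holder_semi alpha a * M%:E
       + \sum_(i < n) (Nf i)%:E *
           (holder_semi alpha (sigma i) + supnorm (sigma i) * holder_semi alpha a)))%E /\
    (holder_semi alpha u <= C%:E *
       (M%:E + \sum_(i < n) (Nf i)%:E * supnorm (sigma i)))%E.
Proof.
(* The constant has to be fixed before [psi]. It is computed from some kernel [psi0] with the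
   prescribed transform, with which every admissible [psi 1] coincides; if there is none, no [psi]
   satisfies [is_kernel]. *)
have [[psi0 gp0]|nok] := pselect (exists p : R * R -> R, gauss4 p); last first.
  by exists 0 => psi n f df Nf v u a sigma M N /gauss4_kernel gp; case: nok; exists (psi 1).
have [C C0 hC] := modelled_estimate gp0 hlambda halpha.
have /andP[l0 l1] := hlambda.
have ll : lambda \in `[lambda, lambda^-1].
  by rewrite in_itv /= lexx /= (le_trans l1) // invf_ge1.
(* Absorbing [M / 2] turns [C] into [2 * C]; the added 1 makes the constant positive, so that its
   product with an infinite right-hand side is infinite. *)
exists (1 + 2 * C) => psi n f df Nf v u a sigma M N hp _ hdf hNf hv pu _ _ ha [nu hM] hN.
have e1 : psi 1 = psi0 by apply: gauss4_unique gp0; exact: gauss4_kernel.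
have C10 : 0 < 1 + 2 * C by rewrite ltr_wpDr // mulr_ge0.
have N0 i : 0 <= Nf i.
  have s1 : (0 < (1 : R)) && ((1 : R) <= 1) by rewrite ltr01 lexx.
  have [h _] := neg_norm1P (hNf i) ll 0 s1.
  by move: h; rewrite powR1 mulr1; exact: le_trans.
have hub x y : x <> y -> `|u y - u x - \sum_(i < n) sigma i x * (v i y (a x) - v i x (a x))
    - nu x * (y - x).1| <= M * nrm (y - x) `^ (2 * alpha).
  move=> xy; have d0 : 0 < nrm (y - x) `^ (2 * alpha).
    by apply: powR_gt0; apply: nrm_gt0; rewrite subr_eq0 eq_sym; exact/eqP.
  have : (((nrm (y - x) `^ (2 * alpha))^-1 * `|u y - u x - \sum_(i < n) sigma i x *
     (v i y (a x) - v i x (a x)) - nu x * (y - x).1|)%:E <= M%:E)%E.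
    by rewrite -hM; apply: ereal_sup_ubound; exists (x, y).
  by rewrite lee_fin mulrC ler_pdivrMr.
have M0 : 0 <= M.
  have := hub _ _ (@neq0e R) => /(le_trans (normr_ge0 _)).
  by rewrite pmulr_lge0 // powR_gt0 // nrm_gt0 // subr0; apply/eqP => /esym; exact: neq0e.
have hR x y : `|u y - u x - \sum_(i < n) sigma i x * (v i y (a x) - v i x (a x))
    - nu x * (y - x).1| <= M * nrm (y - x) `^ (2 * alpha).
  have [<-|/eqP/hub //] := eqVneq x y.
  rewrite big1 => [|i _]; last by rewrite subrr mulr0.
  by rewrite !subrr mulr0 !subr0 normr0 mulr_ge0 // powR_ge0.
have la x : lambda <= a x <= lambda^-1 by have := ha x; rewrite in_itv.
have hmoll F s x : 0 < s -> mollify psi F (s ^+ 4) x = dist_conv F (scal s (s ^+ 2) psi0) x.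
  by move=> s0; rewrite /mollify kernel_scal // e1.
have hmain := hC n u a (fun i b x => v i x b) sigma
  (fun i b s z => mollify psi (f i b) (s ^+ 4) z)
  (fun i b s => dist_mean (f i b) * integral2 (scal s (s ^+ 2) psi0)) Nf nu M pu la N0 M0.
have hk s : 0 < s -> schwartz (scal s (s ^+ 2) psi0).
  by have [sp _ _] := gp0; move=> s0; apply: schwartz_scal => //; rewrite exprn_gt0.
have Hv i b : lambda <= b <= lambda^-1 -> solves b (f i b) (fun x => v i x b).
  by move=> lb; apply: hv; rewrite in_itv.
have H1 i b : lambda <= b <= lambda^-1 -> cperiodic (fun x => v i x b).
  by move=> lb; have [cv pv _ _] := Hv i b lb.
have H2 i b (s : R) z : lambda <= b <= lambda^-1 -> 0 < s <= 1 ->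
   convol (fun x => v i x b) (heat b (scal s (s ^+ 2) psi0)) z =
   mollify psi (f i b) (s ^+ 4) z - dist_mean (f i b) * integral2 (scal s (s ^+ 2) psi0).
  by move=> lb /andP[s0 _]; rewrite hmoll // (solves_convol (Hv i b lb) (hk s s0)).
have H3 i b (s : R) z : lambda <= b <= lambda^-1 -> 0 < s <= 1 ->
   `|mollify psi (f i b) (s ^+ 4) z| <= Nf i * s `^ (alpha - 2).
  move=> lb s01; have lb' : b \in `[lambda, lambda^-1] by rewrite in_itv.
  by have [] := neg_norm1P (hNf i) lb' z s01.
have H4 i b b' (s : R) z : lambda <= b <= lambda^-1 -> lambda <= b' <= lambda^-1 -> 0 < s <= 1 ->
   `|mollify psi (f i b') (s ^+ 4) z - mollify psi (f i b) (s ^+ 4) z| <=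
     Nf i * s `^ (alpha - 2) * `|b' - b|.
  move=> lb lb' s01; apply: (mollify_lipschitz hp (hdf i) (hNf i) _ s01); by rewrite in_itv.
have {hmain} [hu hr] := hmain H1 H2 H3 H4 hR.
have S0 x : 0 <= \sum_(i < n) Nf i * `|sigma i x|.
  by rewrite sumr_ge0 // => i _; rewrite mulr_ge0.
split; last first.
  apply: ub_ereal_sup => _ [[y x] /= yx <-].
  have xy0 : 0 < nrm (y - x) `^ alpha.
    by apply: powR_gt0; apply: nrm_gt0; rewrite subr_eq0; exact/eqP.
  apply: (@le_trans _ _ ((1 + 2 * C) * (M + \sum_(i < n) Nf i * `|sigma i x|))%:E).
    rewrite lee_fin cc_distE ler_pdivrMr //; apply: le_trans (hu x y) _.
    apply: ler_wpM2r; first exact: ltW.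
    apply: ler_wpM2r; first exact: addr_ge0.
    by move: C0; clear; lra.
  rewrite EFinM; apply: lee_wpmul2l; first by rewrite lee_fin ltW.
  rewrite EFinD; apply: leeD2l; rewrite -sumEFin; apply: lee_sum => i _.
  rewrite EFinM; apply: lee_wpmul2l; [by rewrite lee_fin|exact: supnorm_ub].
set KE := (_ + _ + _)%E.
have KE1 : (0 <= holder_semi alpha a * M%:E)%E.
  by apply: mule_ge0; [exact: holder_semi_ge0|rewrite lee_fin].
have KE2 i : (0 <= (Nf i)%:E * (holder_semi alpha (sigma i) + supnorm (sigma i) * holder_semi alpha a))%E.
  apply: mule_ge0; first by rewrite lee_fin.
  by apply: adde_ge0; [exact: holder_semi_ge0|apply: mule_ge0; [exact: supnorm_ge0|exact: holder_semi_ge0]].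
have KE3 : (0 <= \sum_(i < n) (Nf i)%:E * (holder_semi alpha (sigma i) + supnorm (sigma i) * holder_semi alpha a))%E.
  by apply: sume_ge0 => i _.
have KE4 : (0 <= (N ^+ 2)%:E)%E by rewrite lee_fin sqr_ge0.
have le1 : ((N ^+ 2)%:E <= KE)%E.
  by apply: (le_trans _ (leeDl _ KE3)); exact: leeDl.
have le2 : (holder_semi alpha a * M%:E <= KE)%E.
  by apply: (le_trans _ (leeDl _ KE3)); exact: leeDr.
have le3 : (\sum_(i < n) (Nf i)%:E * (holder_semi alpha (sigma i) + supnorm (sigma i) * holder_semi alpha a) <= KE)%E.
  by apply: leeDr; exact: adde_ge0.
(* An infinite right-hand side makes the bound trivial, and it cannot be [-oo]. A finite value [k]
   bounds each of the three nonnegative terms and serves as the [K] of the estimate. *)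
case: KE le1 le2 le3 => [k| |] le1 le2 le3; last first.
- by have := le_trans KE4 le1.
- by rewrite gt0_muley ?leey // lte_fin.
rewrite -EFinM lee_fin; rewrite lee_fin in le1.
have k0 : 0 <= k by apply: le_trans le1; exact: sqr_ge0.
have EU s : 0 < s -> mollify psi (dist_of_fun u) (s ^+ 4) = convol u (scal s (s ^+ 2) psi0).
  by move=> s0; rewrite /mollify kernel_scal // e1.
pose c s := cell_mean (fun z => a z * d1 (d1 (convol u (scal s (s ^+ 2) psi0))) z
  + \sum_(i < n) sigma i z * mollify psi (f i (a z)) (s ^+ 4) z).
have P1 (s : R) z : 0 < s <= 1 ->
    `|'D_(e_ R true) (convol u (scal s (s ^+ 2) psi0)) z -
      (a z * 'D_(e_ R false) ('D_(e_ R false) (convol u (scal s (s ^+ 2) psi0))) z +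
       \sum_(i < n) sigma i z * mollify psi (f i (a z)) (s ^+ 4) z - c s)| <= k * s `^ (2 * alpha - 2).
  move=> s01; have /andP[s0 _] := s01.
  have := scale_supP hN z s01; rewrite (EU s s0) => /le_trans; apply.
  by rewrite -(opprB 2 (2 * alpha)); apply: ler_wpM2r => //; exact: powR_ge0.
have quot x z (p : R) : x <> z -> p / nrm (z - x) `^ alpha <= k -> p <= k * nrm (z - x) `^ alpha.
  move=> xz; rewrite ler_pdivrMr // powR_gt0 // nrm_gt0 // subr_eq0 eq_sym; exact/eqP.
have kd0 x z : 0 <= k * nrm (z - x) `^ alpha by rewrite mulr_ge0 // powR_ge0.
have Na0 p q : 0 <= p -> 0 <= q / p `^ alpha -> (0 <= (q / p `^ alpha)%:E)%E by rewrite lee_fin.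
have qa x z : 0 <= `|a z - a x| / nrm (z - x) `^ alpha by rewrite divr_ge0 // powR_ge0.
(* The product with [M] is kept: if [M = 0], the seminorm of [a] may be infinite although [k] is
   finite, by the convention [0 * +oo = 0]. *)
have P2 x z : `|a z - a x| * M <= k * nrm (z - x) `^ alpha.
  have [<-|/eqP xz] := eqVneq x z; first by rewrite subrr normr0 mul0r.
  apply: quot => //; rewrite -lee_fin mulrAC EFinM; apply: (le_trans _ le2).
  by apply: lee_wpmul2r; [rewrite lee_fin|exact: holder_semi_ub].
have P3 x z : `|a z - a x| * \sum_(i < n) Nf i * `|sigma i z| <= k * nrm (z - x) `^ alpha.
  have [<-|/eqP xz] := eqVneq x z; first by rewrite subrr normr0 mul0r.
  apply: quot => //; rewrite -lee_fin mulrAC mulr_sumr -sumEFin; apply: (le_trans _ le3).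
  apply: lee_sum => i _; rewrite mulrCA EFinM; apply: lee_wpmul2l; first by rewrite lee_fin.
  apply: (@le_trans _ _ (supnorm (sigma i) * holder_semi alpha a)%E); last first.
    by apply: leeDr; exact: holder_semi_ge0.
  rewrite mulrC EFinM; apply: lee_pmul; rewrite ?lee_fin //; [exact: supnorm_ub|exact: holder_semi_ub].
have P4 x z : \sum_(i < n) Nf i * (`|sigma i z - sigma i x| + `|sigma i x| * `|a z - a x|)
    <= k * nrm (z - x) `^ alpha.
  have [<-|/eqP xz] := eqVneq x z.
    by rewrite big1 // => i _; rewrite !subrr normr0 mulr0 addr0 mulr0.
  apply: quot => //; rewrite -lee_fin mulr_suml -sumEFin; apply: (le_trans _ le3).
  apply: lee_sum => i _; rewrite -mulrA EFinM; apply: lee_wpmul2l; first by rewrite lee_fin.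
  rewrite mulrDl EFinD; apply: leeD; first exact: holder_semi_ub.
  rewrite -mulrA EFinM; apply: lee_pmul; rewrite ?lee_fin //; [exact: supnorm_ub|exact: holder_semi_ub].
have {}hr := hr k c k0 P1 P2 P3 P4.
(* [M] is the supremum of the quotients just bounded, so the improved bound on all pairs is a bound
   on [M] itself; being finite, [M / 2] can be moved to the left. *)
have hMk : M <= C * k + M / 2.
  rewrite -lee_fin -[leLHS]hM; apply: ub_ereal_sup => _ [[x y] /= xy <-].
  have d0 : 0 < nrm (y - x) `^ (2 * alpha).
    by apply: powR_gt0; apply: nrm_gt0; rewrite subr_eq0 eq_sym; exact/eqP.
  by rewrite lee_fin cc_distE mulrC ler_pdivrMr //; exact: hr.
have Ck0 : 0 <= C * k by exact: mulr_ge0.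
by rewrite mulrDl mul1r -mulrA; move: (C * k) hMk k0 Ck0 => X; clear; lra.
Qed.
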